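(* Let $H$ be a fixed connected unicyclic graph and let $m(n)$ be integers with $m(n)=(1+o(1))n$. Then \[ \mathbf{P}[P_{n,m}\text{ has a subgraph isomorphic to } H]\to 1 \quad\text{as } n\to\infty. \]
   Context: $\mathcal{P}(n,m)$ denotes the set of all (simple, labelled) planar graphs on the vertex set $\{1,2,\ldots,n\}$ with exactly $m$ edges, and $P_{n,m}$ denotes a graph chosen uniformly at random from $\mathcal{P}(n,m)$. A connected graph $H$ is unicyclic if $e(H)=|H|$ (number of edges equals number of vertices), i.e. it contains exactly one cycle. A copy of $H$ means any (not necessarily induced) subgraph isomorphic to $H$. *)

(* Defs.v *)
From mathcomp Require Import all_boot all_order all_algebra.
From mathcomp Require Import all_classical all_reals all_analysis.
Import Order.TTheory GRing.Theory Num.Theory.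
Import numFieldNormedType.Exports.

Set Implicit Arguments.
Unset Strict Implicit.
Unset Printing Implicit Defensive.

Local Open Scope classical_set_scope.
Local Open Scope ring_scope.

(* A simple graph on the vertex set V is given by its set E of edges, each
   edge being the two-element set of its endpoints. *)
Definition simple_graph (V : finType) (E : {set {set V}}) : bool :=
  [forall e in E, #|e| == 2%N].

(* For a simple graph this is irreflexive, since [set x; x] is not an edge. *)
Definition adj (V : finType) (E : {set {set V}}) : rel V :=
  fun x y => [set x; y]%SET \in E.

Definition connected_graph (V : finType) (E : {set {set V}}) : bool :=
  (0 < #|V|)%N && [forall x, forall y, connect (adj E) x y].

Definition unicyclic (V : finType) (E : {set {set V}}) : bool :=
  connected_graph E && (#|E| == #|V|).

(* Copies are not required to be induced: only edges have to be preserved. *)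
Definition has_copy (V W : finType) (EH : {set {set V}}) (EG : {set {set W}})
    : bool :=
  [exists f : {ffun V -> W}, injectiveb f &&
    [forall x, forall y, adj EH x y ==> adj EG (f x) (f y)]].

(* Vertices are sent to distinct points of the plane and each edge e to a
   simple arc, parametrised by gamma e on [0, 1], that joins its endpoints;
   the interior of an arc meets neither a vertex nor the interior of another
   arc.  The values of gamma e outside [0, 1] are irrelevant. *)
Definition plane_drawing (R : realType) (V : finType) (E : {set {set V}})
    (p : V -> R * R) (gamma : {set V} -> R -> R * R) : Prop :=
  [/\ injective p,
      forall e, e \in E ->
        [/\ {within `[0, 1], continuous (gamma e)},
            {in `[0, 1] &, injective (gamma e)} &
            exists x y : V, [/\ e = [set x; y]%SET,
              gamma e 0 = p x & gamma e 1 = p y]],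
      forall e (v : V) (t : R), e \in E -> t \in `]0, 1[ ->
        gamma e t <> p v &
      forall e e' (s t : R), e \in E -> e' \in E -> e != e' ->
        s \in `]0, 1[ -> t \in `]0, 1[ -> gamma e s <> gamma e' t].

Definition planar (R : realType) (V : finType) (E : {set {set V}}) : Prop :=
  exists p gamma, @plane_drawing R V E p gamma.

(* The vertices 1, ..., n are represented by the elements 0, ..., n - 1
   of 'I_n. *)
Definition planar_graphs (R : realType) (n m : nat) :
    {set {set {set 'I_n}}} :=
  [set E : {set {set 'I_n}} |
    [&& simple_graph E, #|E| == m & `[< planar R E >]]]%SET.

(* The probability that a uniformly random element of S satisfies A; it is 0
   by convention when S is empty. *)
Definition prob_in (R : realType) (T : finType) (S : {set T})
    (A : pred T) : R :=
  #|[set x in S | A x]%SET|%:R / #|S|%:R.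

(* Main.v *)
(* Let h = |V(H)| and let G be the set of planar graphs with n vertices and m
   edges.  The graphs of G without a copy of H are shown to be rare by double
   counting switchings that preserve n and m; the switchings that create a copy
   of H rely on e(H) = |H|.

   - Few graphs have a linear number of isolated vertices: otherwise delete one
     of the edges and join two isolated vertices.  To recover the deleted edge
     one needs that most edges lie on a short closed chain or meet a vertex of
     large degree, which follows from Euler's formula as m is close to n.
   - Linearly many leaves: detach h of them, put a copy of H on h leaves of which
     one is still attached; this creates an isolated vertex.
   - Linearly many components that are cycles of length q <= h: replace h of them
     by q copies of H.
   - Otherwise the degree sum 2m, about 2n, forces a linear number of paths of
     length h through vertices of degree 2; replace the edges of such a path by a
     copy of H, hung at its first vertex, so that a new leaf marks its last one.

   A graph H is hung at a vertex of degree at most 1 of a plane drawing along an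
   order of its vertices in which no two edges interleave: H is drawn with its
   vertices on a small parabola arc.  A unicyclic graph has such an order.

   Instead of Euler's formula, the weaker inequality
     (e(E) - number of nonisolated vertices) * g <= 2 e(E)
   is used, g being a lower bound for the size of nonempty even edge sets.  It
   avoids the Jordan curve theorem: a drawing makes the graph a minor of a square
   grid, where an even chain is the boundary of a set of unit squares, so that
   the cycle space is generated by boundaries of classes of faces, each edge
   bordering at most two of them. *)
Require Import Defs.
From mathcomp Require Import all_boot.
From mathcomp Require Import zify.

Set Implicit Arguments.
Unset Strict Implicit.
Unset Printing Implicit Defensive.

(** * Graphs *)

(** Each switching comes with a code that makes (graph, tag) recoverable from the result, so a class
    is rare once its graphs have many more tags than the results have codes; everything depends on
    codes being cheap. A planted copy of H costs a constant: there was no copy before, so any copy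
    found afterwards meets the planted one, whose vertices have bounded degree. The balance is then
    as follows, with h = |V(H)|. Isolated vertices: order n^3 tags against n times the number of
    candidates for the deleted edge, so the candidates must be a small fraction of n^2. Leaves:
    order n^(h+1) tags against n^h former neighbours times one isolated vertex, and isolated
    vertices are few on average by the first case. Cycles: an unbounded number of tags against a
    bounded number of codes. Paths: order n tags against one leaf, in graphs where leaves are
    few. *)

Lemma simple_edge (V : finType) (E : {set {set V}}) (e : {set V}) :
  simple_graph E -> e \in E -> exists x y, x != y /\ e = [set x; y].
Proof.
move=> /forall_inP sE eE; have /cards2P[x [y [xy ->]]] := sE e eE.
by exists x, y.
Qed.

Lemma simple_sub (V : finType) (E F : {set {set V}}) :
  F \subset E -> simple_graph E -> simple_graph F.
Proof.
move=> /subsetP FE /forall_inP sE; apply/forall_inP => e eF.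
by apply: sE; apply: FE.
Qed.

Lemma adj_sym (V : finType) (E : {set {set V}}) : symmetric (adj E).
Proof. by move=> x y; rewrite /adj setUC. Qed.

Lemma adj_neq (V : finType) (E : {set {set V}}) x y :
  simple_graph E -> adj E x y -> x != y.
Proof.
move=> /forall_inP sE /sE; apply: contraTN => /eqP->.
by rewrite setUid cards1.
Qed.

Lemma adj_sub (V : finType) (E F : {set {set V}}) x y :
  F \subset E -> adj F x y -> adj E x y.
Proof. by move=> /subsetP FE /FE. Qed.

Definition nbrs (V : finType) (E : {set {set V}}) (x : V) : {set V} :=
  [set y | adj E x y].

Definition inc (V : finType) (E : {set {set V}}) (x : V) : {set {set V}} :=
  [set e in E | x \in e].

Lemma set2_inj (V : finType) (x y z : V) :
  [set x; y] = [set x; z] -> y = z.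
Proof.
move=> eq2; have : y \in [set x; z] by rewrite -eq2 set22.
have : z \in [set x; y] by rewrite eq2 set22.
by rewrite !inE => /orP[]/eqP -> // /orP[] /eqP ->.
Qed.

Lemma set2_eq (V : finType) (x y z t : V) :
  [set x; y] = [set z; t] -> (x = z /\ y = t) \/ (x = t /\ y = z).
Proof.
move=> eq2; have : x \in [set z; t] by rewrite -eq2 set21.
rewrite !inE => /orP[]/eqP ex; subst x; [left|right]; split=> //.
  exact: set2_inj eq2.
by apply: set2_inj (t) _ _ _; rewrite eq2 setUC.
Qed.

Lemma inc_nbrs (V : finType) (E : {set {set V}}) x :
  simple_graph E -> inc E x = [set [set x; y] | y in nbrs E x].
Proof.
move=> sE; apply/setP => e; rewrite !inE; apply/andP/imsetP.
  move=> [eE xe]; have [y [z [yz ee]]] := simple_edge sE eE.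
  move: xe; rewrite ee !inE => /orP[]/eqP xE; subst x.
    by exists z; rewrite // inE /adj -ee.
  by exists y; rewrite 1?inE /adj setUC // -ee.
by move=> [y]; rewrite inE => xy ->; rewrite set21.
Qed.

Lemma card_inc (V : finType) (E : {set {set V}}) x :
  simple_graph E -> #|inc E x| = #|nbrs E x|.
Proof.
move=> sE; rewrite inc_nbrs // card_in_imset // => y z _ _; exact: set2_inj.
Qed.

Lemma sum_card_inc (V : finType) (E : {set {set V}}) (U : {set V}) :
  \sum_(x in U) #|inc E x| = \sum_(e in E) #|e :&: U|.
Proof.
under eq_bigr => x _ do rewrite -sum1_card.
under [RHS]eq_bigr => e _ do rewrite -sum1_card.
rewrite (exchange_big_dep [in E]) /=; last by move=> x e _; rewrite inE => /andP[].
by apply: eq_bigr => e eE; apply: eq_bigl => x; rewrite !inE eE /= andbC.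
Qed.

Lemma handshake (V : finType) (E : {set {set V}}) :
  simple_graph E -> \sum_x #|nbrs E x| = #|E| * 2.
Proof.
move=> sE; under eq_bigr => x _ do rewrite -card_inc //.
have := sum_card_inc E setT; under eq_bigl => x do rewrite inE.
move=> ->; rewrite -sum_nat_const; apply: eq_bigr => e eE.
by rewrite setIT; apply/eqP; move/forall_inP: sE => /(_ e eE).
Qed.

Definition even_edges (V : finType) (F : {set {set V}}) : bool :=
  [forall x, ~~ odd #|inc F x|].

Definition imgraph (V W : finType) (f : V -> W) (H : {set {set V}}) : {set {set W}} :=
  [set f @: (e : {set V}) | e in H].

Lemma imset_set2 (V W : finType) (f : V -> W) x y : f @: [set x; y] = [set f x; f y].
Proof. by rewrite imsetU1 imset_set1. Qed.

Lemma imgraphP (V W : finType) (f : V -> W) (H : {set {set V}}) e :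
  simple_graph H -> e \in imgraph f H ->
  exists x y, adj H x y /\ e = [set f x; f y].
Proof.
move=> sH /imsetP[e' e'H ->]; have [x [y [_ ee]]] := simple_edge sH e'H.
by exists x, y; split; [rewrite /adj -ee|rewrite ee imset_set2].
Qed.

Lemma mem_imgraph (V W : finType) (f : V -> W) (H : {set {set V}}) x y :
  adj H x y -> [set f x; f y] \in imgraph f H.
Proof. by move=> xy; rewrite -imset_set2; apply: imset_f. Qed.

Lemma card_imgraph (V W : finType) (f : V -> W) (H : {set {set V}}) :
  injective f -> #|imgraph f H| = #|H|.
Proof. by move=> fI; rewrite card_imset //; apply: imset_inj. Qed.

Lemma simple_imgraph (V W : finType) (f : V -> W) (H : {set {set V}}) :
  injective f -> simple_graph H -> simple_graph (imgraph f H).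
Proof.
move=> fI /forall_inP sH; apply/forall_inP => _ /imsetP[e eH ->].
by rewrite card_imset //; apply: sH.
Qed.

Lemma simpleU (V : finType) (E F : {set {set V}}) :
  simple_graph E -> simple_graph F -> simple_graph (E :|: F).
Proof.
move=> /forall_inP sE /forall_inP sF; apply/forall_inP => e.
by rewrite inE => /orP[/sE|/sF].
Qed.

Lemma in_inc (V : finType) (E : {set {set V}}) x (e : {set V}) :
  (e \in inc E x) = (e \in E) && (x \in e).
Proof. by rewrite inE. Qed.

Definition noncrossing (V : finType) (H : {set {set V}}) (pos : V -> nat) : Prop :=
  forall x y x' y', adj H x y -> adj H x' y' ->
    ~~ [&& pos x < pos x', pos x' < pos y & pos y < pos y'].

Lemma odd_card_xor (T : finType) (A : {set T}) :
  odd #|A| = \big[addb/false]_(x in A) true.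
Proof. by rewrite -sum1_card (big_morph odd oddD (erefl _)). Qed.

Lemma odd_card_pred (T : finType) (A : {set T}) (P : pred T) :
  odd #|[set x in A | P x]| = \big[addb/false]_(x in A) P x.
Proof.
rewrite odd_card_xor big_mkcond [RHS]big_mkcond; apply: eq_bigr => x _.
by rewrite inE; case: (x \in A) => //=; case: (P x).
Qed.

(** The terms of (x, y) and (y, x) cancel. *)
Lemma xor_sym_sum (T : finType) (c : T -> T -> bool) (B : {set T}) :
  (forall x y, c x y = c y x) -> (forall x, c x x = false) ->
  \big[addb/false]_(x in B) \big[addb/false]_(y in B) c x y = false.
Proof.
move=> csym cirr; pose l := enum B.
have -> : \big[addb/false]_(x in B) \big[addb/false]_(y in B) c x y =
  \big[addb/false]_(x <- l) \big[addb/false]_(y <- l) c x y.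
  by rewrite -big_enum; apply: eq_bigr => x _; rewrite -big_enum.
elim: l => [|a l IH]; first by rewrite big_nil.
rewrite big_cons big_cons cirr /=.
under [X in _ (+) X]eq_bigr => x _ do rewrite big_cons.
rewrite big_split /= IH addbF.
by under [X in _ (+) X]eq_bigr => x _ do rewrite csym; rewrite addbb.
Qed.

(** * Chains of the square grid *)

Definition chain := nat * nat -> nat * nat -> bool.

(** Degree parity at x. At coordinate 0 the predecessor [.-1] is the coordinate itself, so the
    formula is meaningful only at points with positive coordinates. *)
Definition bd (c : chain) (x : nat * nat) : bool :=
  c x (x.1.+1, x.2) (+) c x (x.1.-1, x.2) (+)
  (c x (x.1, x.2.+1) (+) c x (x.1, x.2.-1)).

(** Counts mod 2 the horizontal edges met when descending from the unit square with lower left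
    corner (i, j), its bottom side included. *)
Definition fill (c : chain) (i j : nat) : bool :=
  \big[addb/false]_(k < j.+1) c (i, val k) (i.+1, val k).

Lemma fillS (c : chain) i j :
  fill c i j.+1 (+) fill c i j = c (i, j.+1) (i.+1, j.+1).
Proof. by rewrite /fill big_ord_recr /= addbAC addbb. Qed.

(* A chain without boundary is the boundary of the faces that a vertical ray
   reaches after crossing it an odd number of times. *)
Lemma fill_right (c : chain) i j :
  (forall x y, c x y = c y x) -> (forall x, 0 < x.1 -> 0 < x.2 -> ~~ bd c x) ->
  (forall x y, x.2 = 0 -> c x y = false) ->
  fill c i.+1 j (+) fill c i j = c (i.+1, j) (i.+1, j.+1).
Proof.
move=> csym bd0 c0; elim: j => [|j IH].
  by rewrite /fill !big_ord_recr !big_ord0 /= !c0.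
rewrite /fill big_ord_recr [X in _ (+) X]big_ord_recr /= addbACA.
rewrite -!/(fill _ _ _) IH.
have := bd0 (i.+1, j.+1) isT isT; rewrite /bd /=.
rewrite [c (i.+1, j.+1) (i, _)]csym [c (i.+1, j.+1) (_, j)]csym.
by do 4 case: (c _ _).
Qed.

Definition single (p q : nat * nat) : chain :=
  fun x y => ((x == p) && (y == q)) (+) ((x == q) && (y == p)).

Lemma single_sym p q x y : single p q x y = single p q y x.
Proof. by rewrite /single addbC andbC [X in _ (+) X]andbC. Qed.

Definition nadj (p q : nat * nat) : bool :=
  (p.1 == q.1) && ((p.2.+1 == q.2) || (q.2.+1 == p.2)) ||
  (p.2 == q.2) && ((p.1.+1 == q.1) || (q.1.+1 == p.1)).

Lemma nadj_sym p q : nadj p q = nadj q p.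
Proof. by rewrite /nadj; case: p q => [a b] [c d] /=; lia. Qed.

Lemma bd_single p q x : nadj p q ->
  0 < x.1 -> 0 < x.2 ->
  bd (single p q) x = (x == p) (+) (x == q).
Proof.
have sg a b y z : single a b y z = ((y == a) && (z == b)) (+) ((y == b) && (z == a)).
  by [].
move=> pq x10 x20; have npq : p != q.
  by apply: contraTneq pq => ->; rewrite /nadj !eqxx /=; lia.
have one a b : nadj a b -> 0 < a.1 -> 0 < a.2 ->
  ((a.1.+1, a.2) == b) (+) ((a.1.-1, a.2) == b) (+)
  (((a.1, a.2.+1) == b) (+) ((a.1, a.2.-1) == b)) = true.
  case: a b => [a1 a2] [b1 b2]; rewrite /nadj /= !xpair_eqE => + a10 a20.
  case: a1 a10 => // a1 _; case: a2 a20 => // a2 _ /=.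
  case/orP=> /andP[/eqP <- /orP[]/eqP]; [move=> <-|case=> ->|move=> <-|case=> ->].
  - rewrite eqxx; lia.
  - rewrite eqxx; lia.
  - rewrite eqxx; lia.
  - rewrite eqxx; lia.
rewrite /bd !sg; have [xp|xp] := eqVneq x p; have [xq|xq] := eqVneq x q => //=.
- by rewrite -xp -xq eqxx in npq.
- by subst x; rewrite !addbF one.
- by subst x; rewrite one // nadj_sym.
Qed.

Lemma bd_xor (c d : chain) x :
  bd (fun y z => c y z (+) d y z) x = bd c x (+) bd d x.
Proof. by rewrite /bd; do 8 case: (_ x _). Qed.

Lemma bd_sum (I : finType) (A : {set I}) (c : I -> chain) x :
  bd (fun y z => \big[addb/false]_(i in A) c i y z) x =
  \big[addb/false]_(i in A) bd (c i) x.
Proof. by rewrite /bd -!big_split. Qed.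

Definition pos_grid N (p : 'I_N * 'I_N) : nat * nat := (val p.1, val p.2).

Lemma pos_grid_inj N : injective (@pos_grid N).
Proof.
by move=> [a b] [c d] [/val_inj -> /val_inj ->].
Qed.

Definition gadj N (p q : 'I_N * 'I_N) : bool := nadj (pos_grid p) (pos_grid q).

Lemma gadj_sym N : symmetric (@gadj N).
Proof. by move=> p q; rewrite /gadj nadj_sym. Qed.

Definition inner_grid N (p : 'I_N * 'I_N) : bool :=
  [&& 0 < p.1, p.1.+1 < N, 0 < p.2 & p.2.+1 < N].

(* The vertices of the graph are the disjoint connected sets B v of grid points,
   and the edge e is represented by the grid edge from ra e to rb e. *)
Record grid_minor N (V : finType) (E : {set {set V}})
    (B : V -> {set 'I_N * 'I_N}) (ra rb : {set V} -> 'I_N * 'I_N) : Prop :=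
  GridMinor {
  gm_inner : forall v p, p \in B v -> inner_grid p;
  gm_disj : forall u v p, p \in B u -> p \in B v -> u = v;
  gm_conn : forall v p q, p \in B v -> q \in B v ->
    connect (fun x y => [&& gadj x y, x \in B v & y \in B v]) p q;
  gm_edge : forall e, e \in E -> gadj (ra e) (rb e) /\
    exists u v, [/\ e = [set u; v], ra e \in B u & rb e \in B v]
  }.

Lemma singleP p q x y :
  single p q x y -> (x = p /\ y = q) \/ (x = q /\ y = p).
Proof.
rewrite /single; case: andP => [[/eqP-> /eqP->] _|_ /= /andP[/eqP-> /eqP->]].
  by left.
by right.
Qed.

(** The chain is the mod 2 sum of the edges of a path from o to a, whose boundary telescopes. *)
Lemma path_chain N (B : {set 'I_N * 'I_N}) o a :
  connect (fun x y => [&& gadj x y, x \in B & y \in B]) o a ->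
  exists c : chain,
  [/\ forall x y, c x y = c y x,
      forall x y, c x y -> exists p q,
        [/\ gadj p q, p \in B, q \in B, x = pos_grid p & y = pos_grid q] &
      forall x, 0 < x.1 -> 0 < x.2 ->
        bd c x = (x == pos_grid o) (+) (x == pos_grid a)].
Proof.
move=> /connectP[s]; elim: s o => [|b s IH] o /=.
  move=> _ ->; exists (fun _ _ => false); split=> // x _ _.
  by rewrite addbb.
move=> /andP[/and3P[ob oB bB] /IH{}IH] /IH [c [csym csup cbd]].
exists (fun x y => single (pos_grid o) (pos_grid b) x y (+) c x y); split.
- by move=> x y; rewrite csym single_sym.
- move=> x y; have [cxy _|_] := boolP (c x y).
    by have [p [q [*]]] := csup x y cxy; exists p, q.
  rewrite addbF => /singleP[[-> ->]|[-> ->]]; first by exists o, b.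
  by exists b, o; rewrite gadj_sym.
- move=> x x10 x20; rewrite bd_xor bd_single // cbd //.
  by rewrite addbA -(addbA (x == pos_grid o)) addbb addbF.
Qed.

Section Lift.
Variables (N : nat) (V : finType) (E : {set {set V}}).
Variables (B : V -> {set 'I_N * 'I_N}) (ra rb : {set V} -> 'I_N * 'I_N).
Hypotheses (sE : simple_graph E) (gm : grid_minor E B ra rb).

(** For adjacent p and q: the grid edges that the model of the graph uses. Every other grid edge
    will merge the two squares on its sides. *)
Definition kept (p q : 'I_N * 'I_N) : bool :=
  [exists v, (p \in B v) && (q \in B v)] ||
  [exists e in E, ((p == ra e) && (q == rb e)) || ((p == rb e) && (q == ra e))].

Lemma kept_sym p q : kept p q = kept q p.
Proof.
rewrite /kept; congr (_ || _); apply: eq_existsb => z; first by rewrite andbC.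
by congr (_ && _); do 4 case: (_ == _).
Qed.

(* The edge of the grid that represents e is joined, inside the two branch sets
   of its ends, to their base points. *)
Lemma edge_chain : exists o : V -> nat * nat, forall e, exists c : chain,
  e \in E ->
  [/\ forall x y, c x y = c y x,
      forall x y, c x y -> exists p q,
        [/\ gadj p q, kept p q, x = pos_grid p & y = pos_grid q],
      forall x, 0 < x.1 -> 0 < x.2 ->
        bd c x = \big[addb/false]_(w in e) (x == o w) &
      forall e', e' \in E -> c (pos_grid (ra e')) (pos_grid (rb e')) = (e == e')].
Proof.
(* The ends of an edge have nonempty branch sets, so the default (0, 0) never arises for
   [e \in E]. *)
exists (fun v => if [pick p in B v] is Some p then pos_grid p else (0, 0)) => e.
have [eE|neE] := boolP (e \in E); last by exists (fun _ _ => false).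
have [rr [u [v [ee rau rbv]]]] := gm_edge gm eE.
have uv : u != v.
  by apply: contraTneq rr => uv; move/forall_inP: sE => /(_ e eE); rewrite ee uv setUid cards1.
have base w p : p \in B w -> exists c : chain,
  [/\ forall x y, c x y = c y x,
      forall x y, c x y -> exists p' q',
        [/\ gadj p' q', p' \in B w, q' \in B w, x = pos_grid p' & y = pos_grid q'] &
      forall x, 0 < x.1 -> 0 < x.2 ->
        bd c x = (x == (if [pick p in B w] is Some p then pos_grid p else (0, 0)))
                 (+) (x == pos_grid p)].
  move=> pB; case: pickP => [q qB|/(_ p)]; last by rewrite pB.
  exact: path_chain (gm_conn gm qB pB).
have [c1 [c1s c1p c1b]] := base u _ rau.
have [c2 [c2s c2p c2b]] := base v _ rbv.
exists (fun x y => single (pos_grid (ra e)) (pos_grid (rb e)) x y (+) (c1 x y (+) c2 x y)).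
move=> _; split.
- by move=> x y; rewrite c1s c2s single_sym.
- move=> x y; have [cxy _|_] := boolP (c1 x y).
    have [p [q [pq pB qB -> ->]]] := c1p x y cxy; exists p, q; split=> //.
    by apply/orP; left; apply/existsP; exists u; rewrite pB.
  have [cxy _|_] := boolP (c2 x y).
    have [p [q [pq pB qB -> ->]]] := c2p x y cxy; exists p, q; split=> //.
    by apply/orP; left; apply/existsP; exists v; rewrite pB.
  have kr : kept (ra e) (rb e).
    by apply/orP; right; apply/existsP; exists e; rewrite eE !eqxx.
  rewrite /= addbF => /singleP[[-> ->]|[-> ->]].
    by exists (ra e), (rb e).
  by exists (rb e), (ra e); rewrite gadj_sym kept_sym.
- move=> x x1 x2; rewrite bd_xor bd_single // bd_xor c1b // c2b //.
  rewrite ee big_setU1 ?inE //= big_set1.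
  by do 4 case: (x == _).
- move=> e' e'E; have [rr' [u' [v' [ee' rau' rbv']]]] := gm_edge gm e'E.
  have uv' : u' != v'.
    by apply: contraTneq rr => uv'; move/forall_inP: sE => /(_ e' e'E); rewrite ee' uv' setUid cards1.
  (* A chain inside one branch set misses all representing edges, whose ends lie in two different
     branch sets. *)
  have nc (c : chain) w : (forall x y, c x y -> exists p' q',
        [/\ gadj p' q', p' \in B w, q' \in B w, x = pos_grid p' & y = pos_grid q']) ->
        c (pos_grid (ra e')) (pos_grid (rb e')) = false.
    move=> cp; apply/negP => /cp [p [q [_ pB qB /pos_grid_inj ep /pos_grid_inj eq]]].
    case/negP: uv'; apply/eqP; subst p q.
    by rewrite (gm_disj gm rau' pB) (gm_disj gm rbv' qB).
  rewrite (nc _ _ c1p) (nc _ _ c2p) !addbF; apply/idP/eqP => [|<-].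
    case/singleP => -[/pos_grid_inj E1 /pos_grid_inj E2]; rewrite E1 in rau'; rewrite E2 in rbv'.
      by rewrite ee ee' (gm_disj gm rau' rau) (gm_disj gm rbv' rbv).
    by rewrite ee ee' (gm_disj gm rau' rbv) (gm_disj gm rbv' rau) setUC.
  rewrite /single !eqxx /= (inj_eq (@pos_grid_inj N)).
  case: eqP => //= E1; case/negP: uv; apply/eqP/(gm_disj gm rau); by rewrite E1.
Qed.
End Lift.

(* The two unit squares bordering the grid edge pq are named by their lower left
   corners. *)
Definition side1 (p q : nat * nat) : nat * nat :=
  (minn p.1 q.1, minn p.2 q.2).

Definition side2 (p q : nat * nat) : nat * nat :=
  if p.1 == q.1 then ((minn p.1 q.1).-1, minn p.2 q.2)
  else (minn p.1 q.1, (minn p.2 q.2).-1).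

Lemma nadjP p q : nadj p q ->
  [\/ q = (p.1.+1, p.2), p = (q.1.+1, q.2), q = (p.1, p.2.+1) | p = (q.1, q.2.+1)].
Proof.
case: p q => [a b] [c d]; rewrite /nadj /=.
case/orP=> /andP[/eqP <- /orP[]/eqP <-];
 [constructor 3|constructor 4|constructor 1|constructor 2]; by [].
Qed.

(** Hence a cycle of the grid is the boundary of the set of squares where [fill] holds. *)
Lemma fill_sides (c : chain) (p q : nat * nat) :
  (forall x y, c x y = c y x) -> (forall x, 0 < x.1 -> 0 < x.2 -> ~~ bd c x) ->
  (forall x y, x.2 = 0 -> c x y = false) ->
  nadj p q -> 0 < p.1 -> 0 < p.2 ->
  fill c (side1 p q).1 (side1 p q).2 (+) fill c (side2 p q).1 (side2 p q).2 = c p q.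
Proof.
move=> csym bd0 c0 /nadjP pq p1 p2; rewrite /side1 /side2.
case: pq => E; [case: p p1 p2 E => [a b] /= p1 p2 E|case: q E => [a b] /= E|
  case: p p1 p2 E => [a b] /= p1 p2 E|case: q E => [a b] /= E]; subst=> /=;
  rewrite ?(ltn_eqF (ltnSn _)) ?(gtn_eqF (ltnSn _)) ?eqxx.
- by rewrite minnn (minn_idPl _) //; case: b p2 => // b _; rewrite fillS.
- rewrite /= in p1 p2; rewrite minnn (minn_idPr _) //.
  by case: b p2 => // b _; rewrite fillS csym.
- rewrite minnn (minn_idPl _) //; case: a p1 => // a _.
  by rewrite fill_right.
- rewrite /= in p1 p2; rewrite minnn (minn_idPr _) //.
  by case: a p1 => // a _; rewrite fill_right // csym.
Qed.

Definition cutchain (chi : nat * nat -> bool) : chain :=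
  fun p q => nadj p q && (chi (side1 p q) (+) chi (side2 p q)).

Lemma cutchain_sym chi p q : cutchain chi p q = cutchain chi q p.
Proof.
rewrite /cutchain nadj_sym /side1 /side2 ![minn q.1 _]minnC ![minn q.2 _]minnC.
by rewrite eq_sym.
Qed.

(** Each of the four squares around x borders two of the four edges at x, so it is counted twice. *)
Lemma bd_cutchain chi x : 0 < x.1 -> 0 < x.2 -> bd (cutchain chi) x = false.
Proof.
case: x => [[|a] [|b]] //= _ _; rewrite /bd /cutchain /nadj /side1 /side2 /= !eqxx /=.
rewrite ?(ltn_eqF (ltnSn _)) ?(gtn_eqF (ltnSn _)) ?eqxx ?orbT ?minnn /=.
rewrite !(minn_idPl (leqnSn _)) !(minn_idPr (leqnSn _)).
by do 4 case: (chi _).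
Qed.

Lemma bd_grid N (c : chain) (p : 'I_N * 'I_N) :
  (forall x y, c x y -> nadj x y) -> inner_grid p ->
  bd c (pos_grid p) = \big[addb/false]_(q : 'I_N * 'I_N) c (pos_grid p) (pos_grid q).
Proof.
case: p => [[a aN] [b bN]] cn; rewrite /inner_grid /= => /and4P[a0 a1 b0 b1].
have aN' : a.-1 < N by lia.
have bN' : b.-1 < N by lia.
pose l := [:: (Ordinal a1, Ordinal bN); (Ordinal aN', Ordinal bN);
              (Ordinal aN, Ordinal b1); (Ordinal aN, Ordinal bN')].
have ul : uniq l by rewrite /= !inE !xpair_eqE -!val_eqE /=; lia.
rewrite [RHS](bigID (mem l)) /= [X in _ (+) X]big1 ?addbF; last first.
  move=> [[c1 c1N] [c2 c2N]]; rewrite !inE !xpair_eqE -!val_eqE /= => nl.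
  apply/negP => /cn; rewrite /nadj /=; lia.
transitivity (\big[addb/false]_(q <- l) c (a, b) (pos_grid q)).
  by rewrite /bd /l !big_cons big_nil /pos_grid /= addbF !addbA.
by rewrite (big_uniq _ ul) /=; apply: eq_bigl => q.
Qed.

Lemma xor_pred1 (T : finType) (P : pred T) (a : T) (b : bool) :
  \big[addb/false]_(p | P p) ((p == a) && b) = P a && b.
Proof.
rewrite big_mkcond (bigD1 a) //= eqxx big1 => [|p /negPf ->]; last first.
  by case: (P p).
by case: (P a); rewrite ?addbF.
Qed.

Lemma odd_card_addb (T : finType) (A B : {set T}) :
  odd #|[set x | (x \in A) (+) (x \in B)]| = odd #|A| (+) odd #|B|.
Proof.
have odE (C : {set T}) : odd #|C| = \big[addb/false]_x (x \in C).
  by rewrite odd_card_xor big_mkcond; apply: eq_bigr => x _; case: (x \in C).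
by rewrite !odE -big_split; apply: eq_bigr => x _; rewrite inE.
Qed.

(** * Even edge sets and the face classes of a grid minor *)

Section Lift.
Variables (N : nat) (V : finType) (E : {set {set V}}).
Variables (B : V -> {set 'I_N * 'I_N}) (ra rb : {set V} -> 'I_N * 'I_N).
Hypotheses (sE : simple_graph E) (gm : grid_minor E B ra rb).

Local Notation kept := (kept E B ra rb).

(** The chains of the edges of F add up to a cycle of the grid, because the degrees of F are even; X
    is its [fill]. It changes only across kept edges, and across the edge representing e exactly
    when e is in F. *)
Lemma even_lift (F : {set {set V}}) : F \subset E -> even_edges F ->
  exists X : nat * nat -> bool, forall p q : 'I_N * 'I_N,
    gadj p q -> inner_grid p ->
    let d := X (side1 (pos_grid p) (pos_grid q)) (+)
             X (side2 (pos_grid p) (pos_grid q)) in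
    (d -> kept p q) /\ (forall e, e \in E -> p = ra e -> q = rb e -> d = (e \in F)).
Proof.
move=> /subsetP FE /forallP evF.
have [o /fin_all_exists [c cP]] := edge_chain sE gm.
pose cF : chain := fun x y => \big[addb/false]_(e in F) c e x y.
have cFk x y : cF x y -> exists p q,
   [/\ gadj p q, kept p q, x = pos_grid p & y = pos_grid q].
  move=> cxy; have [/exists_inP [e eF cexy]|] := boolP [exists e in F, c e x y].
    by have [_ ck _ _] := cP e (FE e eF); apply: ck cexy.
  move/exists_inPn => no; move: cxy; rewrite /cF big1 // => e eF.
  exact/negbTE/no.
have keptI p q : kept p q -> inner_grid p.
  case/orP=> [/existsP[v /andP[pB _]]|/exists_inP [e eE]].
    exact (gm_inner gm pB).
  have [_ [u [v [_ rau rbv]]]] := gm_edge gm eE.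
  case/orP=> /andP[/eqP -> _]; [exact (gm_inner gm rau)|exact (gm_inner gm rbv)].
exists (fun x => fill cF x.1 x.2) => p q pq pin /=.
have -> : fill cF (side1 (pos_grid p) (pos_grid q)).1 (side1 (pos_grid p) (pos_grid q)).2 (+)
    fill cF (side2 (pos_grid p) (pos_grid q)).1 (side2 (pos_grid p) (pos_grid q)).2 =
    cF (pos_grid p) (pos_grid q).
  have /and4P[p1 _ p2 _] := pin.
  apply: fill_sides => //.
  - move=> x y; apply: eq_bigr => e /FE eE.
    by have [cs _ _ _] := cP e eE.
  - move=> x x1 x2; rewrite bd_sum.
    under eq_bigr => e eF.
      have [_ _ -> //] := cP e (FE e eF).
    over.
    (* After the exchange, a vertex w with base point x contributes the parity of its degree in
       F. *)
    rewrite (exchange_big_dep predT) //= big1 // => w _.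
    have := evF w; rewrite odd_card_xor.
    case: (x == o w); last by move=> _; rewrite big1.
    by move=> /negbTE h; rewrite -[RHS]h; apply: eq_bigl => e; rewrite inE.
  (* Kept edges lie in the inner grid, so the chain vanishes on row 0, where the rays of [fill]
     end. *)
  - move=> x y x0; apply/negP => /cFk [p' [q' [_ /keptI/and4P[_ _ + _] xp _]]].
    by rewrite xp in x0; rewrite /= in x0; rewrite x0.
split=> [/cFk [p' [q' [_ k /pos_grid_inj -> /pos_grid_inj ->]]] //|e eE -> ->].
rewrite /cF.
under eq_bigr => e' e'F.
  have [_ _ _ ->//] := cP e' (FE e' e'F).
over.
rewrite -[RHS]andbT -(xor_pred1 (fun e => e \in F)).
by apply: eq_bigr => e' _; rewrite andbT.
Qed.

(** A square is named by its lower left corner; the successor in ['I_N.+1] is what [inord]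
    requires. *)
Definition toface (x : nat * nat) : 'I_N.+1 * 'I_N.+1 := (inord x.1, inord x.2).

(** The classes of the generated equivalence play the part of the faces of the drawing; nothing
    about their topology is needed. *)
Definition frel (f f' : 'I_N.+1 * 'I_N.+1) : bool :=
  [exists p : 'I_N * 'I_N, exists q : 'I_N * 'I_N,
   [&& gadj p q, inner_grid p, ~~ kept p q &
    ((f == toface (side1 (pos_grid p) (pos_grid q))) &&
     (f' == toface (side2 (pos_grid p) (pos_grid q)))) ||
    ((f' == toface (side1 (pos_grid p) (pos_grid q))) &&
     (f == toface (side2 (pos_grid p) (pos_grid q))))]].

Lemma frel_sym : connect_sym frel.
Proof.
apply: sym_connect_sym => f f'; rewrite /frel; apply: eq_existsb => p.
by apply: eq_existsb => q; do 3 congr (_ && _); rewrite orbC.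
Qed.

Definition region (f : 'I_N.+1 * 'I_N.+1) : {set 'I_N.+1 * 'I_N.+1} :=
  [set f' | connect frel f f'].

Lemma region_eq f f' : (region f == region f') = connect frel f f'.
Proof.
apply/eqP/idP => [eqr|cff].
  have : f' \in region f' by rewrite inE.
  by rewrite -eqr inE.
apply/setP => g; rewrite !inE; exact: same_connect frel_sym _ _ cff g.
Qed.

Definition face1 (e : {set V}) := toface (side1 (pos_grid (ra e)) (pos_grid (rb e))).
Definition face2 (e : {set V}) := toface (side2 (pos_grid (ra e)) (pos_grid (rb e))).

Definition bdry (s : {set 'I_N.+1 * 'I_N.+1}) : {set {set V}} :=
  [set e in E | (region (face1 e) == s) (+) (region (face2 e) == s)].

Definition reps (e : {set V}) (p q : 'I_N * 'I_N) : bool :=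
  ((p == ra e) && (q == rb e)) || ((p == rb e) && (q == ra e)).

Lemma reps_ends e p q : e \in E -> reps e p q ->
  e = [set x | (p \in B x) || (q \in B x)].
Proof.
move=> eE h; have [_ [u [w [ee rau rbw]]]] := gm_edge gm eE.
have inu x : (ra e \in B x) = (x == u).
  by apply/idP/eqP => [xB|-> //]; exact (esym (gm_disj gm rau xB)).
have inw x : (rb e \in B x) = (x == w).
  by apply/idP/eqP => [xB|-> //]; exact (esym (gm_disj gm rbw xB)).
apply/setP => x; rewrite ee !inE -inu -inw.
by case/orP: h => /andP[/eqP-> /eqP->] //; rewrite orbC.
Qed.

(** The squares of the class s bound a grid chain [c] without boundary. Summing its degrees over the
    branch set of v, edges inside the branch set cancel in pairs, and those that leave it are
    counted by the degree of v in [bdry s]. *)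
Lemma even_bdry s : even_edges (bdry s).
Proof.
apply/forallP => v.
pose c := cutchain (fun x => region (toface x) == s).
have cn x y : c x y -> nadj x y by case/andP.
pose rc (p q : 'I_N * 'I_N) := c (pos_grid p) (pos_grid q).
have rcE p q e : e \in E -> reps e p q -> rc p q = (e \in bdry s).
  move=> eE; rewrite inE eE /=.
  have [rr _] := gm_edge gm eE.
  case/orP => /andP[/eqP -> /eqP ->]; rewrite /rc ?[c (pos_grid (rb e)) _]cutchain_sym;
    by rewrite /c /cutchain -/(gadj _ _) rr.
(* A grid edge leaving [B v] represents an edge or is not kept; in the latter case its two sides
   belong to the same class and [c] vanishes on it. *)
have disj p q : p \in B v -> q \notin B v -> rc p q =
   \big[addb/false]_(e in bdry s) reps e p q.
  move=> pB qB.
  have [/exists_inP[e eE h]|/exists_inPn noe] := boolP [exists e in E, reps e p q].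
    rewrite (rcE p q e) //.
    rewrite -[LHS]andbT -(xor_pred1 (fun e => e \in bdry s)).
    apply: eq_bigr => e'; rewrite inE => /andP[e'E _]; rewrite andbT.
    apply/eqP/idP => [-> //|h'].
    by rewrite (reps_ends eE h) (reps_ends e'E h').
  rewrite big1 => [|e]; last first.
    by rewrite inE => /andP[/noe/negbTE].
  have [gpq|ngpq] := boolP (gadj p q); last first.
    by apply: contraNF ngpq => /cn.
  rewrite /rc /c /cutchain -/(gadj _ _) gpq /=.
  have /eqP-> : region (toface (side1 (pos_grid p) (pos_grid q))) ==
         region (toface (side2 (pos_grid p) (pos_grid q))).
    rewrite region_eq connect1 //; apply/existsP; exists p; apply/existsP; exists q.
    rewrite gpq (gm_inner gm pB) !eqxx /= andbT.
    apply/norP; split; last by apply/exists_inPn.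
    apply/existsPn => w; apply/andP => -[pw qw].
    by rewrite (gm_disj gm pB pw) qw in qB.
  by rewrite addbb.
have tot : \big[addb/false]_(p in B v) \big[addb/false]_(q | q \notin B v) rc p q = false.
  have : \big[addb/false]_(p in B v) bd c (pos_grid p) = false.
    rewrite big1 // => p pB; have /and4P[p1 _ p2 _] := gm_inner gm pB.
    exact: bd_cutchain.
  under eq_bigr => p pB.
    rewrite (bd_grid cn (gm_inner gm pB)) (bigID (mem (B v))).
  over.
  rewrite big_split /= xor_sym_sum //.
    by move=> p q; apply: cutchain_sym.
  by move=> p; apply/negP => /cn; rewrite /nadj; lia.
rewrite odd_card_pred; apply/negbT; rewrite -[RHS]tot.
under [RHS]eq_bigr => p pB.
  under eq_bigr => q qB do rewrite (disj p q pB qB).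
over.
under [RHS]eq_bigr => p pB do rewrite exchange_big.
rewrite exchange_big; apply: eq_bigr => e; rewrite inE => /andP[eE _].
have [rr [u [w [ee rau rbw]]]] := gm_edge gm eE.
have uw : u != w.
  apply: contraTneq eE => uw; apply/negP => eE.
  by move/forall_inP: sE => /(_ e eE); rewrite ee uw setUid cards1.
have inu x : (ra e \in B x) = (x == u).
  by apply/idP/eqP => [xB|-> //]; exact (esym (gm_disj gm rau xB)).
have inw x : (rb e \in B x) = (x == w).
  by apply/idP/eqP => [xB|-> //]; exact (esym (gm_disj gm rbw xB)).
have rE p q : reps e p q = ((p == ra e) && (q == rb e)) (+) ((p == rb e) && (q == ra e)).
  rewrite /reps; case: (p =P ra e) => [->|_] //=; case: (ra e =P rb e) => [ab|_].
    by rewrite ab inw in rau; case/negP: uw; rewrite eq_sym in rau; rewrite eq_sym.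
  by rewrite orbF addbF.
under [RHS]eq_bigr => p pB.
  under eq_bigr => q qB do rewrite rE ![(p == _) && _]andbC.
  rewrite big_split !xor_pred1 ![(_ \notin _) && _]andbC.
over.
rewrite big_split !xor_pred1 inu inw ee !inE.
by have [vu|vu] := eqVneq v u; have [vw|vw] := eqVneq v w => //=; subst; rewrite eqxx in uw.
Qed.

(** The even edge sets number at least 2^(edges - nonisolated vertices) and at most 2^(classes with
    nonempty boundary). Each such boundary has at least g edges, and an edge lies on at most two of
    them. *)
Lemma grid_euler g :
  (forall F : {set {set V}}, F \subset E -> F != set0 -> even_edges F -> g <= #|F|) ->
  (#|E| - #|[set x | nbrs E x != set0]|) * g <= 2 * #|E|.
Proof.
move=> girth.
pose S := [set s | bdry s != set0].
pose cov := [set x | nbrs E x != set0].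
pose evens := [set F in powerset E | even_edges F].
(* By [even_lift], an even set is determined by the classes on which X holds, and classes with empty
   boundary do not matter. *)
have evS : #|evens| <= 2 ^ #|S|.
  rewrite -card_powerset.
  pose back (T : {set {set 'I_N.+1 * 'I_N.+1}}) :=
    [set e in E | (region (face1 e) != region (face2 e)) &&
                  ((region (face1 e) \in T) (+) (region (face2 e) \in T))].
  apply: leq_trans (leq_imset_card back _); apply/subset_leq_card/subsetP => F.
  rewrite inE powersetE => /andP[FE Fev]; have [X XP] := even_lift FE Fev.
  pose X' (f : 'I_N.+1 * 'I_N.+1) := X (val f.1, val f.2).
  have Xf (p q : 'I_N * 'I_N) : 
     X' (toface (side1 (pos_grid p) (pos_grid q))) = X (side1 (pos_grid p) (pos_grid q)) /\
     X' (toface (side2 (pos_grid p) (pos_grid q))) = X (side2 (pos_grid p) (pos_grid q)).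
    rewrite /X' /side1 /side2 /toface /=; case: ifP => _ /=;
    rewrite !inordK //; case: p q => [[a aN] [b bN]] [[c cN] [d dN]] /=; lia.
  have Xc f f' : connect frel f f' -> X' f = X' f'.
    case/connectP => s; elim: s f => [|a s IH] f /= => [_ -> //|/andP[fa /IH h] /h <-].
    case/existsP: fa => p /existsP[q /and4P[gpq pin nk h']].
    have [dk _] := XP p q gpq pin; have [X1 X2] := Xf p q.
    have : X (side1 (pos_grid p) (pos_grid q)) = X (side2 (pos_grid p) (pos_grid q)).
      apply/eqP; apply: contraNT nk => ne; apply: dk; move: ne.
      by case: (X _); case: (X _).
    by rewrite -X1 -X2; case/orP: h' => /andP[/eqP -> /eqP ->].
  apply/imsetP; exists [set s in S | [exists f, (region f == s) && X' f]].
    by rewrite powersetE; apply/subsetP => s; rewrite !inE => /andP[].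
  apply/setP => e; rewrite inE.
  have [eE|neE] := boolP (e \in E); last by apply: contraNF neE => /(subsetP FE).
  have [rr [u [w [ee rau rbw]]]] := gm_edge gm eE.
  have [_ /(_ e eE erefl erefl) <-] := XP _ _ rr (gm_inner gm rau).
  have [<- <-] := Xf (ra e) (rb e); rewrite -/(face1 e) -/(face2 e) /=.
  have [eqr|neqr] := eqVneq.
    by rewrite (Xc (face1 e) (face2 e)) ?addbb // -region_eq eqr.
  have inS f : [exists f', (region f' == region f) && X' f'] = X' f.
    apply/existsP/idP => [[f' /andP[]]|Xf']; last by exists f; rewrite eqxx.
    by rewrite region_eq => /Xc ->.
  rewrite !inE !inS.
  have -> : bdry (region (face1 e)) != set0.
    by apply/set0Pn; exists e; rewrite inE eE eqxx eq_sym (negPf neqr).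
  have -> // : bdry (region (face2 e)) != set0.
  by apply/set0Pn; exists e; rewrite inE eE eqxx (negPf neqr).
(* Count the pairs (class, edge of its boundary) in two ways. *)
have Sg : #|S| * g <= 2 * #|E|.
  rewrite -sum_nat_const.
  apply: (@leq_trans (\sum_(s in S) #|bdry s|)).
    apply: leq_sum => s; rewrite inE => s0; apply: girth => //; last exact: even_bdry.
    by apply/subsetP => e; rewrite inE => /andP[].
  apply: (@leq_trans (\sum_s #|bdry s|)).
    by rewrite big_mkcond /=; apply: leq_sum => s _; case: ifP.
  under eq_bigr => s _ do rewrite -sum1_card.
  rewrite (exchange_big_dep [in E]) /=; last by move=> s e _; rewrite inE => /andP[].
  rewrite mulnC -sum_nat_const; apply: leq_sum => e eE.
  rewrite sum1_card -[leqRHS]/(1 + 1).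
  apply: leq_trans (_ : #|[set region (face1 e); region (face2 e)]| <= _); last first.
    by rewrite cards2; case: (_ != _).
  apply/subset_leq_card/subsetP => s h; have : e \in bdry s := h; rewrite inE => /andP[_].
  by rewrite !inE ![_ == s]eq_sym; case: (s == _) => //=; case: (s == _).
(* [od] sends an edge set to its vertices of odd degree, all nonisolated; adding a fixed member F0
   of a fibre maps that fibre injectively into the even sets. *)
have evC : 2 ^ #|E| <= 2 ^ #|cov| * #|evens|.
  rewrite -!card_powerset.
  pose od (F : {set {set V}}) := [set x | odd #|inc F x|].
  have odc F : F \in powerset E -> od F \in powerset cov.
    rewrite !powersetE => FE; apply/subsetP => x; rewrite !inE.
    rewrite -cards_eq0 -card_inc //; apply: contraTneq => /eqP.
    rewrite cards_eq0 => /eqP i0; suff -> : inc F x = set0 by rewrite cards0.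
    apply/eqP; rewrite -subset0 -i0; apply/subsetP => e; rewrite !inE => /andP[eF ->].
    by rewrite (subsetP FE).
  rewrite -sum1_card (partition_big od (fun T => T \in powerset cov)) //=.
  rewrite -sum_nat_const; apply: leq_sum => T _.
  have [F0 /andP[F0E /eqP F0T]|no] := pickP (fun F => (F \in powerset E) && (od F == T)); last first.
    by rewrite big_pred0.
  rewrite sum1_card.
  pose sd (F : {set {set V}}) := [set e | (e \in F) (+) (e \in F0)].
  have sdi : injective sd.
    move=> F F' /setP eqF; apply/setP => e; have := eqF e; rewrite !inE.
    by do 3 case: (e \in _).
  rewrite -(card_imset _ sdi); apply/subset_leq_card/subsetP => _ /imsetP[F Fin ->].
  have /andP[FE /eqP FT] : (F \in powerset E) && (od F == T) := Fin.
  rewrite !inE.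
  apply/andP; split.
    rewrite powersetE in FE; rewrite powersetE in F0E; apply/subsetP => e; rewrite inE.
    have [/(subsetP FE) //|_ /=] := boolP (e \in F); exact: (subsetP F0E).
  apply/forallP => x.
  have -> : inc (sd F) x = [set e | (e \in inc F x) (+) (e \in inc F0 x)].
    by apply/setP => e; rewrite !inE; case: (x \in e); rewrite ?andbT ?andbF.
  rewrite odd_card_addb; move/setP: FT => /(_ x); rewrite -F0T !inE => ->.
  by rewrite addbb.
have le : #|E| - #|cov| <= #|S|.
  rewrite leq_subLR -(@leq_exp2l 2) // expnD; apply: leq_trans evC _.
  by rewrite leq_mul2l evS orbT.
by apply: leq_trans Sg; rewrite leq_mul2r le orbT.
Qed.
End Lift.

(** * Connected sets of grid points and the cutting of tubes *)

Definition restr (T : finType) (r : rel T) (B : {set T}) : rel T :=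
  fun x y => [&& r x y, x \in B & y \in B].

Lemma connect_within_sub (T : finType) (r : rel T) (B C : {set T}) x y :
  B \subset C -> connect (restr r B) x y -> connect (restr r C) x y.
Proof.
move=> /subsetP BC; apply: connect_sub => a b /and3P[rab aB bB].
by apply: connect1; rewrite /restr rab !BC.
Qed.

Lemma connect_within_sym (T : finType) (r : rel T) (B : {set T}) :
  symmetric r -> connect_sym (restr r B).
Proof.
move=> rs; apply: sym_connect_sym => x y.
by rewrite /restr rs; congr (_ && _); rewrite andbC.
Qed.

(** P is the part of a path from a to b before its first point in A, which is y. *)
Lemma first_hit (T : finType) (r : rel T) (K A : {set T}) a b :
  connect (restr r K) a b -> a \in K -> a \notin A -> b \in A ->
  exists (P : {set T}) x y,
  [/\ a \in P, P \subset K & [disjoint P & A]] /\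
  [/\ x \in P, y \in A, r x y & forall p, p \in P -> connect (restr r P) a p].
Proof.
case/connectP => s; elim: s a => [|c s IH] a /=.
  by move=> _ -> _ /negPf ->.
case/andP=> /and3P[rac aK cK] path_s lst _ naA bA.
have [cA|ncA] := boolP (c \in A).
  exists [set a], a, c; split; split; rewrite ?set11 ?sub1set //.
    by rewrite disjoints1.
  by move=> p; rewrite inE => /eqP ->.
have [P [x [y [[cP PK PA] [xP yA rxy conP]]]]] := IH c path_s lst cK ncA bA.
exists (a |: P), x, y; split; split=> //.
- by rewrite setU11.
- by rewrite subUset sub1set aK.
- rewrite disjoint_subset; apply/subsetP => z; rewrite !inE => /orP[/eqP->//|zP].
  by rewrite (disjointFr PA zP).
- by rewrite setU1r.
- move=> p; rewrite inE => /orP[|pP].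
    by rewrite inE => /eqP->.
  apply: (@connect_trans _ _ c).
    by apply: connect1; rewrite /restr rac setU11 setU1r.
  by apply: connect_within_sub (conP p pP); apply: subsetUr.
Qed.

(* Tubes around the arcs overlap the boxes around their ends; cutting each tube
   where it first meets the box of one end yields a minor of the grid. *)
Lemma tubes_minor N (V : finType) (E : {set {set V}})
    (A : V -> {set 'I_N.+1 * 'I_N.+1}) (K : {set V} -> {set 'I_N.+1 * 'I_N.+1}) :
  simple_graph E ->
  (forall v p, p \in A v -> inner_grid p) ->
  (forall e p, e \in E -> p \in K e -> inner_grid p) ->
  (forall u v p, p \in A u -> p \in A v -> u = v) ->
  (forall e e' p, e \in E -> e' \in E -> p \in K e -> p \in K e' -> e = e') ->
  (forall v e p, e \in E -> p \in A v -> p \in K e -> v \in e) ->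
  (forall v e, e \in E -> v \in e -> exists2 p, p \in A v & p \in K e) ->
  (forall v p q, p \in A v -> q \in A v -> connect (restr (@gadj N.+1) (A v)) p q) ->
  (forall e p q, e \in E -> p \in K e -> q \in K e ->
     connect (restr (@gadj N.+1) (K e)) p q) ->
  exists B ra rb, @grid_minor N.+1 V E B ra rb.
Proof.
move=> sE Ain Kin Adis Kdis AK meet Acon Kcon.
pose g := @gadj N.+1.
(* Here t is (u, P, [ra e], [rb e]), where P is the part of the tube that starts in the box of u and
   stops just before that of v. All of P goes to the branch set of u, and the step from P into the
   box of v represents e. *)
pose Q (e : {set V}) (t : option V * {set 'I_N.+1 * 'I_N.+1} *
    ('I_N.+1 * 'I_N.+1) * ('I_N.+1 * 'I_N.+1)) := e \in E -> exists u v,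
  [/\ t.1.1.1 = Some u, e = [set u; v], t.1.2 \in t.1.1.2, t.2 \in A v & g t.1.2 t.2] /\
  [/\ t.1.1.2 \subset K e, [disjoint t.1.1.2 & A v] & exists2 a, a \in A u &
      forall p, p \in t.1.1.2 -> connect (restr g t.1.1.2) a p].
have /fin_all_exists[t tP] : forall e, exists t, Q e t.
  move=> e; have [eE|neE] := boolP (e \in E); last first.
    by exists (None, set0, (ord0, ord0), (ord0, ord0)) => eE; rewrite eE in neE.
  have [u [v [uv ee]]] := simple_edge sE eE.
  have [a aA aK] : exists2 p, p \in A u & p \in K e by apply: meet; rewrite // ee set21.
  have [b bA bK] : exists2 p, p \in A v & p \in K e by apply: meet; rewrite // ee set22.
  have naA : a \notin A v by apply: contraNN uv => aA'; rewrite (Adis _ _ _ aA aA').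
  have [P [x [y [[aP PK PA] [xP yA xy Pc]]]]] := first_hit (Kcon e a b eE aK bK) aK naA bA.
  by exists (Some u, P, x, y) => _; exists u, v; split; split=> //; exists a.
pose hd e := (t e).1.1.1; pose P e := (t e).1.1.2.
pose ra e := (t e).1.2; pose rb e := (t e).2.
have {}tP e : e \in E -> exists u v, 
  [/\ hd e = Some u, e = [set u; v], ra e \in P e, rb e \in A v & g (ra e) (rb e)] /\
  [/\ P e \subset K e, [disjoint P e & A v] & exists2 a, a \in A u &
      forall p, p \in P e -> connect (restr g (P e)) a p].
  exact: tP.
pose B v := A v :|: \bigcup_(e in E | hd e == Some v) P e.
have AB v : A v \subset B v by apply: subsetUl.
have PB e v : e \in E -> hd e = Some v -> P e \subset B v.
  move=> eE hE; apply: subset_trans (subsetUr _ _).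
  by apply: (bigcup_sup e); rewrite eE hE eqxx.
have BP v p : p \in B v -> p \in A v \/
    exists2 e, e \in E & hd e = Some v /\ p \in P e.
  rewrite inE => /orP[|/bigcupP[e /andP[eE /eqP hE] pP]]; first by left.
  by right; exists e.
have PK e p : e \in E -> p \in P e -> p \in K e.
  by move=> eE; have [u [v [_ [/subsetP PK _ _]]]] := tP e eE; apply: PK.
have PA e v w p : e \in E -> hd e = Some v -> p \in P e -> p \in A w -> w = v.
  move=> eE hE pP pA; have [u [v' [[hE' ee _ _ _] [_ dis _]]]] := tP e eE.
  have := AK w e p eE pA (PK e p eE pP).
  rewrite ee !inE; case: eqP => [->|_ /= /eqP wv].
    by move: hE'; rewrite hE => -[->].
  by move: dis => /disjointFr /(_ pP); rewrite -wv pA.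
exists B, ra, rb; split.
- move=> v p /BP[/Ain //|[e eE [_ pP]]].
  exact: Kin (PK _ _ eE pP).
- move=> u v p /BP[pu|[e eE [hE pP]]] /BP[pv|[e' eE' [hE' pP']]].
  + exact: Adis pu pv.
  + exact: PA pP' pu.
  + by apply/esym; apply: PA pP pv.
  + have ee : e = e' by apply: Kdis (PK _ _ eE pP) (PK _ _ eE' pP').
    by subst e'; move: hE'; rewrite hE => -[].
- move=> v p q pB qB.
  suff con x : x \in B v -> exists2 a, a \in A v & connect (restr g (B v)) a x.
    have [a aA ap] := con p pB; have [b bA bq] := con q qB.
    rewrite (connect_within_sym _ (@gadj_sym _)) in ap.
    apply: connect_trans ap _; apply: connect_trans bq.
    exact: connect_within_sub (AB v) (Acon v a b aA bA).
  case/BP => [xA|[e eE [hE xP]]]; first by exists x.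
  have [u [v' [[hE' _ _ _ _] [_ _ [a aA ac]]]]] := tP e eE.
  move: hE'; rewrite hE => -[uv]; subst u; exists a => //.
  by apply: connect_within_sub (ac x xP); apply: PB.
- move=> e eE; have [u [v [[hE ee rP rA rr] _]]] := tP e eE.
  split=> //; exists u, v; split=> //.
    exact: (subsetP (PB _ _ eE hE)).
  exact: (subsetP (AB v)).
Qed.

(** Convexity makes P and Q intervals; the path goes horizontally, then vertically. *)
Lemma grid_rect N (P Q : pred 'I_N) (z z' : 'I_N * 'I_N) :
  (forall a b c : 'I_N, a <= b -> b <= c -> P a -> P c -> P b) ->
  (forall a b c : 'I_N, a <= b -> b <= c -> Q a -> Q c -> Q b) ->
  P z.1 -> Q z.2 -> P z'.1 -> Q z'.2 ->
  connect (restr (@gadj N) [set p | P p.1 && Q p.2]) z z'.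
Proof.
move=> cP cQ Pz Qz Pz' Qz'; set S := [set p | _].
have sy : connect_sym (restr (@gadj N) S) := connect_within_sym S (@gadj_sym N).
have hor (y a b : 'I_N) : Q y -> P a -> P b -> a <= b ->
    connect (restr (@gadj N) S) (a, y) (b, y).
  move=> Qy Pa + ab; have := leqnn (b - a); move: {2}(b - a) => n.
  elim: n b ab => [|n IH] b ab ban Pb.
    by have -> : a = b by apply: val_inj => /=; lia.
  have [ab'|ab'] := eqVneq (a : nat) b.
    by have -> : a = b by apply: val_inj.
  have bN : b.-1 < N by have := ltn_ord b; lia.
  have ab1 : a <= Ordinal bN by rewrite /=; lia.
  have Pb1 : P (Ordinal bN) by apply: cP ab1 _ Pa Pb => /=; lia.
  have b1n : Ordinal bN - a <= n by rewrite /=; lia.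
  apply: connect_trans (IH _ ab1 b1n Pb1) _.
  apply: connect1; rewrite /restr !inE /= Pb1 Pb Qy /gadj /nadj /= !andbT; lia.
have ver (x a b : 'I_N) : P x -> Q a -> Q b -> a <= b ->
    connect (restr (@gadj N) S) (x, a) (x, b).
  move=> Px Qa + ab; have := leqnn (b - a); move: {2}(b - a) => n.
  elim: n b ab => [|n IH] b ab ban Qb.
    by have -> : a = b by apply: val_inj => /=; lia.
  have [ab'|ab'] := eqVneq (a : nat) b.
    by have -> : a = b by apply: val_inj.
  have bN : b.-1 < N by have := ltn_ord b; lia.
  have ab1 : a <= Ordinal bN by rewrite /=; lia.
  have Qb1 : Q (Ordinal bN) by apply: cQ ab1 _ Qa Qb => /=; lia.
  have b1n : Ordinal bN - a <= n by rewrite /=; lia.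
  apply: connect_trans (IH _ ab1 b1n Qb1) _.
  apply: connect1; rewrite /restr !inE /= Qb1 Qb Px /gadj /nadj /=; lia.
case: z z' Pz Qz Pz' Qz' => [a b] [c d] /= Pa Qb Pc Qd.
apply: (@connect_trans _ _ (c, b)).
  have [ac|/ltnW ca] := leqP a c; first exact: hor.
  by rewrite sy; apply: hor.
have [bd|/ltnW db] := leqP b d; first exact: ver.
by rewrite sy; apply: ver.
Qed.

Lemma union_connected (X : Type) (T : finType) (r : rel T) (b : X -> {set T}) x0 l :
  symmetric r ->
  (forall x p q, p \in b x -> q \in b x -> connect (restr r (b x)) p q) ->
  path (fun x y => b x :&: b y != set0) x0 l ->
  forall p q, has (fun x => p \in b x) (x0 :: l) -> has (fun x => q \in b x) (x0 :: l) ->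
  connect (restr r [set z | has (fun x => z \in b x) (x0 :: l)]) p q.
Proof.
move=> rs bc; elim: l x0 => [|x1 l IH] x0 /=.
  move=> _ p q; rewrite !orbF => px qx; apply: connect_within_sub (bc x0 p q px qx).
  by apply/subsetP => z zb; rewrite inE zb.
case/andP=> /set0Pn[c]; rewrite inE => /andP[c0 c1] {}/IH IH.
have con p : has (fun x => p \in b x) [:: x0, x1 & l] ->
    connect (restr r [set z | has (fun x => z \in b x) [:: x0, x1 & l]]) c p.
  rewrite /= => /orP[p0|pl].
    apply: connect_within_sub (bc x0 c p c0 p0).
    by apply/subsetP => z zb; rewrite inE zb.
  apply: (@connect_within_sub _ r [set z | has (fun x => z \in b x) (x1 :: l)]).
    by apply/subsetP => z; rewrite !inE => /= ->; rewrite orbT.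
  by apply: IH => //=; rewrite c1.
move=> p q /con cp /con cq.
by apply: connect_trans cq; rewrite (connect_within_sym _ rs).
Qed.

(** Stop at the first visit to Q and restart at the last visit to P before it. *)
Lemma last_first_split (X : Type) (e : rel X) (P Q : pred X) x0 s :
  (forall x, P x -> ~~ Q x) -> path e x0 s -> P x0 -> Q (last x0 s) ->
  exists x m y, [/\ P x, Q y, path e x (rcons m y) & all (fun z => ~~ P z && ~~ Q z) m].
Proof.
move=> PQ.
suff gen t x m : P x -> path e x m -> all (fun z => ~~ P z && ~~ Q z) m ->
    path e (last x m) t -> Q (last (last x m) t) ->
    exists x m y, [/\ P x, Q y, path e x (rcons m y) & all (fun z => ~~ P z && ~~ Q z) m].
  by move=> pe Px Ql; apply: (gen s x0 [::]).
elim: t x m => [|c t IH] x m Px pm am /=.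
  case/lastP: m pm am => [|m y] _; first by move=> _ _ /= Qx; have := PQ x Px; rewrite Qx.
  by rewrite all_rcons last_rcons => /andP[/andP[_ /negPf ->]].
case/andP=> ec pt Ql; have [Pc|nPc] := boolP (P c); first exact: (IH c [::]).
have [Qc|nQc] := boolP (Q c).
  by exists x, m, c; split=> //; rewrite rcons_path pm.
apply: (IH x (rcons m c)) => //.
- by rewrite rcons_path pm.
- by rewrite all_rcons nPc nQc.
- by rewrite last_rcons.
- by rewrite last_rcons.
Qed.

(** * Outerplanar orders *)

Lemma connect_cross (T : finType) (r : rel T) (S : {set T}) x y :
  connect r x y -> x \in S -> y \notin S ->
  exists u v, [/\ u \in S, v \notin S & r u v].
Proof.
case/connectP => s; elim: s x => [|a s IH] x /=; first by move=> _ -> ->.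
case/andP=> xa ps lst xS nyS; have [aS|naS] := boolP (a \in S); first exact: IH a ps lst aS nyS.
by exists x, a.
Qed.

(** A connected graph is exhausted by adding one leaf at a time. With connectivity as invariant this
    yields a spanning tree; with an order as invariant it extends the order of a path to the whole
    tree. *)
Lemma grow_leaves (V : finType) (H : {set {set V}})
    (Inv : {set V} -> {set {set V}} -> Prop) (S0 : {set V}) (F0 : {set {set V}}) x0 :
  (forall x y, connect (adj H) x y) -> x0 \in S0 -> F0 \subset H ->
  (forall e, e \in F0 -> e \subset S0) -> Inv S0 F0 ->
  (forall S F u v, Inv S F -> (forall e, e \in F -> e \subset S) ->
     S0 \subset S -> u \in S -> v \notin S -> adj H u v ->
     Inv (v |: S) ([set u; v] |: F)) ->
  exists F, [/\ Inv setT F, F \subset H & #|F| + #|S0| = #|F0| + #|V|].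
Proof.
move=> Hc x0S F0H F0S Inv0 step.
suff gen n : forall (S : {set V}) (F : {set {set V}}), #|~: S| = n -> S0 \subset S -> F \subset H ->
    (forall e, e \in F -> e \subset S) -> Inv S F -> #|F| + #|S0| = #|F0| + #|S| ->
  exists F, [/\ Inv setT F, F \subset H & #|F| + #|S0| = #|F0| + #|V|].
  exact: (gen #|~: S0| S0 F0).
elim: n => [|n IH] S F Sn S0S FH FS inv cnt.
  have ST : S = setT by rewrite -[S]setCK; move/eqP: Sn; rewrite cards_eq0 => /eqP ->; rewrite setC0.
  by exists F; rewrite -cardsT -ST.
have /card_gt0P[y] : 0 < #|~: S| by rewrite Sn.
rewrite inE => ynS.
have [u [v [uS vnS uv]]] := connect_cross (Hc x0 y) (subsetP S0S _ x0S) ynS.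
have eF : [set u; v] \notin F.
  by apply/negP => /FS /subsetP /(_ v); rewrite set22 (negPf vnS) => /(_ isT).
apply: (IH (v |: S) ([set u; v] |: F)).
- by rewrite setCU setIC -setDE; move: Sn; rewrite (cardsD1 v (~: S)) inE vnS => -[].
- exact: subset_trans S0S (subsetUr _ _).
- by rewrite subUset sub1set FH andbT.
- move=> e; rewrite !inE => /orP[/eqP ->|/FS eS].
    by rewrite subUset !sub1set !inE uS eqxx orbT.
  exact: subset_trans eS (subsetUr _ _).
- exact: step.
- by rewrite !cardsU1 eF vnS !add1n addSn addnS cnt.
Qed.

(** The extreme positions of x and y are recorded because an edge between the first and the last
    vertex crosses nothing: it will close the cycle. *)
Record ordered_in (V : finType) (S : {set V}) (F : {set {set V}}) (pos : V -> nat) (x y : V)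
  : Prop := OrderedIn {
  oi_x : x \in S; oi_y : y \in S;
  oi_sub : forall e, e \in F -> e \subset S;
  oi_inj : {in S &, injective pos};
  oi_min : forall z, z \in S -> pos x <= pos z;
  oi_max : forall z, z \in S -> pos z <= pos y;
  oi_nc : noncrossing F pos }.

Lemma adj_setU1 (V : finType) (F : {set {set V}}) (u v a b : V) :
  adj ([set u; v] |: F) a b -> [\/ a = u /\ b = v, a = v /\ b = u | adj F a b].
Proof.
rewrite /adj !inE => /orP[/eqP/set2_eq[[-> ->]|[-> ->]]|].
- by constructor 1.
- by constructor 2.
- by constructor 3.
Qed.

Lemma adj_in (V : finType) (S : {set V}) (F : {set {set V}}) a b :
  (forall e, e \in F -> e \subset S) -> adj F a b -> a \in S /\ b \in S.
Proof. by move=> FS /FS; rewrite subUset !sub1set => /andP[]. Qed.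

(** Doubling the positions frees the odd ones: v goes right after its neighbour u, or right before
    it when u = y, which must stay last. *)
Lemma ordered_leaf (V : finType) (S : {set V}) (F : {set {set V}}) pos (x y u v : V) :
  ordered_in S F pos x y -> x != y -> u \in S -> v \notin S ->
  exists pos', ordered_in (v |: S) ([set u; v] |: F) pos' x y.
Proof.
case=> xS yS FS pI pmin pmax nc xy uS vnS.
have xy_lt : pos x < pos y.
  rewrite ltn_neqAle pmin // andbT; apply: contra xy => /eqP /pI -> //.
have vS z : z \in S -> z == v = false by move=> zS; apply: contraNF vnS => /eqP <-.
pose pos' z := if z == v then (if u == y then (pos y).*2.-1 else (pos u).*2.+1)
               else (pos z).*2.
have old z : z \in S -> pos' z = (pos z).*2 by move=> zS; rewrite /pos' vS.
have new : (u = y /\ pos' v = (pos y).*2.-1) \/ (pos u < pos y /\ pos' v = (pos u).*2.+1).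
  rewrite /pos' eqxx; case: eqVneq => [->|uy]; [by left|right; split=> //].
  rewrite ltn_neqAle pmax // andbT; apply: contra uy => /eqP /pI -> //.
exists pos'; split.
- by rewrite !inE xS orbT.
- by rewrite !inE yS orbT.
- move=> e; rewrite !inE => /orP[/eqP ->|/FS eS].
    by rewrite subUset !sub1set !inE uS eqxx orbT.
  exact: subset_trans eS (subsetUr _ _).
- move=> a b; rewrite !inE => /orP[/eqP ->|aS] /orP[/eqP ->|bS] //.
  + by rewrite (old b bS); case: new => [[_ ->]|[_ ->]]; lia.
  + by rewrite (old a aS); case: new => [[_ ->]|[_ ->]]; lia.
  + by rewrite (old a aS) (old b bS) => /double_inj /pI ->.
- move=> z; rewrite !inE (old x xS) => /orP[/eqP ->|zS].
    have := pmin u uS; case: new => [[_ ->]|[_ ->]]; lia.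
  by rewrite (old z zS) leq_double pmin.
- move=> z; rewrite !inE (old y yS) => /orP[/eqP ->|zS].
    case: new => [[_ ->]|[? ->]]; lia.
  by rewrite (old z zS) leq_double pmax.
- move=> a b c d /adj_setU1 ab /adj_setU1 cd.
  have eu := old u uS.
  case: ab => [[-> ->]|[-> ->]|ab]; case: cd => [[-> ->]|[-> ->]|cd];
    try (have [aS bS] := adj_in FS ab; have ea := old a aS; have eb := old b bS);
    try (have [cS dS] := adj_in FS cd; have ec := old c cS; have ed := old d dS);
    try (by case: new => [[uy ev]|[uy ev]]; rewrite ?uy in eu *; lia).
  by rewrite ea eb ec ed !ltn_double; apply: nc.
Qed.

Lemma ordered_append (V : finType) (S : {set V}) (F : {set {set V}}) pos (x y v : V) :
  ordered_in S F pos x y -> v \notin S ->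
  exists pos', ordered_in (v |: S) ([set y; v] |: F) pos' x v.
Proof.
case=> xS yS FS pI pmin pmax nc vnS.
have vS z : z \in S -> z == v = false by move=> zS; apply: contraNF vnS => /eqP <-.
pose pos' z := if z == v then (pos y).+1 else pos z.
have old z : z \in S -> pos' z = pos z by move=> zS; rewrite /pos' vS.
have new : pos' v = (pos y).+1 by rewrite /pos' eqxx.
exists pos'; split.
- by rewrite !inE xS orbT.
- by rewrite !inE eqxx.
- move=> e; rewrite !inE => /orP[/eqP ->|/FS eS].
    by rewrite subUset !sub1set !inE yS eqxx orbT.
  exact: subset_trans eS (subsetUr _ _).
- move=> a b; rewrite !inE => /orP[/eqP ->|aS] /orP[/eqP ->|bS] //.
  + by rewrite (old b bS) new => eq; have := pmax b bS; rewrite -eq ltnn.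
  + by rewrite (old a aS) new => eq; have := pmax a aS; rewrite eq ltnn.
  + by rewrite (old a aS) (old b bS) => /pI ->.
- move=> z; rewrite !inE (old x xS) => /orP[/eqP ->|zS].
    by rewrite new leqW // pmin.
  by rewrite (old z zS) pmin.
- move=> z; rewrite !inE new => /orP[/eqP ->|zS]; first by rewrite new.
  by rewrite (old z zS) leqW // pmax.
- move=> a b c d /adj_setU1 ab /adj_setU1 cd; have ey := old y yS.
  apply/and3P => -[h1 h2 h3].
  case: ab => [[ea eb]|[ea eb]|ab].
  + rewrite eb new in h3; case: cd h3 => [[_ ->]|[_ ->]|/(adj_in FS)[_ dS]].
    * by rewrite new ltnn.
    * by rewrite ey ltnNge leqnSn.
    * by rewrite (old d dS) ltnNge (leq_trans (pmax d dS)).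
  + rewrite ea new in h1; case: cd h1 => [[-> _]|[-> _]|/(adj_in FS)[cS _]].
    * by rewrite ey ltnNge leqnSn.
    * by rewrite new ltnn.
    * by rewrite (old c cS) ltnNge (leq_trans (pmax c cS)).
  have [aS bS] := adj_in FS ab; rewrite (old a aS) (old b bS) in h1 h2 h3.
  case: cd => [[ec ed]|[ec ed]|cd].
  + by move: h2; rewrite ec ey ltnNge pmax.
  + by move: h2; rewrite ec new ltnNge leqW // pmax.
  + have [cS dS] := adj_in FS cd; rewrite (old c cS) (old d dS) in h1 h2 h3.
    by have := nc a b c d ab cd; rewrite h1 h2 h3.
Qed.

Lemma ordered_path (V : finType) (T : {set {set V}}) (x : V) s :
  path (adj T) x s -> uniq (x :: s) ->
  exists F pos, [/\ ordered_in [set z in x :: s] F pos x (last x s), F \subset T & #|F| = size s].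
Proof.
elim/last_ind: s => [_ _|s v IH].
  exists set0, (fun _ => 0); split; rewrite ?sub0set ?cards0 //.
  split=> // [||e|a b]; rewrite ?inE ?mem_head // => /eqP-> /eqP->.
  by [].
rewrite rcons_path last_rcons -rcons_cons rcons_uniq => /andP[ps lv] /andP[vn us].
have [F [pos [ord FT cF]]] := IH ps us.
have vn' : v \notin [set z in x :: s] by rewrite inE.
have [pos' ord'] := ordered_append ord vn'.
have -> : [set z in rcons (x :: s) v] = v |: [set z in x :: s].
  by apply/setP => z; rewrite in_setU1 !in_set mem_rcons inE.
exists ([set last x s; v] |: F), pos'; split=> //.
  by rewrite subUset sub1set FT andbT.
rewrite cardsU1 cF size_rcons; suff -> : [set last x s; v] \notin F by [].
by apply/negP => /(oi_sub ord)/subsetP /(_ v); rewrite set22 (negPf vn') => /(_ isT).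
Qed.

(** H is a spanning tree T plus one edge xy. The path of T from x to y is laid out in order, the
    rest of T is inserted leaf by leaf between x and y, and the edge xy then joins the two extreme
    vertices. *)
Lemma unicyclic_order (V : finType) (H : {set {set V}}) :
  simple_graph H -> unicyclic H ->
  exists pos r, [/\ injective pos, noncrossing H pos & forall v, pos r <= pos v].
Proof.
move=> sH /andP[/andP[/card_gt0P[x0 _] /forallP Hc] /eqP eH].
have {}Hc x y : connect (adj H) x y by apply/forallP.
have [T [Tc TH cT]] : exists F, [/\ forall x y, connect (adj F) x y, F \subset H & #|F| + 1 = #|V|].
  have [|||||F [Fc FH cF]] := @grow_leaves V H (fun S F => forall x y, x \in S -> y \in S -> connect (adj F) x y)
    [set x0] set0 x0 Hc.
  - exact: set11.
  - exact: sub0set.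
  - by move=> e; rewrite inE.
  - by move=> x y; rewrite !inE => /eqP -> /eqP ->.
  - move=> S F u v Fc FS _ uS vnS uv x y.
    have old a b : connect (adj F) a b -> connect (adj ([set u; v] |: F)) a b.
      apply: connect_sub => c d cd; apply: connect1; exact: adj_sub (subsetUr _ _) cd.
    have uv' : connect (adj ([set u; v] |: F)) u v by apply: connect1; rewrite /adj setU11.
    have sy := sym_connect_sym (@adj_sym V ([set u; v] |: F)).
    rewrite !inE => /orP[/eqP ->|xS] /orP[/eqP ->|yS].
    + exact: connect0.
    + by rewrite sy; apply: connect_trans uv'; apply/old/Fc.
    + by apply: connect_trans uv'; apply/old/Fc.
    + exact/old/Fc.
  - by exists F; split=> //; [move=> x y; apply: Fc; rewrite inE|rewrite cards1 cards0 in cF].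
have [e eHT] : exists e, e \in H :\: T.
  by apply/set0Pn; rewrite -card_gt0 cardsDS // subn_gt0 eH -cT addn1.
have {eHT} [eH' eT] : e \in H /\ e \notin T by move: eHT; rewrite inE => /andP[].
have HE : H = e |: T.
  apply/esym/eqP; rewrite eqEcard subUset sub1set eH' TH /= cardsU1 eT eH -cT.
  by rewrite addnC.
have [x [y [xy ee]]] := simple_edge sH eH'.
have /connectP[s' ps' lst'] := Tc x y.
case/shortenP: ps' lst' => s ps us _ ylast.
have [F0 [pos0 [ord0 F0T cF0]]] := ordered_path ps us.
rewrite -ylast in ord0.
have [|||||F [[pos ord] FT cF]] := @grow_leaves V T (fun S F => exists pos, ordered_in S F pos x y)
  [set z in x :: s] F0 x Tc.
- by rewrite inE mem_head.
- by [].
- exact: oi_sub ord0.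
- by exists pos0.
- by move=> S F u v [pos ord] _ _ uS vnS _; apply: ordered_leaf ord xy uS vnS.
have FE : F = T.
  apply/eqP; rewrite eqEcard FT; move: cF; rewrite cF0 cardsE (card_uniqP us) /= -cT.
  by rewrite addn1 !addnS addnC => -[] /addnI ->.
rewrite FE in ord.
exists pos, x; split.
- by move=> a b; apply: (oi_inj ord); rewrite inE.
- have pmin z : pos x <= pos z by apply: oi_min ord _ _; rewrite inE.
  have pmax z : pos z <= pos y by apply: oi_max ord _ _; rewrite inE.
  rewrite HE ee => a b c d ab cd; apply/and3P => -[h1 h2 h3].
  case/adj_setU1: ab => [[ea eb]|[ea eb]|ab].
  + by move: h3; rewrite eb ltnNge pmax.
  + by move: h1; rewrite ea ltnNge pmax.
  case/adj_setU1: cd => [[ec ed]|[ec ed]|cd].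
  + by move: h1; rewrite ec ltnNge pmin.
  + by move: h2; rewrite ec ltnNge pmax.
  + by have := oi_nc ord ab cd; rewrite h1 h2 h3.
- by move=> v; apply: oi_min ord _ _; rewrite inE.
Qed.

(** The graph is a part of a fan: the n + 1 edges at vertex 0 and the n edges between consecutive
    other vertices. It will show that the class of planar graphs is not empty. *)
Lemma fan_graph n m : m <= n.*2.+1 ->
  exists E : {set {set 'I_n.+2}}, [/\ simple_graph E, #|E| = m & noncrossing E val].
Proof.
move=> mn.
pose A := [set p : 'I_n.+2 * 'I_n.+2 | (p.1 < p.2) && ((p.1 == ord0) || (p.2 == p.1.+1 :> nat))].
pose Fan := [set [set p.1; p.2] | p in A].
have cA : n.*2.+1 <= #|A|.
  pose f1 (i : 'I_n.+1) : 'I_n.+2 * 'I_n.+2 := (ord0, lift ord0 i).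
  pose f2 (i : 'I_n) : 'I_n.+2 * 'I_n.+2 := (inord i.+1, inord i.+2).
  have f1I : injective f1 by move=> i j /(congr1 snd); apply: lift_inj.
  have v2 (i : 'I_n) : (val (f2 i).1 = i.+1) /\ (val (f2 i).2 = i.+2).
    by rewrite /f2 /= !inordK //; have := ltn_ord i; lia.
  have f2I : injective f2.
    by move=> i j eq; apply: val_inj; have [h _] := v2 i; have [h' _] := v2 j;
       rewrite eq h' in h; case: h.
  have -> : n.*2.+1 = #|f1 @: setT| + #|f2 @: setT|.
    by rewrite !card_imset // !cardsT !card_ord; lia.
  rewrite -cardsUI [X in _ + X](_ : _ = 0) ?addn0; last first.
    apply/eqP; rewrite cards_eq0 -subset0; apply/subsetP => p; rewrite !inE.
    case/andP=> /imsetP[i _ ->] /imsetP[j _ [eq _]].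
    by have [h _] := v2 j; move: h; rewrite /f2 /= -eq.
  apply/subset_leq_card/subsetP => p; rewrite inE => /orP[] /imsetP[i _ ->].
    by rewrite inE.
  have [h1 h2] := v2 i; rewrite inE; move: (f2 i) h1 h2 => [a b] /= -> ->.
  by rewrite ltnSn eqxx orbT.
have cF : #|Fan| = #|A|.
  rewrite card_in_imset // => -[a b] [c d]; rewrite !inE /= => /andP[ab _] /andP[cd _].
  case/set2_eq => -[e1 e2]; subst => //.
  by have := ltn_trans ab cd; rewrite ltnn.
have : 0 < #|[set B : {set {set 'I_n.+2}} | (B \subset Fan) & #|B| == m]|.
  by rewrite cards_draws bin_gt0 cF (leq_trans mn).
case/card_gt0P => E; rewrite inE => /andP[EF /eqP cE]; exists E.
have adjP x y : adj E x y -> [|| val x == 0, val y == 0, val x == (val y).+1 | val y == (val x).+1].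
  move=> /(subsetP EF) /imsetP[[a b]]; rewrite inE -val_eqE /= => /andP[ab h].
  by case/set2_eq => -[-> ->]; case/orP: h => ->; rewrite ?orbT.
split=> //.
  apply/forall_inP => e /(subsetP EF) /imsetP[[a b]]; rewrite inE /= => /andP[ab _] ->.
  by rewrite cards2 neq_ltn ab.
move=> x y x' y' /adjP xy /adjP xy'; lia.
Qed.

(** * Switchings *)

(** The form of all switchings: [tags a] lists the ways to modify a, [phi a t] is the result, and
    [psi a t] is the code that recovers a and t from it. *)
Lemma double_count (A B T U : finType) (SA : {set A}) (SB : {set B})
    (tags : A -> {set T}) (codes : B -> {set U}) (phi : A -> T -> B) (psi : A -> T -> U) :
  (forall a t, a \in SA -> t \in tags a ->
     phi a t \in SB /\ psi a t \in codes (phi a t)) ->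
  (forall a t a' t', a \in SA -> t \in tags a -> a' \in SA -> t' \in tags a' ->
     phi a t = phi a' t' -> psi a t = psi a' t' -> a = a' /\ t = t') ->
  \sum_(a in SA) #|tags a| <= \sum_(b in SB) #|codes b|.
Proof.
have sumE (X Y : finType) (S : {set X}) (f : X -> {set Y}) :
    \sum_(x in S) #|f x| = #|[set p : X * Y | (p.1 \in S) && (p.2 \in f p.1)]|.
  under eq_bigr => x _ do rewrite -sum1_card.
  by rewrite pair_big_dep /= -sum1_card; apply: eq_bigl => p; rewrite inE.
move=> good inj; rewrite !sumE.
pose h (p : A * T) := (phi p.1 p.2, psi p.1 p.2).
rewrite -(@card_in_imset _ _ h); last first.
  move=> [a t] [a' t']; rewrite !inE /= => /andP[aS tT] /andP[aS' tT'] [e1 e2].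
  by have [-> ->] := inj a t a' t' aS tT aS' tT' e1 e2.
apply/subset_leq_card/subsetP => q /imsetP[[a t]]; rewrite inE /= => /andP[aS tT] ->.
by rewrite inE /=; have [-> ->] := good a t aS tT.
Qed.

Lemma count_leq (A B T U : finType) (SA : {set A}) (SB : {set B})
    (tags : A -> {set T}) (codes : B -> {set U}) (phi : A -> T -> B) (psi : A -> T -> U) M K :
  (forall a t, a \in SA -> t \in tags a ->
     phi a t \in SB /\ psi a t \in codes (phi a t)) ->
  (forall a t a' t', a \in SA -> t \in tags a -> a' \in SA -> t' \in tags a' ->
     phi a t = phi a' t' -> psi a t = psi a' t' -> a = a' /\ t = t') ->
  (forall a, a \in SA -> M <= #|tags a|) -> (forall b, b \in SB -> #|codes b| <= K) ->
  #|SA| * M <= #|SB| * K.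
Proof.
move=> good inj lo hi.
apply: (@leq_trans (\sum_(a in SA) #|tags a|)).
  by rewrite -sum_nat_const; apply: leq_sum.
apply: leq_trans (double_count good inj) _.
by rewrite -sum_nat_const; apply: leq_sum.
Qed.

Section Reach.
Variables (V : finType) (E : {set {set V}}) (D : nat).

(** Only vertices of degree at most D are expanded, so that the size has a bound independent of the
    graph. *)
Fixpoint reach (x : V) (l : nat) : {set V} :=
  if l is l'.+1 then
    reach x l' :|: \bigcup_(z in reach x l' | #|nbrs E z| <= D) nbrs E z
  else [set x].

Lemma card_reach x l : #|reach x l| <= D.+1 ^ l.
Proof.
elim: l => [|l IH] /=; first by rewrite cards1.
apply: leq_trans (leq_card_setU _ _) _; rewrite expnS mulSn; apply: leq_add => //.
apply: (@leq_trans (\sum_(z in reach x l | #|nbrs E z| <= D) #|nbrs E z|)).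
  elim/big_ind2: _ => [|A a B b Aa Bb|z _] //; first by rewrite cards0.
  by apply: leq_trans (leq_card_setU _ _) _; apply: leq_add.
apply: (@leq_trans (\sum_(z in reach x l) D)).
  rewrite big_mkcondr /=; apply: leq_sum => z _; case: ifP => //.
by rewrite sum_nat_const mulnC leq_mul2l IH orbT.
Qed.

Lemma reach_sub x l l' : l <= l' -> reach x l \subset reach x l'.
Proof.
move=> /subnK <-; elim: (l' - l) => [|k IH] //.
by rewrite addSn /=; apply: subset_trans IH (subsetUl _ _).
Qed.

Lemma reach_path x s l :
  path (adj E) x s -> (forall z, z \in x :: s -> #|nbrs E z| <= D) ->
  size s <= l -> last x s \in reach x l.
Proof.
move=> ps ds sl; apply: (subsetP (reach_sub x sl)).
elim/last_ind: s ps ds {sl} => [|s y IH]; first by rewrite /= inE.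
rewrite rcons_path last_rcons size_rcons => /andP[ps xy] ds /=.
rewrite inE; apply/orP; right; apply/bigcupP; exists (last x s); last by rewrite inE.
rewrite IH //.
  by apply: ds; rewrite -rcons_cons mem_rcons inE mem_last orbT.
by move=> z zs; apply: ds; rewrite -rcons_cons mem_rcons inE zs orbT.
Qed.
End Reach.

Lemma card_set_pairs (T U : finType) (A : {set T}) (f : T -> {set U}) (W : finType)
    (g : T -> U -> W) K :
  (forall x, x \in A -> #|f x| <= K) ->
  #|[set g x y | x in A, y in f x]| <= #|A| * K.
Proof.
move=> fK; pose C := \bigcup_(x in A) [set g x y | y in f x].
apply: (@leq_trans #|C|).
  apply/subset_leq_card/subsetP => w /imset2P[x y xA yf ->].
  by apply/bigcupP; exists x => //; apply: imset_f.
rewrite -sum_nat_const; apply: (@leq_trans (\sum_(x in A) #|[set g x y | y in f x]|)).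
  rewrite /C; elim/big_ind2: _ => [|B a B' b Ba Bb|z _] //; first by rewrite cards0.
  by apply: leq_trans (leq_card_setU _ _) _; apply: leq_add.
by apply: leq_sum => x xA; apply: leq_trans (leq_imset_card _ _) (fK x xA).
Qed.

(** Otherwise let S be the component of x once the edge xy is removed. In the degree sum of F over S
    the edge xy counts once and every other edge 0 or 2 times, so an even sum would be odd. *)
Lemma even_edge_cycle (V : finType) (F : {set {set V}}) x y :
  simple_graph F -> even_edges F -> adj F x y ->
  connect (adj (F :\ [set x; y])) x y.
Proof.
move=> sF /forallP evF xy; pose e := [set x; y]; apply: contraT => nxy.
pose S := [set z | connect (adj (F :\ e)) x z].
have xS : x \in S by rewrite inE connect0.
have yS : y \notin S by rewrite inE.
have : ~~ odd (\sum_(z in S) #|inc F z|).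
  by apply: (big_ind (fun n => ~~ odd n)) => // m n; rewrite oddD => /negPf -> /negPf ->.
rewrite sum_card_inc (bigD1 e) //= oddD.
have -> : e :&: S = [set x].
  apply/setP => z; rewrite !inE; have [->|zx] := eqVneq z x; first by rewrite connect0.
  by have [->|] := eqVneq z y; rewrite //= (negPf nxy).
rewrite cards1 /= negbK => o.
suff : ~~ odd (\sum_(i in F | i != e) #|i :&: S|) by rewrite o.
apply: (big_ind (fun n => ~~ odd n)) => // [m n|e' /andP[e'F e'e]].
  by rewrite oddD => /negPf -> /negPf ->.
have [a [b [ab ee]]] := simple_edge sF e'F.
have abF : adj (F :\ e) a b by rewrite /adj -ee !inE e'e.
have aSb : (a \in S) = (b \in S).
  rewrite !inE; apply/idP/idP => h; apply: connect_trans h _; apply: connect1 => //.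
  by rewrite adj_sym.
have [aS|aS] := boolP (a \in S).
  have -> : e' :&: S = e'.
    by apply/setIidPl; rewrite ee subUset !sub1set -aSb aS.
  by rewrite ee cards2 ab.
have -> : e' :&: S = set0.
  apply/setP => z; rewrite in_setI in_set0; apply/negP => /andP[].
  rewrite ee in_set2 => /orP[] /eqP -> zS; first by rewrite zS in aS.
  by rewrite aSb zS in aS.
by rewrite cards0.
Qed.

Lemma card_cover_le (V : finType) (F : {set {set V}}) :
  simple_graph F -> #|\bigcup_(e in F) e| <= 2 * #|F|.
Proof.
move=> /forall_inP sF; rewrite mulnC -sum_nat_const.
apply: (@leq_trans (\sum_(e in F) #|e|)); last first.
  by apply: leq_sum => e /sF /eqP ->.
elim/big_ind2: _ => [|A a B b Aa Bb|e _] //; first by rewrite cards0.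
by apply: leq_trans (leq_card_setU _ _) _; apply: leq_add.
Qed.

(** What the switchings use of planarity, together with [hangs]; the counting is thereby kept apart
    from drawings and real numbers. *)
Record planar_like (P : forall n, {set {set 'I_n}} -> bool) : Prop := PlanarLike {
  pl_sub : forall n (E F : {set {set 'I_n}}), F \subset E -> P n E -> P n F;
  pl_join : forall n (E : {set {set 'I_n}}) x y, simple_graph E -> P n E -> x != y ->
    nbrs E x = set0 -> nbrs E y = set0 -> P n ([set x; y] |: E);
  pl_euler : forall n (E : {set {set 'I_n}}) g, simple_graph E -> P n E ->
    (forall F : {set {set 'I_n}}, F \subset E -> F != set0 -> even_edges F -> g <= #|F|) ->
    (#|E| - #|[set x | nbrs E x != set0]|) * g <= 2 * #|E| }.

Definition class_graphs (P : forall n, {set {set 'I_n}} -> bool) n m :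
    {set {set {set 'I_n}}} :=
  [set E : {set {set 'I_n}} | [&& simple_graph E, #|E| == m & P n E]].

Lemma class_graphsP P n m (E : {set {set 'I_n}}) :
  E \in class_graphs P n m -> [/\ simple_graph E, #|E| = m & P n E].
Proof. by rewrite in_set => /and3P[? /eqP ? ?]. Qed.

(** * Few graphs have linearly many isolated vertices *)

Section Good.
Variables (n : nat) (E : {set {set 'I_n}}) (D L : nat).

(* Deleting a good edge leaves few candidates for it: one end has a large degree,
   or its ends are joined by a short path through vertices of small degree. *)
Definition good_edges : {set {set 'I_n}} :=
  [set e in E | [exists x in e, D < #|nbrs E x|] ||
    [exists F : {set {set 'I_n}}, [&& F \subset E, e \in F, #|F| <= L, even_edges F &
      [forall e' in F, [forall x in e', #|nbrs E x| <= D]]]]].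

(** The bound is [D <=] where [good_edges] has [D <], since deleting the edge lowers the degree by
    one. The radius is 2 L because L edges cover at most 2 L vertices. *)
Definition candidates : {set {set 'I_n}} :=
  [set [set x; y] | x in [set x | D <= #|nbrs E x|], y in [set: 'I_n]] :|:
  [set [set x; y] | x in [set: 'I_n], y in reach E D x (2 * L)].

(** By the handshake lemma at most 2 #|E| / D vertices have degree at least D. For large D the
    candidates are thus a small fraction of all pairs. *)
Lemma card_candidates : simple_graph E ->
  D * #|candidates| <= n * (2 * #|E|) + D * (n * D.+1 ^ (2 * L)).
Proof.
move=> sE; rewrite /candidates.
apply: (@leq_trans (D * (#|[set x | D <= #|nbrs E x|]| * n + n * D.+1 ^ (2 * L)))).
  rewrite leq_mul2l; apply/orP; right.
  apply: leq_trans (leq_card_setU _ _) _; apply: leq_add.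
    by apply: card_set_pairs => x _; rewrite cardsT card_ord.
  rewrite -[X in _ <= X * _](card_ord n) -cardsT; apply: card_set_pairs => x _.
  exact: card_reach.
rewrite mulnDr leq_add2r mulnA mulnC leq_mul2l; apply/orP; right.
rewrite mulnC [2 * _]mulnC -handshake // -sum_nat_const.
rewrite [leqRHS](bigID (fun x => x \in [set x | D <= #|nbrs E x|])) /=.
by apply: leq_trans (leq_addr _ _); apply: leq_sum => x; rewrite inE.
Qed.

End Good.

Lemma nbrs_sub (V : finType) (E F : {set {set V}}) x : F \subset E -> nbrs F x \subset nbrs E x.
Proof. by move=> FE; apply/subsetP => y; rewrite !inE; apply: adj_sub FE. Qed.

Lemma isolated_inc (V : finType) (E : {set {set V}}) x e :
  simple_graph E -> nbrs E x = set0 -> e \in E -> x \notin e.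
Proof.
move=> sE x0 eE; apply/negP => xe.
have : #|inc E x| = 0 by rewrite card_inc // x0 cards0.
by move/eqP; rewrite cards_eq0 => /eqP/setP /(_ e); rewrite !inE eE xe.
Qed.

Lemma good_candidate n (E : {set {set 'I_n}}) D L e (z z' : 'I_n) :
  simple_graph E -> e \in good_edges E D L -> nbrs E z = set0 -> nbrs E z' = set0 ->
  e \in candidates ([set z; z'] |: (E :\ e)) D L.
Proof.
set E' := _ |: _ => sE; rewrite inE => /andP[eE good] z0 z'0.
have nz x : x \in e -> (x != z) && (x != z').
  move=> xe; apply/andP; split; apply: contraTneq xe => ->; exact: isolated_inc eE.
have nE' x : x \in e -> nbrs E x \subset nbrs E' x :|: e.
  move=> xe; apply/subsetP => y; rewrite !inE => xy.
  have [<-|ne] := eqVneq [set x; y] e; first by rewrite set22 orbT.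
  by rewrite /adj !inE ne; rewrite /adj in xy; rewrite xy orbT.
have sub x : x != z -> x != z' -> nbrs E' x \subset nbrs E x.
  move=> xz xz'; apply/subsetP => y; rewrite !inE /adj !inE => /orP[/eqP|/andP[] //].
  by case/set2_eq => -[ex _]; rewrite ex eqxx in xz xz'.
have [x0 [y0 [xy0 ee0]]] := simple_edge sE eE.
case/orP: good => [/exists_inP[x xe Dx]|].
  have [y [xy ee]] : exists y, x != y /\ e = [set x; y].
    move: xe; rewrite ee0 !inE => /orP[]/eqP ->; first by exists y0.
    by exists x0; rewrite eq_sym setUC.
  rewrite inE; apply/orP; left; apply/imset2P; exists x y => //; rewrite ?inE //.
  have : nbrs E x \subset y |: nbrs E' x.
    apply/subsetP => w xw; have := subsetP (nE' x xe) w xw.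
    rewrite !in_setU ee !inE => /orP[->|/orP[/eqP wx|->]]; rewrite ?orbT //.
    by move: xw; rewrite inE wx => /(adj_neq sE); rewrite eqxx.
  move/subset_leq_card/(leq_trans Dx); rewrite cardsU1.
  by case: (_ \notin _); rewrite ?add1n ?add0n ?ltnS // => /ltnW.
case/existsP=> F /and5P[FE eF FL evF /forall_inP low].
have sF := simple_sub FE sE.
rewrite ee0 in eF; have := even_edge_cycle sF evF eF.
case/connectP => s' ps' lst; case/shortenP: ps' lst => s ps us _ lst.
rewrite inE; apply/orP; right; apply/imset2P; exists x0 y0; rewrite ?inE //.
have cov w : w \in x0 :: s -> exists2 e', e' \in F & w \in e'.
  rewrite inE => /orP[/eqP->|ws]; first by exists [set x0; y0]; rewrite ?set21.
  case/splitPr: ws ps {us lst} => s1 s2; rewrite cat_path /= => /and3P[_ aw _].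
  by exists [set last x0 s1; w]; rewrite ?set22 //; move: aw; rewrite /adj inE => /andP[].
(* Only z and z' gain a neighbour in the switching. The path avoids them, so the low degrees along
   it persist. *)
have notz w : w \in x0 :: s -> (w != z) && (w != z').
  move=> /cov[e' /(subsetP FE) e'E we'].
  apply/andP; split; apply: contraTneq we' => ->; exact: isolated_inc e'E.
rewrite lst; apply: reach_path.
- apply: sub_path ps => a b; rewrite /adj !inE => /andP[ne abF].
  by rewrite -ee0 in ne; rewrite ne (subsetP FE _ abF) orbT.
- move=> w ws; have /andP[wz wz'] := notz w ws; have [e' e'F we'] := cov w ws.
  apply: leq_trans (subset_leq_card (sub w wz wz')) _.
  by have /forall_inP := low e' e'F; apply.
- have : #|x0 :: s| <= #|\bigcup_(e in F) e|.
    apply/subset_leq_card/subsetP => w /cov[e' e'F we'].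
    by apply/bigcupP; exists e'.
  rewrite (card_uniqP us) => /leq_trans /(_ (card_cover_le sF)) /= h.
  by apply: ltnW; apply: leq_trans h _; rewrite leq_mul2l.
Qed.

Definition isol (V : finType) (E : {set {set V}}) : {set V} := [set x | nbrs E x == set0].

Lemma card_offdiag (T : finType) (A : {set T}) :
  #|[set p : T * T | [&& p.1 \in A, p.2 \in A & p.1 != p.2]]| = #|A| * #|A|.-1.
Proof.
have -> : #|A| * #|A|.-1 = #|setX A A| - #|[set (x, x) | x in A]|.
  by rewrite cardsX card_imset => [|x y [->]] //; case: #|A| => // a; rewrite mulnSr addnK.
rewrite -cardsDS; last by apply/subsetP => _ /imsetP[x xA ->]; rewrite inE /= xA.
apply: eq_card => -[x y]; rewrite in_set in_setD in_setX /=.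
have -> : ((x, y) \in [set (x, x) | x in A]) = (x \in A) && (x == y).
  apply/imsetP/andP => [[z zA [-> ->]]|[xA /eqP <-]]; first by rewrite zA eqxx.
  by exists x.
by case: (x \in A); case: (y \in A); case: (x == y).
Qed.

(** Bad edges span no nonempty even set with fewer than 16 k edges, so by [pl_euler] they exceed the
    nonisolated vertices by at most 4 n / (16 k). With n / k isolated vertices there are at most n -
    3 n / (4 k) of them, whereas m is at least n - n / (4 k). *)
Lemma num_good P n m k K E : planar_like P ->
  E \in class_graphs P n m -> 0 < k -> 4 * k * n <= 4 * k * m + n -> m <= 2 * n ->
  n <= k * #|isol E| -> n <= 2 * k * #|good_edges E K (16 * k).-1|.
Proof.
move=> pl; rewrite inE => /and3P[sE /eqP cE PE] k0 mn m2 ik.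
pose bad := E :\: good_edges E K (16 * k).-1.
have gE : good_edges E K (16 * k).-1 \subset E.
  by apply/subsetP => e; rewrite inE => /andP[].
have bE : bad \subset E by apply: subsetDl.
have girth (F : {set {set 'I_n}}) : F \subset bad -> F != set0 -> even_edges F -> 16 * k <= #|F|.
  move=> Fb /set0Pn[e eF] Fev; rewrite leqNgt; apply/negP => Fk.
  have := subsetP Fb e eF; rewrite inE => /andP[+ eE]; case/negP.
  rewrite inE eE; apply/orP; right; apply/existsP; exists F.
  rewrite (subset_trans Fb bE) eF Fev /=; apply/andP; split.
    by rewrite -ltnS prednK // muln_gt0 k0.
  apply/forall_inP => e' e'F; apply/forall_inP => x xe'.
  rewrite leqNgt; apply/negP => Dx.
  have := subsetP Fb e' e'F; rewrite inE => /andP[+ e'E]; case/negP.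
  rewrite inE e'E; apply/orP; left; apply/exists_inP; by exists x.
have := pl_euler pl (simple_sub bE sE) (pl_sub pl bE PE) girth.
have cov : #|[set x | nbrs bad x != set0]| + #|isol E| <= n.
  rewrite -[X in _ <= X](card_ord n) -cardsT.
  rewrite -cardsUI [X in _ + X](_ : _ = 0) ?addn0; last first.
    apply/eqP; rewrite cards_eq0 -subset0; apply/subsetP => x; rewrite !inE.
    case/andP=> + /eqP x0; case/negP; rewrite -subset0 -x0; exact: nbrs_sub.
  by apply/subset_leq_card/subsetP => x; rewrite inE.
have := cardsID (good_edges E K (16 * k).-1) E.
rewrite (setIidPr gE) -/bad cE.
move: #|good_edges _ _ _| #|bad| #|isol E| #|[set x | nbrs bad x != set0]| ik cov => g b i c ik cov gb.
move=> h.
have {h} h1 : (b - c) * (16 * k) <= 4 * n by lia.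
have h2 : b <= c + (b - c) by lia.
move: (b - c) h1 h2 => d h1 h2.
have h3 : 4 * (k * d) <= n by lia.
have h4 : k * b <= k * c + k * d by rewrite -mulnDr leq_mul2l h2 orbT.
have h5 : k * c + k * i <= k * n by rewrite -mulnDr leq_mul2l cov orbT.
have h6 : k * g + k * b = k * m by rewrite -mulnDr gb.
by rewrite -!mulnA in mn *; lia.
Qed.

Lemma few_isolated P k K : planar_like P -> 0 < k -> 0 < K ->
  exists n0, forall n m, n0 <= n -> 4 * k * n <= 4 * k * m + n -> m <= 2 * n ->
  K * #|[set E in class_graphs P n m | n <= k * #|isol E|]| <= #|class_graphs P n m|.
Proof.
(* There will be at least n^3 / (4 k^3) tags per graph and at most 5 n^3 / D codes per result, so D
   has to be at least 20 k^3 K. *)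
move=> pl k0 K0; pose D := 32 * (k * (k * (k * K))); pose L := (16 * k).-1.
pose C := D.+1 ^ (2 * L).
(* n > 2 k makes #|isol E| - 1 at least half of #|isol E|; n > D * C absorbs the [reach] term of
   [card_candidates]. *)
exists (2 * k + D * C).+1 => n m n0 mn m2.
have n_gt0 : 0 < n by lia.
set A := [set E in _ | _]; set G := class_graphs P n m.
pose tags (E : {set {set 'I_n}}) := setX (good_edges E D L)
  [set p : 'I_n * 'I_n | [&& p.1 \in isol E, p.2 \in isol E & p.1 != p.2]].
pose phi (E : {set {set 'I_n}}) (t : {set 'I_n} * ('I_n * 'I_n)) := [set t.2.1; t.2.2] |: (E :\ t.1).
(* Only one of the two joined vertices is stored: the other is its unique neighbour in the
   result. *)
pose psi (E : {set {set 'I_n}}) (t : {set 'I_n} * ('I_n * 'I_n)) := (t.2.1, t.1).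
pose codes (E : {set {set 'I_n}}) := setX [set: 'I_n] (candidates E D L).
have tagP E t : E \in A -> t \in tags E -> [/\ E \in G, simple_graph E, t.1 \in E &
   [/\ nbrs E t.2.1 = set0, nbrs E t.2.2 = set0, t.2.1 != t.2.2 & [set t.2.1; t.2.2] \notin E :\ t.1]].
  case: t => e [z z'] /setIdP[EG _]; have [sE _ _] := class_graphsP EG.
  rewrite in_setX in_set => /andP[tg /and3P[/= zI zI' zz']].
  have eE : e \in E by move: tg => /setIdP[].
  have z0 : nbrs E z = set0 by move: zI; rewrite in_set => /eqP.
  have z'0 : nbrs E z' = set0 by move: zI'; rewrite in_set => /eqP.
  split; [exact: EG|exact: sE|exact: eE|].
  split=> //; apply/negP; rewrite in_setD => /andP[_ zE].
  by have := isolated_inc sE z0 zE; rewrite set21.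
have main : \sum_(E in A) #|tags E| <= \sum_(E in G) #|codes E|.
  apply: (@double_count _ _ _ _ A G tags codes phi psi).
  - move=> E t EA tT; have [EG sE tE [z0 z'0 zz' nE]] := tagP E t EA tT; split.
      move: EG; rewrite !inE => /and3P[_ /eqP cE PE]; apply/and3P; split.
      + rewrite simpleU //; last by apply: simple_sub sE; apply: subD1set.
        by apply/forall_inP => e; rewrite inE => /eqP->; rewrite cards2 zz'.
      + by rewrite /phi cardsU1 nE -cE (cardsD1 t.1 E) tE.
      + apply: (pl_join pl) => //.
        * by apply: simple_sub sE; apply: subD1set.
        * by apply: (pl_sub pl) PE; apply: subD1set.
        * by apply/eqP; rewrite -subset0 -z0; apply/nbrs_sub/subD1set.
        * by apply/eqP; rewrite -subset0 -z'0; apply/nbrs_sub/subD1set.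
    rewrite inE in_setT /=; apply: good_candidate => //.
    by move: tT; rewrite inE => /andP[].
  - move=> E [e [z z']] E' [f [y y']] EA tT EA' tT' eq_phi [ezy eef].
    have [_ sE eE [z0 z'0 zz' nE]] := tagP _ _ EA tT.
    have [_ sE' fE' [y0 y'0 yy' nE']] := tagP _ _ EA' tT'.
    rewrite /phi /= in eq_phi nE nE' eE fE' z0 z'0 zz' y0 y'0 yy'.
    subst y f.
    have incz (X : {set {set 'I_n}}) w : simple_graph X -> nbrs X z = set0 ->
       [set g in [set z; w] |: (X :\ e) | z \in g] = [set [set z; w]].
      move=> sX zX; apply/setP => g; rewrite !inE; apply/andP/eqP.
        move=> [/orP[/eqP //|/andP[_ gX]] zg].
        by have := isolated_inc sX zX gX; rewrite zg.
      by move=> ->; rewrite eqxx set21.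
    have zz : z' = y'.
      have := incz E z' sE z0; rewrite eq_phi incz // => /set1_inj /esym.
      exact: set2_inj.
    split; last by rewrite zz.
    rewrite -(setD1K eE) -(setD1K fE'); congr (_ |: _).
    by rewrite -(setU1K nE) eq_phi zz setU1K // -zz.
have tagc E : E \in A -> n * (n * n) <= 4 * (k * (k * k)) * #|tags E|.
  move=> EA; have := EA; rewrite inE => /andP[EG ik].
  have := num_good D pl EG k0 mn m2 ik.
  rewrite cardsX card_offdiag -/L.
  have : n <= 2 * (k * #|isol E|.-1) by case: #|isol E| ik => [|i] /=; lia.
  move: #|good_edges _ _ _| #|isol E| #|isol E|.-1 ik => g i i1 ik h1 h2.
  have := leq_mul h2 (leq_mul ik h1).
  by rewrite (_ : 2 * k * g * (k * i * (2 * (k * i1))) = 4 * (k * (k * k)) * (g * (i * i1))) //; lia.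
have codec E : E \in G -> D * #|codes E| <= n * (n * (5 * n)).
  rewrite inE => /and3P[sE /eqP cE _].
  rewrite cardsX cardsT card_ord mulnCA leq_mul2l; apply/orP; right.
  apply: leq_trans (card_candidates D L sE) _; rewrite cE -/C [D * (n * C)]mulnCA -mulnDr leq_mul2l.
  apply/orP; right; lia.
have tot : D * (#|A| * (n * (n * n))) <= 4 * (k * (k * k)) * (#|G| * (n * (n * (5 * n)))).
  apply: (@leq_trans (D * (4 * (k * (k * k)) * \sum_(E in A) #|tags E|))).
    rewrite leq_mul2l; apply/orP; right; rewrite -sum_nat_const big_distrr /=.
    by apply: leq_sum => E /tagc.
  apply: (@leq_trans (D * (4 * (k * (k * k)) * \sum_(E in G) #|codes E|))).
    by rewrite !leq_mul2l main !orbT.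
  rewrite mulnCA leq_mul2l; apply/orP; right.
  by rewrite -sum_nat_const big_distrr /=; apply: leq_sum => E /codec.
have : (n * (n * n)) * (k * (k * k)) * (32 * (K * #|A|)) <= (n * (n * n)) * (k * (k * k)) * (20 * #|G|).
  by move: tot; rewrite /D; lia.
rewrite leq_pmul2l; first by lia.
by rewrite !muln_gt0 n_gt0 k0.
Qed.

Definition hangs (P : forall n, {set {set 'I_n}} -> bool) (V : finType)
    (H : {set {set V}}) (r : V) : Prop :=
  forall n (E : {set {set 'I_n}}) (f : V -> 'I_n), simple_graph E -> P n E ->
  injective f -> (forall v, v != r -> nbrs E (f v) = set0) -> #|nbrs E (f r)| <= 1 ->
  P n (E :|: imgraph f H).

(** * Planting a copy of H and finding it again *)

Section Attach.
Variables (V W : finType) (H : {set {set V}}) (r : V) (E : {set {set W}}) (f : V -> W).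
Hypotheses (sH : simple_graph H) (sE : simple_graph E).
Hypothesis iso : forall v, v != r -> nbrs E (f v) = set0.

Lemma attach_disjoint : E :&: imgraph f H = set0.
Proof.
apply/setP => e; rewrite in_setI in_set0; apply/negP => /andP[eE /(imgraphP sH)[x [y [xy ee]]]].
have [xr|xr] := eqVneq x r.
  have yr : y != r by apply: contraTneq xy => ->; apply/negP => /(adj_neq sH); rewrite xr eqxx.
  by have := isolated_inc sE (iso yr) eE; rewrite ee set22.
by have := isolated_inc sE (iso xr) eE; rewrite ee set21.
Qed.

Lemma attachK : (E :|: imgraph f H) :\: imgraph f H = E.
Proof. by rewrite setDUl setDv setU0; apply/setDidPl; rewrite -setI_eq0 attach_disjoint. Qed.

Lemma card_attach : injective f -> #|E :|: imgraph f H| = #|E| + #|H|.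
Proof. by move=> fI; rewrite cardsU attach_disjoint cards0 subn0 card_imgraph. Qed.

Lemma nbrs_attach x : (forall v, f v != x) -> nbrs (E :|: imgraph f H) x = nbrs E x.
Proof.
move=> nx; apply/setP => y; rewrite !in_set /adj in_setU; case: (_ \in E) => //=.
apply/negP => /(imgraphP sH)[a [b [_ /set2_eq[[ex _]|[ex _]]]]];
  by [have := nx a; rewrite ex eqxx|have := nx b; rewrite ex eqxx].
Qed.

Lemma card_nbrs_attach v : #|nbrs E (f r)| <= 1 ->
  #|nbrs (E :|: imgraph f H) (f v)| <= #|V|.+1.
Proof.
move=> fr; apply: (@leq_trans #|nbrs E (f v) :|: f @: V|).
  apply/subset_leq_card/subsetP => y; rewrite !in_set /adj in_setU => /orP[->//|].
  case/(imgraphP sH) => a [b [_ /set2_eq[[_ ->]|[_ ->]]]]; apply/orP; right; exact: imset_f.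
apply: leq_trans (leq_card_setU _ _) _; rewrite -add1n; apply: leq_add.
  by have [->//|/iso ->] := eqVneq v r; rewrite cards0.
exact: leq_imset_card.
Qed.
End Attach.

Section Placements.
Variables (V : finType) (H : {set {set V}}) (n : nat).
Hypotheses (sH : simple_graph H) (cH : connected_graph H).
Implicit Types (E : {set {set 'I_n}}) (f g : {ffun V -> 'I_n}).

Definition homs E : {set {ffun V -> 'I_n}} :=
  [set f : {ffun V -> 'I_n} | [forall x, forall y, adj H x y ==> adj E (f x) (f y)]].

Lemma homsP E f x y : f \in homs E -> adj H x y -> adj E (f x) (f y).
Proof. by rewrite in_set => /forallP /(_ x)/forallP /(_ y)/implyP. Qed.

Lemma has_copyP E : reflect (exists2 f : {ffun V -> 'I_n}, injective f & f \in homs E) (has_copy H E).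
Proof.
apply: (iffP existsP) => [[f /andP[/injectiveP fI fH]]|[f fI fH]]; exists f => //.
  by rewrite in_set.
by apply/andP; split; [apply/injectiveP|move: fH; rewrite in_set].
Qed.

(* The homomorphic images of H, through vertices of bounded degree, that meet a
   fixed copy of H. *)
Definition placements E : {set {ffun V -> 'I_n}} :=
  if [pick g : {ffun V -> 'I_n} | injectiveb g && (g \in homs E)] is Some g then
    [set f in homs E | [forall v, #|nbrs E (f v)| <= #|V|.+1] &&
                       [exists v, exists u, f v == g u]]
  else set0.

(** The factors are the choice of the common vertex in the fixed copy, and for each vertex of H a
    point of a [reach] set of radius #|V| with degree bound #|V| + 1. There is no dependence on
    n. *)
Definition max_placements := #|V| * (#|V|.+2 ^ #|V|) ^ #|V|.

Lemma hom_reach E f u v : f \in homs E -> (forall v, #|nbrs E (f v)| <= #|V|.+1) ->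
  f v \in reach E #|V|.+1 (f u) #|V|.
Proof.
move=> fH deg; case/andP: cH => _ /forallP /(_ u)/forallP /(_ v)/connectP [s' ps' lst].
case/shortenP: ps' lst => s ps us _ ->.
rewrite -last_map; apply: reach_path.
- by rewrite path_map; apply: sub_path ps => a b; apply: homsP.
- by move=> z; rewrite -map_cons => /mapP[w _ ->].
- by rewrite size_map; apply: ltnW; rewrite -[_.+1]/(size (u :: s)) -(card_uniqP us) max_card.
Qed.

Lemma card_placements E : #|placements E| <= max_placements.
Proof.
rewrite /placements; case: pickP => [g _|_]; last by rewrite cards0.
pose R u := [set f : {ffun V -> 'I_n} | f \in ffun_on (mem (reach E #|V|.+1 (g u) #|V|))].
apply: (@leq_trans #|\bigcup_u R u|).
  apply/subset_leq_card/subsetP => f; rewrite in_set => /and3P[fH /forallP deg].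
  case/existsP => v /existsP[u /eqP fv]; apply/bigcupP; exists u => //.
  rewrite in_set; apply/ffun_onP => w; rewrite -fv; exact: hom_reach.
rewrite /max_placements -sum_nat_const.
apply: (@leq_trans (\sum_u #|R u|)).
  elim/big_ind2: _ => [|A a B b Aa Bb|e _] //; first by rewrite cards0.
  by apply: leq_trans (leq_card_setU _ _) _; apply: leq_add.
apply: leq_sum => u _; rewrite cardsE card_ffun_on leq_exp2r; first exact: card_reach.
by case/andP: cH.
Qed.

(** The copy that [placements] picks in the new graph cannot avoid the image of f, or it would
    already be a copy in E. *)
Lemma attach_placement E r f : simple_graph E -> ~~ has_copy H E -> injective f ->
  (forall v, v != r -> nbrs E (f v) = set0) -> #|nbrs E (f r)| <= 1 ->
  f \in placements (E :|: imgraph f H).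
Proof.
move=> sE noH fI iso fr; set E' := _ :|: _.
have fH : f \in homs E'.
  rewrite in_set; apply/forallP => x; apply/forallP => y; apply/implyP => xy.
  by rewrite /adj in_setU mem_imgraph // orbT.
rewrite /placements; case: pickP => [g /andP[/injectiveP gI gH]|/(_ f)]; last first.
  by rewrite fH andbT => /injectiveP; case.
rewrite in_set fH /=; apply/andP; split; first by apply/forallP => v; apply: card_nbrs_attach iso _ fr.
apply: contraR noH => /existsPn nomeet; apply/has_copyP; exists g => //.
rewrite in_set; apply/forallP => x; apply/forallP => y; apply/implyP => xy.
have := homsP gH xy; rewrite /adj in_setU => /orP[//|/(imgraphP sH)[a [b [_ ee]]]].
exfalso; have : g x \in [set f a; f b] by rewrite -ee set21.
by rewrite in_set2 => /orP[]/eqP gx; [have := nomeet a|have := nomeet b];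
  move/existsPn/(_ x); rewrite gx eqxx.
Qed.
End Placements.

Lemma has_copy_sub (V : finType) (H : {set {set V}}) n (E F : {set {set 'I_n}}) :
  F \subset E -> has_copy H F -> has_copy H E.
Proof.
move=> FE /has_copyP[f fI fH]; apply/has_copyP; exists f => //.
rewrite in_set; apply/forallP => x; apply/forallP => y; apply/implyP => xy.
exact: adj_sub FE (homsP fH xy).
Qed.

Lemma ffact_ge m : forall n, (n.+1 - m) ^ m <= n ^_ m.
Proof.
elim: m => [|m IH] n; first by rewrite expn0 ffactn0.
case: n => [|n]; first by rewrite subSS sub0n exp0n.
rewrite ffactnS /= subSS expnS; apply: leq_mul; first by rewrite leq_subr.
exact: IH.
Qed.

(** * Graphs with linearly many leaves *)

Definition leaves (V : finType) (E : {set {set V}}) : {set V} := [set x | #|nbrs E x| == 1].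

Definition nbr (V : finType) (E : {set {set V}}) (x : V) : V := odflt x [pick y in nbrs E x].

Lemma nbrs_leaf (V : finType) (E : {set {set V}}) x : x \in leaves E -> nbrs E x = [set nbr E x].
Proof.
rewrite in_set => /cards1P[y yE]; rewrite /nbr; case: pickP => [z|/(_ y)].
  by rewrite yE in_set1 => /eqP ->.
by rewrite yE set11.
Qed.

(** Of a component that is a single edge only the smaller end is retained, so distinct chosen leaves
    have distinct edges. *)
Definition indep_leaves n (E : {set {set 'I_n}}) : {set 'I_n} :=
  [set x in leaves E | (nbr E x \in leaves E) ==> (x < nbr E x)].

Lemma indep_leaves_sub n (E : {set {set 'I_n}}) x : x \in indep_leaves E -> x \in leaves E.
Proof. by rewrite in_set => /andP[]. Qed.

Lemma adj_leaf (V : finType) (E : {set {set V}}) x y : x \in leaves E -> adj E x y -> y = nbr E x.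
Proof.
move=> xl xy; have : y \in nbrs E x by rewrite in_set.
by rewrite nbrs_leaf // in_set1 => /eqP.
Qed.

Lemma adj_nbr_leaf (V : finType) (E : {set {set V}}) x : x \in leaves E -> adj E x (nbr E x).
Proof. by move=> xl; have := set11 (nbr E x); rewrite -nbrs_leaf // in_set. Qed.

Lemma indep_leavesP n (E : {set {set 'I_n}}) x y :
  x \in indep_leaves E -> y \in indep_leaves E -> adj E x y -> False.
Proof.
rewrite !in_set => /andP[xl /implyP hx] /andP[yl /implyP hy] xy.
have yx : adj E y x by rewrite adj_sym.
have xl' : x \in leaves E by rewrite in_set.
have yl' : y \in leaves E by rewrite in_set.
have ey := adj_leaf xl' xy; have ex := adj_leaf yl' yx.
rewrite -ey in hx; rewrite -ex in hy.
by have := ltn_trans (hx yl) (hy xl); rewrite ltnn.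
Qed.

Lemma card_indep_leaves n (E : {set {set 'I_n}}) : simple_graph E ->
  #|leaves E| <= 2 * #|indep_leaves E|.
Proof.
move=> sE; rewrite -(cardsID (indep_leaves E) (leaves E)) mul2n -addnn; apply: leq_add.
  exact/subset_leq_card/subsetIr.
have H x : x \in leaves E :\: indep_leaves E ->
    [/\ x \in leaves E, nbr E x \in leaves E, nbr E x < x & nbr E (nbr E x) = x].
  rewrite in_setD => /andP[+ xl]; rewrite in_set xl /= negb_imply -leqNgt => /andP[nl nx].
  have xn := adj_nbr_leaf xl; have nx' : adj E (nbr E x) x by rewrite adj_sym.
  split=> //; last by rewrite -(adj_leaf nl nx').
  by rewrite ltn_neqAle nx andbT; have := adj_neq sE nx'; rewrite -val_eqE.
rewrite -(@card_in_imset _ _ (nbr E)); last first.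
  by move=> x y /H[_ _ _ ex] /H[_ _ _ ey] eq; rewrite -ex -ey eq.
apply/subset_leq_card/subsetP => _ /imsetP[x /H[xl nl nx nn] ->].
by rewrite in_set nl nn nx implybT.
Qed.

(** Graphs with at least n / k isolated vertices contribute at most n each and are rare; the others
    contribute less than n / k each. *)
Lemma sum_isolated P n m k : n * (k * #|[set E in class_graphs P n m | n <= k * #|isol E|]|) <= n * #|class_graphs P n m| ->
  k * (\sum_(E in class_graphs P n m) #|isol E|) <= 2 * (n * #|class_graphs P n m|).
Proof.
set G := class_graphs P n m; set A := [set E in G | _] => hA.
rewrite big_distrr /=.
apply: (@leq_trans (\sum_(E in G) (n + (if E \in A then k * n else 0)))).
  apply: leq_sum => E EG; rewrite in_set EG /=; case: (leqP n) => h; last by rewrite addn0 ltnW.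
  by apply: leq_trans (leq_addl _ _); rewrite leq_mul2l -[X in _ <= X](card_ord n) max_card orbT.
rewrite big_split /= sum_nat_const -big_mkcondr /= mul2n -addnn mulnC leq_add2l.
apply: leq_trans hA; rewrite (eq_bigl (mem A)); last first.
  by move=> E /=; rewrite !in_set; case: (_ && P n E) => //=; rewrite ?andbF //; case: (simple_graph E).
by rewrite sum_nat_const; lia.
Qed.

Section ManyLeaves.
Variables (P : forall n, {set {set 'I_n}} -> bool) (V : finType) (H : {set {set V}}) (r : V).
Hypotheses (pl : planar_like P) (sH : simple_graph H) (uH : unicyclic H) (hH : hangs P H r).

Let cH : connected_graph H. Proof. by case/andP: uH. Qed.
Let eH : #|H| = #|V|. Proof. by case/andP: uH => _ /eqP. Qed.
Let h := #|V|.

Lemma many_leaves_count n m a :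
  (\sum_(E in [set E in class_graphs P n m | ~~ has_copy H E & n <= a * #|leaves E|])
     #|indep_leaves E| ^_ h.+1) <=
  max_placements V * n ^ h * \sum_(E in class_graphs P n m) #|isol E|.
Proof.
set A := [set E in _ | _]; set G := class_graphs P n m.
(* The leaf [t (Some v)] receives the vertex v of H, and [t None] becomes isolated. All edges at
   chosen leaves are deleted except the one at [t (Some r)]: h edges, as many as H has. *)
pose tags (E : {set {set 'I_n}}) := [set t : {ffun option V -> 'I_n} |
  (t \in ffun_on (mem (indep_leaves E))) && injectiveb t].
have tagsE E : #|indep_leaves E| ^_ h.+1 = #|tags E|.
  rewrite -card_option -card_inj_ffuns_on; apply: eq_card => t; rewrite !inE andbC.
  by [].
under eq_bigr => E _ do rewrite tagsE.
pose fr (t : {ffun option V -> 'I_n}) := [ffun v => t (Some v)] : {ffun V -> 'I_n}.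
pose others := [set o : option V | o != Some r].
pose del (E : {set {set 'I_n}}) (t : {ffun option V -> 'I_n}) := [set [set t o; nbr E (t o)] | o in others].
pose phi (E : {set {set 'I_n}}) t := (E :\: del E t) :|: imgraph (fr t) H.
(* The former neighbours of the h detached leaves, indexed by V: the slot of r, whose leaf stays
   attached, is used for [None]. *)
pose nb (E : {set {set 'I_n}}) (t : {ffun option V -> 'I_n}) : {ffun V -> 'I_n} :=
  [ffun v => nbr E (t (if v == r then None else Some v))].
pose psi (E : {set {set 'I_n}}) t := (fr t, (t None, nb E t)).
pose codes (E : {set {set 'I_n}}) := setX (placements H E) (setX (isol E) [set: {ffun V -> 'I_n}]).
have codesE E : #|codes E| <= max_placements V * n ^ h * #|isol E|.
  rewrite !cardsX cardsT card_ffun card_ord -mulnA [n ^ h * _]mulnC.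
  by apply: leq_mul => //; apply: card_placements.
apply: (@leq_trans (\sum_(E in G) #|codes E|)); last first.
  by rewrite big_distrr /=; apply: leq_sum => E _.
have base E t : E \in A -> t \in tags E ->
  [/\ E \in G, ~~ has_copy H E, injective t, forall o, t o \in indep_leaves E &
   [/\ simple_graph E, #|E| = m, P E, injective (fr t) & 
    [/\ forall o, o != Some r -> nbrs (E :\: del E t) (t o) = set0,
     #|nbrs (E :\: del E t) (t (Some r))| <= 1, del E t \subset E & #|del E t| = h]]].
  case/setIdP => EG /andP[noH _]; rewrite in_set => /andP[/ffun_onP tL /injectiveP tI].
  have [sE cE PE] := class_graphsP EG.
  have tl o := indep_leaves_sub (tL o).
  split=> //; split=> //.
    by move=> u v; rewrite !ffunE => /tI[].
  split.
  - move=> o oo; apply/setP => y; rewrite in_set in_set0 /adj in_setD.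
    case E1: ([set t o; y] \in E); rewrite ?andbF // andbT; apply/negbTE; rewrite negbK.
    apply/imsetP; exists o; rewrite ?in_set //.
    by rewrite (adj_leaf (tl o) (E1 : adj E _ _)).
  - apply: leq_trans (subset_leq_card (nbrs_sub _ (subsetDl _ _))) _.
    by have := tl (Some r); rewrite in_set => /eqP ->.
  - by apply/subsetP => _ /imsetP[o _ ->]; apply: adj_nbr_leaf.
  - rewrite card_in_imset.
      have -> : others = [set~ Some r] by apply/setP => o; rewrite !inE.
      by rewrite cardsC1 card_option.
    move=> o o' _ _ /set2_eq[[/tI //]|[eo _]].
    exfalso; apply: (indep_leavesP (tL o') (tL o)); rewrite eo; exact: adj_nbr_leaf.
apply: (@double_count _ _ _ _ A G tags codes phi psi).
- move=> E t EA tT; have [EG noH tI tL [sE cE PE fI [iso lf dE cd]]] := base E t EA tT.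
  have sE0 : simple_graph (E :\: del E t) by apply: simple_sub sE; apply: subsetDl.
  have isof v : v != r -> nbrs (E :\: del E t) (fr t v) = set0.
    by move=> vr; rewrite ffunE; apply: iso.
  have lff : #|nbrs (E :\: del E t) (fr t r)| <= 1 by rewrite ffunE.
  split.
    rewrite in_set; apply/and3P; split.
    + by apply: simpleU => //; apply: simple_imgraph.
    + rewrite /phi (card_attach sH sE0 isof fI) cardsDS // cd cE eH subnK //.
      by rewrite -cE -cd subset_leq_card.
    + by apply: hH => //; apply: (pl_sub pl) PE; apply: subsetDl.
  rewrite in_setX; apply/andP; split.
    apply: (attach_placement (r := r) sH sE0 _ fI isof lff).
    by apply: contra noH; apply: has_copy_sub; apply: subsetDl.
  rewrite in_setX in_setT andbT in_set (nbrs_attach _ sH); first by rewrite iso.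
  by move=> v; rewrite ffunE (inj_eq tI).
- move=> E t E' t' EA tT EA' tT' ephi [efr eN enb].
  have [EG noH tI tL [sE cE PE fI [iso lf dE cd]]] := base E t EA tT.
  have [EG' noH' tI' tL' [sE' cE' PE' fI' [iso' lf' dE' cd']]] := base E' t' EA' tT'.
  have tt : t = t'.
    apply/ffunP => -[v|//]; have /ffunP/(_ v) := efr; by rewrite !ffunE.
  split=> //; subst t'.
  have isof v : v != r -> nbrs (E :\: del E t) (fr t v) = set0.
    by move=> vr; rewrite ffunE; apply: iso.
  have isof' v : v != r -> nbrs (E' :\: del E' t) (fr t v) = set0.
    by move=> vr; rewrite ffunE; apply: iso'.
  have sE0 : simple_graph (E :\: del E t) by apply: simple_sub sE; apply: subsetDl.
  have sE0' : simple_graph (E' :\: del E' t) by apply: simple_sub sE'; apply: subsetDl.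
  have e0 : E :\: del E t = E' :\: del E' t.
    by rewrite -(attachK sH sE0 isof) -(attachK sH sE0' isof') -/(phi _ _) ephi.
  have ed : del E t = del E' t.
    apply: eq_in_imset => o; rewrite in_set => oo; congr [set _; _].
    case: o oo => [v|] oo.
      have /ffunP/(_ v) := enb; rewrite !ffunE ifN //.
    by have /ffunP/(_ r) := enb; rewrite !ffunE eqxx.
  rewrite -(setID E (del E t)) -(setID E' (del E' t)) (setIidPr dE) (setIidPr dE').
  by rewrite e0 ed.
Qed.

Lemma many_leaves a K : 0 < a -> 0 < K -> exists n0, forall n m, n0 <= n ->
  4 * (2 * (max_placements V * (4 * a) ^ h.+1) * K) * n <=
    4 * (2 * (max_placements V * (4 * a) ^ h.+1) * K) * m + n -> m <= 2 * n ->
  K * #|[set E in class_graphs P n m | ~~ has_copy H E & n <= a * #|leaves E|]|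
    <= #|class_graphs P n m|.
Proof.
move=> a0 K0; pose C := max_placements V.
have C0 : 0 < C.
  have V0 : 0 < #|V| by case/andP: cH.
  by rewrite /C /max_placements !muln_gt0 !expn_gt0 V0.
have p0 : 0 < C * (4 * a) ^ h.+1 by rewrite muln_gt0 C0 expn_gt0 muln_gt0 a0.
(* A graph has on average at most 2 n / k isolated vertices, so about C n^h (2 n / k) codes face
   n^(h+1) / (4 a)^(h+1) tags, a ratio of 1 / K. *)
pose k := 2 * (C * (4 * a) ^ h.+1) * K.
have k0 : 0 < k by rewrite /k muln_gt0 K0 muln_gt0 p0.
have [n1 few] := few_isolated pl k0 k0.
exists (n1 + 4 * a * h.+1).+1 => n m n0 mn m2.
have n_gt0 : 0 < n by lia.
set A := [set E in _ | _]; set G := class_graphs P n m.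
have rare : k * #|[set E in G | n <= k * #|isol E|]| <= #|G|.
  by apply: few => //; lia.
have Siso : k * (\sum_(E in G) #|isol E|) <= 2 * (n * #|G|).
  by apply: sum_isolated; rewrite leq_mul2l rare orbT.
have cnt := many_leaves_count n m a.
(* Half of the n / a leaves are independent, and n / (2 a) - h is still at least n / (4 a). *)
have low E : E \in A -> n ^ h.+1 <= (4 * a) ^ h.+1 * #|indep_leaves E| ^_ h.+1.
  case/setIdP=> EG /andP[_ nl]; have [sE _ _] := class_graphsP EG.
  have := card_indep_leaves sE; move: #|leaves E| #|indep_leaves E| nl => l i nl li.
  apply: (@leq_trans ((4 * a) ^ h.+1 * (i.+1 - h.+1) ^ h.+1)); last first.
    by rewrite leq_mul2l ffact_ge orbT.
  rewrite -expnMn leq_exp2r // subSS.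
  have : n <= a * (2 * i) by apply: leq_trans nl _; rewrite leq_mul2l li orbT.
  by rewrite mulnBr; lia.
have : k * (n ^ h.+1 * #|A|) <= (4 * a) ^ h.+1 * (C * n ^ h * (2 * (n * #|G|))).
  apply: (@leq_trans ((4 * a) ^ h.+1 * (C * n ^ h * (k * \sum_(E in G) #|isol E|)))).
    rewrite [C * n ^ h * (k * _)]mulnCA [(4 * a) ^ h.+1 * (k * _)]mulnCA leq_mul2l.
    apply/orP; right; apply: (@leq_trans ((4 * a) ^ h.+1 * \sum_(E in A) #|indep_leaves E| ^_ h.+1)).
      rewrite mulnC -sum_nat_const big_distrr /=; exact: leq_sum low.
    by rewrite leq_mul2l cnt orbT.
  by rewrite !leq_mul2l Siso !orbT.
have -> : k * (n ^ h.+1 * #|A|) = (2 * n ^ h.+1 * (C * (4 * a) ^ h.+1)) * (K * #|A|).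
  by rewrite /k; lia.
have -> : (4 * a) ^ h.+1 * (C * n ^ h * (2 * (n * #|G|))) = (2 * n ^ h.+1 * (C * (4 * a) ^ h.+1)) * #|G|.
  by rewrite [n ^ h.+1]expnS; lia.
by rewrite leq_pmul2l // muln_gt0 p0 muln_gt0 /= expn_gt0 n_gt0.
Qed.
End ManyLeaves.

Lemma bin_ge N h : N - h <= 'C(N, h.+1).
Proof.
elim: N => [|N IH] //; rewrite binS.
have [hN|Nh] := leqP h N; last by rewrite (_ : N.+1 - h = 0) //; apply/eqP; rewrite subn_eq0.
by rewrite subSn // -addn1 leq_add // bin_gt0.
Qed.

(** * Graphs with linearly many short cycles as components *)

Definition component (V : finType) (E : {set {set V}}) (x : V) : {set V} :=
  [set y | connect (adj E) x y].

(** Connected and 2-regular: these are the vertex sets of the components that are cycles of length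
    q. *)
Definition islands (V : finType) (E : {set {set V}}) (q : nat) : {set {set V}} :=
  [set U : {set V} | [&& [exists x, U == component E x], #|U| == q &
                        [forall y in U, #|nbrs E y| == 2]]].

Section Components.
Variables (V : finType) (E : {set {set V}}).

Lemma component_eq x y : y \in component E x -> component E y = component E x.
Proof.
rewrite in_set => xy; apply/setP => z; rewrite !in_set; apply/esym.
exact: same_connect (sym_connect_sym (@adj_sym _ E)) _ _ xy z.
Qed.

Lemma island_component q U y : U \in islands E q -> y \in U -> U = component E y.
Proof. by rewrite in_set => /and3P[/existsP[x /eqP ->] _ _] /component_eq ->. Qed.

Lemma islands_triv q (X : {set {set V}}) : X \subset islands E q -> finset.trivIset X.
Proof.
move=> /subsetP XI; apply/finset.trivIsetP => A B /XI AI /XI BI AB.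
rewrite -setI_eq0; apply: contraNT AB => /set0Pn[z]; rewrite in_setI => /andP[zA zB].
by rewrite (island_component AI zA) (island_component BI zB).
Qed.

Lemma islands_closed q (X : {set {set V}}) x y : X \subset islands E q -> adj E x y ->
  (x \in finset.cover X) = (y \in finset.cover X).
Proof.
move=> /subsetP XI xy.
have imp a b : adj E a b -> a \in finset.cover X -> b \in finset.cover X.
  move=> ab /bigcupP[U UX aU]; apply/bigcupP; exists U => //.
  by rewrite (island_component (XI U UX) aU) in_set connect1.
by apply/idP/idP; apply: imp; rewrite // adj_sym.
Qed.

Lemma card_cover_islands q (X : {set {set V}}) : X \subset islands E q ->
  #|finset.cover X| = #|X| * q.
Proof.
move=> XI; have := islands_triv XI; rewrite /finset.trivIset => /eqP <-.
rewrite -sum_nat_const; apply: eq_bigr => U /(subsetP XI).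
by rewrite in_set => /and3P[_ /eqP].
Qed.

(** Cycles have as many edges as vertices, and so does H; hence h cycles of length q can be
    exchanged for q copies of H without changing n or m. *)
Lemma island_edges q (X : {set {set V}}) : simple_graph E -> X \subset islands E q ->
  #|E :&: powerset (finset.cover X)| = #|finset.cover X|.
Proof.
move=> sE XI; set U := finset.cover X.
have : \sum_(x in U) #|inc E x| = #|U| * 2.
  rewrite -sum_nat_const; apply: eq_bigr => x /bigcupP[W /(subsetP XI)].
  by rewrite in_set => /and3P[_ _ /forall_inP deg] xW; rewrite card_inc //; apply/eqP/deg.
rewrite sum_card_inc (bigID (fun e => e \in powerset U)) /= [X in _ + X]big1 ?addn0.
  rewrite (eq_bigl (fun e => e \in E :&: powerset U)) => [|e]; last by rewrite in_setI.
  rewrite (eq_bigr (fun _ => 2)) => [|e]; last first.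
    rewrite in_setI powersetE => /andP[eE /setIidPl ->].
    by apply/eqP; move/forall_inP: sE => /(_ e eE).
  by rewrite sum_nat_const => /eqP; rewrite eqn_pmul2r // => /eqP.
move=> e /andP[eE]; rewrite powersetE => neU.
have [x [y [xy ee]]] := simple_edge sE eE.
have xyE : adj E x y by rewrite /adj -ee.
have := islands_closed XI xyE; rewrite -/U.
move: neU; rewrite ee subUset !sub1set => + eqU; rewrite -eqU andbb => xU.
apply/eqP; rewrite cards_eq0 -subset0; apply/subsetP => z.
rewrite in_setI in_set2 => /andP[/orP[]/eqP ->]; first by rewrite (negPf xU).
by rewrite -eqU (negPf xU).
Qed.
End Components.

Section Islands.
Variables (P : forall n, {set {set 'I_n}} -> bool) (V : finType) (H : {set {set V}}) (r : V).
Hypotheses (pl : planar_like P) (sH : simple_graph H) (uH : unicyclic H) (hH : hangs P H r).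

Let cH : connected_graph H. Proof. by case/andP: uH. Qed.
Let eH : #|H| = #|V|. Proof. by case/andP: uH => _ /eqP. Qed.
Let h := #|V|.

Lemma attach_many n (J : eqType) (E : {set {set 'I_n}}) (f : J -> V -> 'I_n) (s : seq J) :
  simple_graph E -> P E -> (forall i j u v, f i u = f j v -> i = j /\ u = v) ->
  (forall j v, nbrs E (f j v) = set0) -> uniq s ->
  let E' := E :|: \bigcup_(j <- s) imgraph (f j) H in
  [/\ simple_graph E', P E', #|E'| = #|E| + size s * h &
     forall x, (forall j v, j \in s -> f j v != x) -> nbrs E' x = nbrs E x].
Proof.
move=> sE PE fI iso; elim: s => [_|j s IH] /=.
  by rewrite big_nil setU0; split=> //; rewrite addn0.
case/andP=> js us; have {IH} [sE' PE' cE' nE'] := IH us.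
rewrite big_cons setUA [E :|: _]setUC -setUA setUC.
set E' := E :|: _ in sE' PE' cE' nE' *.
have fjI : injective (f j) by move=> u v /fI[].
have iso' v : nbrs E' (f j v) = set0.
  rewrite nE' // => i u is_; apply/eqP => /fI[ij _]; by rewrite -ij is_ in js.
have isor v : v != r -> nbrs E' (f j v) = set0 by move=> _; apply: iso'.
split.
- by apply: simpleU => //; apply: simple_imgraph.
- by apply: hH => //; rewrite iso' cards0.
- by rewrite (card_attach sH sE' isor fjI) cE' eH -addnA [_ * h + _]addnC -mulSn.
- move=> x nx; rewrite (nbrs_attach _ sH); last by move=> v; apply: nx; rewrite mem_head.
  by apply: nE' => i v is_; apply: nx; rewrite inE is_ orbT.
Qed.

Definition copy_vertices n (E : {set {set 'I_n}}) : {set 'I_n} :=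
  \bigcup_(f in [set f in homs H E | injectiveb f]) f @: V.

(** The vertices of the q copies are chosen as a function of U alone, so the code need not describe
    them. *)
Definition spread n q (U : {set 'I_n}) : option {ffun V * 'I_q -> 'I_n} :=
  [pick g : {ffun V * 'I_q -> 'I_n} | injectiveb g && (g @: [set: V * 'I_q] == U)].

Lemma spreadP n q (U : {set 'I_n}) : #|U| = h * q ->
  exists g, [/\ spread q U = Some g, injective g & g @: [set: V * 'I_q] = U].
Proof.
move=> cU; rewrite /spread; case: pickP => [g /andP[/injectiveP gI /eqP gU]|no].
  by exists g.
have e : #|(V * 'I_q : finType)%type| = #|U| by rewrite card_prod card_ord cU.
pose g := [ffun p : V * 'I_q => enum_val (cast_ord e (enum_rank p))].
have gI : injective g.
  by move=> p p'; rewrite !ffunE => /enum_val_inj/cast_ord_inj/enum_rank_inj.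
exfalso; have := no g; move/negbT/negP; apply; apply/andP; split; first exact/injectiveP.
rewrite eqEcard card_imset // cardsT e leqnn andbT.
by apply/subsetP => _ /imsetP[p _ ->]; rewrite ffunE enum_valP.
Qed.

(** A connected copy with a vertex outside the closed set U lies entirely outside U, hence in F. *)
Lemma copy_vertices_closed n (E F : {set {set 'I_n}}) (U : {set 'I_n}) :
  ~~ has_copy H F -> (forall x y, adj E x y -> (x \in U) = (y \in U)) ->
  (forall x y, adj E x y -> x \notin U -> adj F x y) ->
  copy_vertices E \subset U.
Proof.
move=> noH cl out; apply/subsetP => _ /bigcupP[f + /imsetP[v _ ->]].
case/setIdP=> fH /injectiveP fI; apply: contraR noH => fv; apply/has_copyP.
exists f => //; rewrite in_set; apply/forallP => x; apply/forallP => y; apply/implyP => xy.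
apply: out; first exact: homsP fH xy.
case/andP: cH => _ /forallP /(_ v)/forallP /(_ x)/connectP[s ps lst].
elim: s v ps lst fv => [|a s IH] v /=; first by move=> _ ->.
move=> /andP[va ps] lst fv; apply: (IH a) => //.
by rewrite -(cl _ _ (homsP fH va)).
Qed.

(** The union U of the chosen cycles is read off from the result, being the set of all vertices on
    copies of H. Only the former edges inside U must be stored, a bounded amount, whereas the number
    of choices of h cycles grows with n. *)
Lemma many_islands q b K : 0 < q -> exists n0, forall n m, n0 <= n ->
  K * #|[set E in class_graphs P n m | ~~ has_copy H E & n <= b * #|islands E q|]|
    <= #|class_graphs P n m|.
Proof.
move=> q0; have h0 : 0 < h by case/andP: cH.
pose C := 2 ^ (2 ^ (h * q)).
have C0 : 0 < C by rewrite expn_gt0.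
exists (b * (K * C + h)).+1 => n m n0.
set A := [set E in _ | _]; set G := class_graphs P n m.
pose tags (E : {set {set 'I_n}}) := [set X : {set {set 'I_n}} | X \subset islands E q & #|X| == h].
pose out (E X : {set {set 'I_n}}) := E :\: powerset (finset.cover X).
pose gad (g : {ffun V * 'I_q -> 'I_n}) := \bigcup_(j <- enum 'I_q) imgraph (fun v => g (v, j)) H.
pose phi (E X : {set {set 'I_n}}) :=
  if spread q (finset.cover X) is Some g then out E X :|: gad g else E.
pose psi (E X : {set {set 'I_n}}) := E :&: powerset (finset.cover X).
(* The size test makes the bound hold for every graph of the class; results of the switching pass
   it. *)
pose codes (E : {set {set 'I_n}}) :=
  if #|copy_vertices E| <= h * q then powerset (powerset (copy_vertices E)) else set0.
have key E X : E \in A -> X \in tags E -> let U := finset.cover X in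
  [/\ E \in G, ~~ has_copy H E, X \subset islands E q & #|U| = h * q] /\
  [/\ phi E X \in G, copy_vertices (phi E X) = U & phi E X :\: powerset U = E :\: powerset U].
  case/setIdP => EG /andP[noH _]; rewrite in_set => /andP[XI /eqP cX] U.
  have [sE cE PE] := class_graphsP EG.
  have cU : #|U| = h * q by rewrite (card_cover_islands XI) cX.
  split; first by [].
  have [g [sp gI gU]] := spreadP cU.
  have -> : phi E X = out E X :|: gad g by rewrite /phi sp.
  have sO : simple_graph (out E X) by apply: simple_sub sE; apply: subsetDl.
  have PO : P (out E X) by apply: (pl_sub pl) PE; apply: subsetDl.
  have gU' p : g p \in U by rewrite -gU imset_f.
  have outU x y : adj (out E X) x y -> (x \notin U) && (y \notin U).
    rewrite {1}/adj in_setD powersetE => /andP[nU xy].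
    have := islands_closed XI (xy : adj E x y); rewrite -/U => eqU; move: nU.
    by rewrite subUset !sub1set -eqU !andbb.
  have gadU e : e \in gad g -> e \subset U.
    rewrite /gad; elim: (enum 'I_q) => [|j s IH]; first by rewrite big_nil in_set0.
    rewrite big_cons in_setU => /orP[/(imgraphP sH)[x [y [_ ->]]]|/IH //].
    by rewrite /= subUset !sub1set !gU'.
  pose f (j : 'I_q) (v : V) := g (v, j).
  have fI i j u v : f i u = f j v -> i = j /\ u = v by move=> /gI[-> ->].
  have iso j v : nbrs (out E X) (f j v) = set0.
    apply/setP => y; rewrite in_set in_set0; apply/negP => /outU/andP[].
    by rewrite gU'.
  have [sE' PE' cE' _] := attach_many sO PO fI iso (enum_uniq 'I_q).
  rewrite -/(gad g) in sE' PE' cE'.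
  split.
  - rewrite in_set sE' PE' andbT /=; apply/eqP; rewrite cE' size_enum_ord.
    by rewrite -cE -(cardsID (powerset U) E) (island_edges sE XI) -/U cU addnC [q * _]mulnC.
  - apply/eqP; rewrite eqEsubset; apply/andP; split.
      apply: (@copy_vertices_closed _ _ E) => // x y.
        rewrite /adj in_setU => /orP[/outU/andP[/negPf -> /negPf ->]//|/gadU].
        by rewrite subUset !sub1set => /andP[-> ->].
      rewrite /adj in_setU => /orP[|/gadU]; first by rewrite in_setD => /andP[].
      by rewrite subUset !sub1set => /andP[->].
    rewrite -gU; apply/subsetP => _ /imsetP[[v j] _ ->].
    apply/bigcupP; exists [ffun v => g (v, j)]; last by apply/imsetP; exists v; rewrite ?ffunE.
    apply/setIdP; split; last by apply/injectiveP => u w; rewrite !ffunE => /gI[].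
    rewrite in_set; apply/forallP => x; apply/forallP => y; apply/implyP => xy.
    rewrite !ffunE /adj in_setU; apply/orP; right; rewrite /gad.
    have : j \in enum 'I_q by rewrite mem_enum.
    elim: (enum 'I_q) => [|i s IH] //; rewrite inE big_cons in_setU.
    case: eqP => [<- _|_ /IH ->]; last by rewrite orbT.
    by rewrite (mem_imgraph (fun v => g (v, j)) xy).
  - apply/setP => e; rewrite !in_setD in_setU !powersetE.
    case eU : (e \subset U) => //=; rewrite /out in_setD powersetE -/U eU /=.
    by case: (e \in E) => //=; apply: contraFF eU => /gadU.
have tagK E : E \in A -> K * C <= #|tags E|.
  case/setIdP => EG /andP[_ nN]; rewrite cards_draws -/h.
  have bN : b * (K * C + h) < b * #|islands E q| by apply: leq_trans n0 nN.
  have {bN} : K * C + h < #|islands E q| by move: bN; rewrite ltn_mul2l => /andP[].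
  move: #|islands E q| => N hN.
  by case: h h0 hN => // h' _ hN; apply: leq_trans (bin_ge N h'); lia.
have codeK E : E \in G -> #|codes E| <= C.
  move=> _; rewrite /codes; case: ifP => le; last by rewrite cards0.
  by rewrite !card_powerset leq_exp2l // leq_exp2l.
have := @count_leq _ _ _ _ A G tags codes phi psi (K * C) C _ _ tagK codeK.
rewrite mulnA leq_pmul2r // mulnC; apply.
- move=> E X EA XT; have [[EG noH XI cU] [pG cv _]] := key E X EA XT.
  split=> //; rewrite /codes cv cU leqnn powersetE; exact: subsetIr.
- move=> E X E' X' EA XT EA' XT' ephi epsi.
  have [[EG noH XI cU] [_ cv oE]] := key E X EA XT.
  have [[EG' noH' XI' cU'] [_ cv' oE']] := key E' X' EA' XT'.
  have UU : finset.cover X = finset.cover X' by rewrite -cv -cv' ephi.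
  have EE : E = E'.
    rewrite -(setID E (powerset (finset.cover X))) -(setID E' (powerset (finset.cover X'))).
    by rewrite -oE -oE' -/(psi _ _) epsi UU ephi.
  split=> //; subst E'.
  (* The chosen cycles are recovered from U as the cycle components that it contains. *)
  have recX (Y : {set {set 'I_n}}) : Y \subset islands E q ->
     Y = [set W in islands E q | W \subset finset.cover Y].
    move=> YI; apply/setP => W; rewrite in_set; apply/idP/andP => [WY|[WI WU]].
      split; first exact: (subsetP YI).
      by apply/subsetP => z zW; apply/bigcupP; exists W.
    have /set0Pn[x xW] : W != set0.
      by rewrite -card_gt0; move: WI; rewrite in_set => /and3P[_ /eqP -> _].
    have /bigcupP[W' W'Y xW'] := subsetP WU x xW.
    by rewrite (island_component WI xW) -(island_component (subsetP YI _ W'Y) xW').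
  by rewrite (recX X XI) (recX X' XI') UU.
Qed.
End Islands.

(** * Paths through vertices of degree 2 *)

Section DegreeTwo.
Variables (V : finType) (E : {set {set V}}).
Hypothesis sE : simple_graph E.

Definition deg2_path (x : V) (s : seq V) : bool :=
  [&& path (adj E) x s, uniq (x :: s) & all (fun z => #|nbrs E z| == 2) (x :: s)].

(** The ball of radius j around the vertices of degree other than 2; from outside it, j steps meet
    only degree 2. *)
Fixpoint near (j : nat) : {set V} :=
  if j is i.+1 then near i :|: \bigcup_(z in near i) nbrs E z
  else [set x | #|nbrs E x| != 2].

Lemma near_sub i j : i <= j -> near i \subset near j.
Proof.
move=> /subnK <-; elim: (j - i) => [|k IH] //.
by rewrite addSn /=; apply: subset_trans IH (subsetUl _ _).
Qed.

Lemma notin_near j x y : x \notin near j.+1 -> adj E x y -> y \notin near j.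
Proof.
rewrite /= in_setU negb_or => /andP[_ nb] xy; apply: contra nb => yn.
by apply/bigcupP; exists y => //; rewrite in_set adj_sym.
Qed.

Lemma deg2_notin_near j x : x \notin near j -> #|nbrs E x| = 2.
Proof.
move=> xn; apply/eqP; apply: contraR xn => d2; apply: (subsetP (near_sub (leq0n j))).
by rewrite in_set.
Qed.

Lemma nbrs_deg2 x y z : #|nbrs E x| = 2 -> adj E x y -> adj E x z -> y != z ->
  nbrs E x = [set y; z].
Proof.
move=> d2 xy xz yz; apply/esym/eqP; rewrite eqEcard cards2 yz d2 andbT.
by rewrite subUset !sub1set !in_set xy xz.
Qed.

(* A path through vertices of degree 2 can only close up at its starting point. *)
Lemma deg2_path_closed x s : deg2_path x s ->
  nbrs E (last x s) \subset [set z in x :: s] -> component E x \in islands E (size s).+1.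
Proof.
case/and3P=> ps us /allP d2; set S := [set z in x :: s] => lS.
have deg z : z \in S -> #|nbrs E z| = 2 by rewrite in_set => /d2/eqP.
pose t i := nth x (x :: s) i.
have tS i : i <= size s -> t i \in S by move=> le; rewrite in_set mem_nth.
have tI i j : i <= size s -> j <= size s -> (t i == t j) = (i == j).
  by move=> le le'; rewrite /t nth_uniq.
have St z : z \in S -> exists2 i, i <= size s & z = t i.
  rewrite in_set => zt; exists (index z (x :: s)); first by have := zt; rewrite -index_mem ltnS.
  by rewrite /t nth_index.
have adjt i : i < size s -> adj E (t i) (t i.+1).
  by move=> lt; have /(pathP x) := ps; apply.
have mid i : i.+1 < size s -> nbrs E (t i.+1) = [set t i; t i.+2].
  move=> lt; apply: nbrs_deg2.
  - by apply: deg; apply: tS; apply: ltnW.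
  - by rewrite adj_sym; apply: adjt; apply: ltnW.
  - exact: adjt.
  - rewrite tI //; [by rewrite neq_ltn leqnSn|by apply: ltnW; apply: ltnW].
have tl : last x s = t (size s) := esym (nth_last x (x :: s)).
rewrite tl in lS.
have l2 : #|nbrs E (t (size s))| = 2 by apply: deg; apply: tS.
have [y yl yn] : exists2 y, y \in nbrs E (t (size s)) & y != t (size s).-1.
  have : 0 < #|nbrs E (t (size s)) :\ t (size s).-1|.
    by have := cardsD1 (t (size s).-1) (nbrs E (t (size s))); rewrite l2; case: (_ \in _); case: #|_ :\ _|.
  by case/card_gt0P => y; rewrite in_setD1 => /andP[yn yl]; exists y.
have [i ile ey] := St y (subsetP lS y yl); subst y.
have inat : i != size s.
  apply: contraTneq yl => ->; rewrite in_set; apply/negP => /(adj_neq sE); by rewrite eqxx.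
have ilt : i < size s by rewrite ltn_neqAle inat.
have i_pred : i != (size s).-1 by rewrite -(@tI i (size s).-1) // leq_pred.
have adjl : adj E (t i) (t (size s)) by rewrite adj_sym; move: yl; rewrite in_set.
have i0 : i = 0.
  case: i ilt yl yn ile inat i_pred adjl => // i ilt _ _ ile inat i_pred adjl.
  have : t (size s) \in nbrs E (t i.+1) by rewrite in_set.
  rewrite mid // in_set2 !tI //; last by apply: ltnW.
  by move=> /orP[/eqP|/eqP]; lia.
subst i.
have s1 : 1 < size s by move: i_pred ilt; case: (size s) => // -[].
have first_ : nbrs E (t 0) = [set t 1; t (size s)].
  apply: nbrs_deg2 => //; first by apply: deg; apply: tS.
  - exact: adjt.
  - by rewrite tI // ?neq_ltn ?s1 // ltnW.
have last_ : nbrs E (t (size s)) \subset S := lS.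
have closed z w : z \in S -> adj E z w -> w \in S.
  move=> /St[j jle ->] zw; have wn : w \in nbrs E (t j) by rewrite in_set.
  have [ej|nj] := eqVneq j (size s); first by apply: (subsetP last_); rewrite -ej.
  have jlt : j < size s by rewrite ltn_neqAle nj.
  case: j jle jlt wn {zw nj} => [|j] jle jlt wn.
    by move: wn; rewrite first_ in_set2 => /orP[]/eqP ->; apply: tS => //; apply: ltnW.
  move: wn; rewrite mid // in_set2 => /orP[]/eqP ->; apply: tS => //.
  by apply: ltnW; apply: ltnW.
have xS : x \in S by rewrite in_set mem_head.
have stay p b : b \in S -> path (adj E) b p -> last b p \in S.
  by elim: p b => [|a p IH] b bS //= /andP[ba]; apply: IH; apply: closed ba.
have compS : component E x = S.
  apply/eqP; rewrite eqEsubset; apply/andP; split; apply/subsetP => z.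
    by rewrite in_set => /connectP[p pp ->]; apply: stay.
  case/St => j jle ->; rewrite in_set; elim: j jle => [|j IH] jle; first exact: connect0.
  by apply: connect_trans (IH (ltnW jle)) _; apply/connect1/adjt.
rewrite in_set; apply/and3P; split.
- by apply/existsP; exists x.
- by rewrite compS cardsE (card_uniqP us).
- by apply/forall_inP => z; rewrite compS => /deg ->.
Qed.

(** The path is prolonged vertex by vertex, each step giving up one unit of distance from the
    exceptional vertices. When no new neighbour is left, the path has closed up into a cycle. *)
Lemma deg2_path_or_island J j x : j <= J -> x \notin near J ->
  (exists s, [/\ size s = j, deg2_path x s & forall z, z \in x :: s -> z \notin near (J - j)]) \/
  (exists2 q, 0 < q <= j & component E x \in islands E q).
Proof.
move=> + xJ; elim: j => [_|j IH jJ].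
  left; exists [::]; split=> //; last by move=> z; rewrite inE subn0 => /eqP ->.
  by rewrite /deg2_path /= (deg2_notin_near xJ).
case: (IH (ltnW jJ)) => [[s [sj ds sn]]|[q /andP[q0 qj] isl]]; last first.
  by right; exists q => //; rewrite q0 leqW.
have [closed|] := boolP (nbrs E (last x s) \subset [set z in x :: s]).
  by right; exists j.+1; rewrite ?leqnn // -sj; apply: deg2_path_closed.
case/subsetPn => y yl; rewrite in_set => ys; left.
have ly : adj E (last x s) y by move: yl; rewrite in_set.
have Jj : J - j = (J - j.+1).+1 by lia.
have ln := sn (last x s) (mem_last x s); rewrite Jj in ln.
have yn : y \notin near (J - j.+1) := notin_near ln ly.
exists (rcons s y); split.
- by rewrite size_rcons sj.
- case/and3P: ds => ps us ds; rewrite /deg2_path rcons_path ps ly -rcons_cons rcons_uniq ys us.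
  by rewrite all_rcons ds (deg2_notin_near yn) eqxx.
- move=> z; rewrite -rcons_cons mem_rcons inE => /orP[/eqP -> //|/sn].
  by rewrite Jj; apply: contra; apply: (subsetP (near_sub (leqnSn _))).
Qed.

(** Vertices of [near 0] have d neighbours in all and the others two each, so a layer takes N to at
    most 3 N + d. *)
Lemma card_near j : #|near j| <= 4 ^ j * (#|near 0| + \sum_(x in near 0) #|nbrs E x|).
Proof.
set d := \sum_(x in near 0) #|nbrs E x|; elim: j => [|j IH]; first by rewrite mul1n leq_addr.
rewrite [near j.+1]/=; apply: leq_trans (leq_card_setU _ _) _.
have : #|\bigcup_(z in near j) nbrs E z| <= d + 2 * #|near j|.
  apply: (@leq_trans (\sum_(z in near j) #|nbrs E z|)).
    elim/big_ind2: _ => [|A a B b Aa Bb|e _] //; first by rewrite cards0.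
    by apply: leq_trans (leq_card_setU _ _) _; apply: leq_add.
  rewrite (bigID (fun z => z \in near 0)) /=; apply: leq_add.
    by rewrite /d [leqRHS](bigID (fun z => z \in near j)) /=; apply: leq_trans (leq_addr _ _);
       apply: eq_leq; apply: eq_bigl => z; rewrite andbC.
  rewrite (eq_bigr (fun _ => 2)); last by move=> z /andP[_ zn]; apply: (@deg2_notin_near 0).
  rewrite sum_nat_const mulnC leq_mul2l; apply/orP; right.
  by apply/subset_leq_card/subsetP => z /andP[].
move=> le; apply: leq_trans (leq_add IH le) _; rewrite expnS.
move: #|near j| #|near 0| (4 ^ j) IH (expn_gt0 4 j) => N b p IH p0.
have : d <= p * (b + d) by apply: leq_trans (leq_addl b d) _; rewrite leq_pmull // p0.
by lia.
Qed.
End DegreeTwo.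

Section PathEdges.
Variables (V : finType) (E : {set {set V}}) (x : V) (s : seq V).
Hypotheses (sE : simple_graph E) (ds : deg2_path E x s).

Definition path_edges : {set {set V}} :=
  [set [set nth x (x :: s) i; nth x (x :: s) i.+1] | i : 'I_(size s)].

Let t i := nth x (x :: s) i.

Let ps : path (adj E) x s. Proof. by case/and3P: ds. Qed.

Lemma path_nth_eq i j : i <= size s -> j <= size s -> (t i == t j) = (i == j).
Proof. by move=> le le'; case/and3P: ds => _ us _; rewrite /t nth_uniq. Qed.

Lemma path_nth_deg i : i <= size s -> #|nbrs E (t i)| = 2.
Proof. by move=> le; case/and3P: ds => _ _ /allP d; apply/eqP/d/mem_nth. Qed.

Lemma path_nth_adj i : i < size s -> adj E (t i) (t i.+1).
Proof. by move=> lt; have /(pathP x) := ps; apply. Qed.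

Lemma path_edges_sub : path_edges \subset E.
Proof. by apply/subsetP => _ /imsetP[i _ ->]; apply: path_nth_adj. Qed.

Lemma card_path_edges : #|path_edges| = size s.
Proof.
rewrite card_imset ?card_ord // => i j /set2_eq[] [/eqP + /eqP];
  rewrite -!/(t _) !path_nth_eq ?ltn_ord ?(ltnW (ltn_ord _)) // => /eqP e1 /eqP e2.
  exact: val_inj.
lia.
Qed.

Lemma mem_path_edges i : i < size s -> [set t i; t i.+1] \in path_edges.
Proof. by move=> lt; apply/imsetP; exists (Ordinal lt). Qed.

Lemma path_edges_mid i : 0 < i < size s -> nbrs (E :\: path_edges) (t i) = set0.
Proof.
case: i => // i /andP[_ lt]; apply/setP => y; rewrite in_set in_set0 /adj in_setD.
apply/negP => /andP[np iy].
have : y \in nbrs E (t i.+1) by rewrite in_set.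
rewrite (@nbrs_deg2 _ E (t i.+1) (t i) (t i.+2)).
- rewrite in_set2 => /orP[]/eqP ey; move: np; rewrite ey; last by rewrite mem_path_edges.
  by rewrite setUC mem_path_edges // ltnW.
- by apply: path_nth_deg; apply: ltnW.
- by rewrite adj_sym; apply: path_nth_adj; apply: ltnW.
- exact: path_nth_adj.
- by rewrite path_nth_eq ?neq_ltn ?leqnSn //; apply: ltnW; apply: ltnW.
Qed.

Lemma path_edges_first : 0 < size s -> #|nbrs (E :\: path_edges) x| <= 1.
Proof.
move=> s0; rewrite -ltnS -(path_nth_deg (leq0n _)) -[x]/(t 0); apply: proper_card.
apply/properP; split; first exact/nbrs_sub/subsetDl.
exists (t 1); first by rewrite in_set; apply: path_nth_adj.
by rewrite in_set /adj in_setD mem_path_edges.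
Qed.

Lemma path_edges_last : 0 < size s -> last x s \in leaves (E :\: path_edges).
Proof.
move=> s0; have -> : last x s = t (size s) := esym (nth_last x (x :: s)).
have e : t (size s).-1.+1 = t (size s) by rewrite prednK.
have la : adj E (t (size s)) (t (size s).-1).
  by rewrite -e adj_sym path_nth_adj // prednK.
rewrite in_set; have -> : nbrs (E :\: path_edges) (t (size s)) = nbrs E (t (size s)) :\ t (size s).-1.
  apply/setP => y; rewrite in_setD1 !in_set /adj in_setD andbC [RHS]andbC.
  case ly : ([set t (size s); y] \in E) => //=; congr (~~ _); apply/idP/eqP => [|->].
    case/imsetP => -[i il] _ /set2_eq[] [/eqP + ->] /=; rewrite -/(t _) path_nth_eq ?(ltnW il) //.
      by move=> /eqP /= ei; have := il; clear - ei; lia.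
    by move=> /eqP ->.
  by rewrite -{1}e setUC mem_path_edges // prednK.
have := cardsD1 (t (size s).-1) (nbrs E (t (size s))); rewrite path_nth_deg // in_set la.
by move=> /eqP; rewrite add1n eqSS eq_sym.
Qed.

Lemma path_edges_other y : y \notin x :: s -> nbrs (E :\: path_edges) y = nbrs E y.
Proof.
move=> yn; apply/setP => z; rewrite !in_set /adj in_setD.
case: (boolP (_ \in path_edges)) => //= /imsetP[i _ /set2_eq[[ey _]|[ey _]]];
  by case/negP: yn; rewrite ey mem_nth //= ltnS ?(ltnW (ltn_ord i)).
Qed.
End PathEdges.

(** Here T is 4^h, i and l count isolated vertices and leaves, b the vertices of degree other than
    2, d their degree sum. The handshake equation and the fourth inequality give b + d <= 8 (m - n)
    + 9 i + 6 l, at most 23 n / (128 T), and 4 * 23 <= 128. *)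
Lemma few_near_arith T i l m n b d N : 128 * T * i <= n -> 128 * T * l <= n ->
  128 * T * m <= 128 * T * n + n -> d + 2 * n = 2 * m + 2 * b ->
  3 * b <= d + 3 * i + 2 * l -> N <= T * (b + d) -> 4 * N <= n.
Proof.
move=> is_ lf mn hs b3 NT.
have u : b + d + 8 * n <= 8 * m + 9 * i + 6 * l by lia.
have v : T * b + T * d + 8 * (T * n) <= 8 * (T * m) + 9 * (T * i) + 6 * (T * l).
  by have := leq_mul (leqnn T) u; lia.
rewrite mulnDr in NT; rewrite -!mulnA in is_ lf mn.
move: (T * b) (T * d) (T * n) (T * m) (T * i) (T * l) is_ lf mn NT v => *; lia.
Qed.

Section FewLeaves.
Variables (P : forall n, {set {set 'I_n}} -> bool) (V : finType) (H : {set {set V}}) (r : V).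
Hypotheses (pl : planar_like P) (sH : simple_graph H) (uH : unicyclic H) (hH : hangs P H r).

Let cH : connected_graph H. Proof. by case/andP: uH. Qed.
Let eH : #|H| = #|V|. Proof. by case/andP: uH => _ /eqP. Qed.
Let h := #|V|.
Let h0 : 0 < h. Proof. by case/andP: cH. Qed.

Definition starts n (E : {set {set 'I_n}}) : {set 'I_n} :=
  [set x | [exists s : h.-tuple 'I_n, deg2_path E x s]].

Definition start_path n (E : {set {set 'I_n}}) (x : 'I_n) : seq 'I_n :=
  if [pick s : h.-tuple 'I_n | deg2_path E x s] is Some s then tval s else [::].

Lemma start_pathP n (E : {set {set 'I_n}}) x : x \in starts E ->
  deg2_path E x (start_path E x) /\ size (start_path E x) = h.
Proof.
rewrite in_set /start_path => /existsP[s ds]; case: pickP => [s' ds'|/(_ s)].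
  by rewrite size_tuple.
by rewrite ds.
Qed.

(** Starting with r puts the root of the copy on the first vertex of the path, which may still have
    an edge to the rest of the graph. *)
Let vs := r :: rem r (enum V).

Let vs_perm : perm_eq (enum V) vs. Proof. by apply: perm_to_rem; rewrite mem_enum. Qed.
Let vs_size : size vs = h. Proof. by rewrite -(perm_size vs_perm) -cardE. Qed.
Let vs_uniq : uniq vs. Proof. by rewrite -(perm_uniq vs_perm) enum_uniq. Qed.
Let vs_mem v : v \in vs. Proof. by rewrite -(perm_mem vs_perm) mem_enum. Qed.

Definition lay n (x : 'I_n) (s : seq 'I_n) : {ffun V -> 'I_n} :=
  [ffun v => nth x (x :: s) (index v vs)].

Lemma index_vs v : index v vs < h. Proof. by rewrite -vs_size index_mem. Qed.

Lemma lay_belast n (x : 'I_n) s : size s = h -> map (lay x s) vs = belast x s.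
Proof.
move=> sh; apply: (@eq_from_nth _ x); first by rewrite size_map size_belast vs_size.
rewrite size_map vs_size => i ih; rewrite (nth_map r) ?vs_size // ffunE index_uniq ?vs_size //.
by rewrite lastI nth_rcons size_belast sh ih.
Qed.

(** A vertex far from exceptional degrees starts a suitable path or lies on a cycle of length at
    most h. The exceptional neighbourhoods and the short cycles each cover at most n / 4 vertices; 4
    h^2 allows for h lengths and h vertices per cycle. *)
Lemma starts_count n m (E : {set {set 'I_n}}) : E \in class_graphs P n m ->
  128 * 4 ^ h * #|isol E| <= n -> 128 * 4 ^ h * #|leaves E| <= n ->
  128 * 4 ^ h * m <= 128 * 4 ^ h * n + n ->
  (forall q, 0 < q <= h -> 4 * (h * h) * #|islands E q| <= n) ->
  n <= 4 * #|starts E|.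
Proof.
move=> EG is_ lf mn isl; have [sE cE _] := class_graphsP EG.
pose bad := near E 0; pose d := \sum_(x in bad) #|nbrs E x|.
have hs : d + 2 * n = 2 * m + 2 * #|bad|.
  have := handshake sE; rewrite cE (bigID (fun x => x \in bad)) /= -/d.
  rewrite [X in _ + X](eq_bigr (fun _ => 2)); last by move=> x xb; apply: (@deg2_notin_near _ _ 0).
  rewrite sum_nat_const => h1; have bn := cardC bad; rewrite card_ord in bn.
  move: h1; have -> : #|(fun x : 'I_n => x \notin bad)| = #|[predC bad]| by apply: eq_card.
  move: #|[predC bad]| #|bad| bn => c b; clear; lia.
(* A degree other than 2 is at least 3, except 0 and 1, which are short of it by 3 and 2. *)
have b3 : 3 * #|bad| <= d + 3 * #|isol E| + 2 * #|leaves E|.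
  have cnt (A : {set 'I_n}) : \sum_(x in bad) (x \in A) <= #|A|.
    rewrite -sum1_card [leqRHS]big_mkcond [leqLHS]big_mkcond /=; apply: leq_sum => x _.
    by case: (x \in bad); case: (x \in A).
  apply: (@leq_trans (d + 3 * \sum_(x in bad) (x \in isol E) + 2 * \sum_(x in bad) (x \in leaves E))).
    rewrite mulnC -sum_nat_const /d !big_distrr -!big_split /=; apply: leq_sum => x.
    rewrite !in_set -cards_eq0; by case: #|nbrs E x| => [|[|[|k]]].
  by rewrite !leq_add // leq_mul2l cnt.
have nearh : 4 * #|near E h| <= n.
  have := card_near sE h; rewrite -/bad -/d.
  move: #|near E h| #|bad| #|isol E| #|leaves E| (4 ^ h) is_ lf mn hs b3.
  move=> N b i l T is_ lf mn hs b3 NT.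
  exact: (few_near_arith is_ lf mn hs b3 NT).
have cov : n <= #|near E h| + (#|starts E| + \sum_(q < h) #|islands E q.+1| * h).
  rewrite -[X in X <= _](card_ord n) -cardsT.
  pose U := \bigcup_(q < h) finset.cover (islands E q.+1).
  apply: (@leq_trans #|near E h :|: (starts E :|: U)|).
    apply/subset_leq_card/subsetP => x _; rewrite in_setU.
    have [//|xn] := boolP (x \in near E h); rewrite /= in_setU.
    case: (deg2_path_or_island sE (leqnn h) xn) => [[s [sh ds _]]|[q /andP[q0 qh] isq]].
      apply/orP; left; rewrite in_set; apply/existsP.
      have st : size s == h by rewrite sh.
      by exists (Tuple st).
    apply/orP; right; apply/bigcupP; case: q q0 qh isq => // q _ qh isq.
    exists (Ordinal qh) => //; apply/bigcupP; exists (component E x) => //.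
    by rewrite in_set connect0.
  apply: leq_trans (leq_card_setU _ _) _; rewrite leq_add2l.
  apply: leq_trans (leq_card_setU _ _) _; rewrite leq_add2l /U.
  apply: (@leq_trans (\sum_(q < h) #|finset.cover (islands E q.+1)|)).
    elim/big_ind2: _ => [|A a B b Aa Bb|e _] //; first by rewrite cards0.
    by apply: leq_trans (leq_card_setU _ _) _; apply: leq_add.
  apply: leq_sum => q _; rewrite (card_cover_islands (subxx _)) leq_mul2l.
  by rewrite ltn_ord orbT.
have isls : 4 * (\sum_(q < h) #|islands E q.+1| * h) <= n.
  rewrite -(leq_pmul2l h0) mulnCA mulnA big_distrr /=.
  rewrite -[X in _ <= X * _](card_ord h) -sum_nat_const; apply: leq_sum => q _.
  by apply: leq_trans (isl q.+1 (ltn_ord q)); rewrite -!mulnA leq_mul2l /=; lia.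
by move: (\sum_(_ < h) _) #|starts E| #|near E h| nearh cov isls => a b c; lia.
Qed.

(** At least n / 4 tags stand against at most [max_placements V] * 2 n / a codes: a placement, and a
    leaf, namely the end of the path left without a copy vertex. *)
Lemma few_leaves a K : 8 * max_placements V * K <= a -> 0 < a -> exists n0, forall n m, n0 <= n ->
  K * #|[set E in class_graphs P n m | [&& ~~ has_copy H E, a * #|leaves E| <= n &
                                          n <= 4 * #|starts E|]]|
    <= #|class_graphs P n m|.
Proof.
move=> aK a0; exists (a * h.+1).+1 => n m n0.
have n_gt0 : 0 < n by lia.
set A := [set E in _ | _]; set G := class_graphs P n m.
pose sp (E : {set {set 'I_n}}) x := start_path E x.
pose del (E : {set {set 'I_n}}) x := path_edges x (sp E x).
pose f (E : {set {set 'I_n}}) x := lay x (sp E x).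
pose phi (E : {set {set 'I_n}}) x := (E :\: del E x) :|: imgraph (f E x) H.
pose psi (E : {set {set 'I_n}}) x := (f E x, last x (sp E x)).
(* The only possible new leaves are the h + 1 vertices of the path. *)
pose B := [set E in G | a * #|leaves E| <= n + a * h.+1].
pose codes (E : {set {set 'I_n}}) := setX (placements H E) (leaves E).
have key E x : E \in A -> x \in starts E ->
  [/\ deg2_path E x (sp E x), size (sp E x) = h, simple_graph E, #|E| = m & P E] /\
  [/\ ~~ has_copy H E, a * #|leaves E| <= n, injective (f E x),
     forall v, v != r -> nbrs (E :\: del E x) (f E x v) = set0 &
     [/\ #|nbrs (E :\: del E x) (f E x r)| <= 1, forall v, f E x v != last x (sp E x) &
       forall v, f E x v \in x :: sp E x]].
  case/setIdP => EG /and3P[noH al _] xs; have [sE cE PE] := class_graphsP EG.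
  have [ds sh] := start_pathP xs; split=> //.
  have le v : index v vs <= size (sp E x) by rewrite sh ltnW // index_vs.
  split=> //.
  - move=> u v /eqP; rewrite !ffunE (path_nth_eq ds) ?le // => /eqP eq.
    by rewrite -(nth_index r (vs_mem u)) eq nth_index ?vs_mem.
  - move=> v vr; rewrite ffunE; apply: path_edges_mid => //; rewrite sh index_vs andbT.
    by rewrite /= eq_sym (negPf vr).
  - split.
    + by rewrite ffunE /= eqxx /=; apply: path_edges_first => //; rewrite sh.
    + move=> v; have -> : last x (sp E x) = nth x (x :: sp E x) (size (sp E x)) := esym (nth_last x (x :: _)).
      by rewrite ffunE (path_nth_eq ds) // sh neq_ltn index_vs.
    + by move=> v; rewrite ffunE mem_nth //; apply: le.
have main : \sum_(E in A) #|starts E| <= \sum_(E in B) #|codes E|.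
  apply: (@double_count _ _ _ _ A B (@starts n) codes phi psi).
  - move=> E x EA xs; have [[ds sh sE cE PE] [noH al fI iso [lf fl fin]]] := key E x EA xs.
    have sE0 : simple_graph (E :\: del E x) by apply: simple_sub sE; apply: subsetDl.
    have lastl : last x (sp E x) \in leaves (E :\: del E x).
      by apply: path_edges_last => //; rewrite sh.
    have lastl' : last x (sp E x) \in leaves (phi E x).
      by move: lastl; rewrite !in_set (nbrs_attach _ sH).
    split; last first.
      rewrite in_setX lastl' andbT; apply: (attach_placement sH sE0 _ fI iso lf).
      by apply: contra noH; apply: has_copy_sub; apply: subsetDl.
    apply/setIdP; split.
      rewrite in_set; apply/and3P; split.
      + by apply: simpleU => //; apply: simple_imgraph.
      + have cd := card_path_edges sE ds; have ps := path_edges_sub ds.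
        rewrite /phi (card_attach sH sE0 iso fI) (cardsDS ps) cd sh cE eH subnK //.
        by rewrite -cE -/h -sh -cd subset_leq_card.
      + by apply: hH => //; apply: (pl_sub pl) PE; apply: subsetDl.
    have sub : leaves (phi E x) \subset leaves E :|: [set z in x :: sp E x].
      apply/subsetP => z zl; rewrite in_setU.
      have [zp|zp] := boolP (z \in x :: sp E x); first by rewrite [X in _ || X]in_set zp orbT.
      move: zl; rewrite !in_set (nbrs_attach _ sH) => [|v]; last first.
        by apply: contraNneq zp => <-.
      by rewrite (path_edges_other E zp) => ->.
    apply: (@leq_trans (a * (#|leaves E| + h.+1))); last by rewrite mulnDr leq_add2r.
    rewrite leq_mul2l; apply/orP; right; apply: leq_trans (subset_leq_card sub) _.
    apply: leq_trans (leq_card_setU _ _) _; rewrite leq_add2l cardsE.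
    by apply: leq_trans (card_size _) _; rewrite /= sh.
  - move=> E x E' x' EA xs EA' xs' ephi [ef el].
    have [[ds sh sE cE PE] [noH al fI iso [lf fl fin]]] := key E x EA xs.
    have [[ds' sh' sE' cE' PE'] [noH' al' fI' iso' [lf' fl' fin']]] := key E' x' EA' xs'.
    (* Listed in the order [vs], the copy is the path without its last vertex, and that vertex is in
       the code. *)
    have [ex es] : x = x' /\ sp E x = sp E' x'.
      have : x :: sp E x = x' :: sp E' x'.
        by rewrite lastI [RHS]lastI -!lay_belast // -/(f E x) -/(f E' x') ef el.
      by case.
    have ed : del E x = del E' x' by rewrite /del ex -[in sp E x']ex es.
    split=> //.
    have sE0 : simple_graph (E :\: del E x) by apply: simple_sub sE; apply: subsetDl.
    have sE0' : simple_graph (E' :\: del E' x') by apply: simple_sub sE'; apply: subsetDl.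
    have e0 : E :\: del E x = E' :\: del E' x'.
      by rewrite -(attachK sH sE0 iso) -(attachK sH sE0' iso') -/(phi _ _) ephi ef.
    have split_del (E1 : {set {set 'I_n}}) y : deg2_path E1 y (sp E1 y) ->
        E1 = del E1 y :|: E1 :\: del E1 y.
      by move=> d1; rewrite -{1}(setID E1 (del E1 y)) (setIidPr (path_edges_sub d1)).
    by rewrite (split_del E x ds) (split_del E' x' ds') e0 ed.
set C := max_placements V in aK.
have codeK E : E \in B -> a * #|codes E| <= C * (2 * n).
  case/setIdP => EG al; rewrite cardsX mulnCA; apply: leq_mul; first exact: card_placements.
  by apply: leq_trans al _; lia.
have : a * (n * #|A|) <= 4 * (#|G| * (C * (2 * n))).
  apply: (@leq_trans (a * (4 * \sum_(E in A) #|starts E|))).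
    rewrite leq_mul2l; apply/orP; right; rewrite mulnC -sum_nat_const big_distrr /=.
    by apply: leq_sum => E /setIdP[_ /and3P[]].
  rewrite mulnCA leq_mul2l /=.
  apply: (@leq_trans (a * \sum_(E in B) #|codes E|)); first by rewrite leq_mul2l main orbT.
  apply: (@leq_trans (#|B| * (C * (2 * n)))).
    by rewrite -sum_nat_const big_distrr /=; apply: leq_sum.
  by rewrite leq_mul2r; apply/orP; right; apply/subset_leq_card/subsetP => E /setIdP[].
rewrite [a * _]mulnCA [4 * _](_ : _ = n * (8 * C * #|G|)); last by lia.
rewrite leq_pmul2l // => le.
have : 8 * C * K * #|A| <= 8 * C * #|G|.
  by apply: leq_trans le; rewrite leq_mul2r aK orbT.
have C0 : 0 < 8 * C.
  by rewrite muln_gt0 /= /C /max_placements !muln_gt0 !expn_gt0 -/h h0.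
by rewrite -mulnA leq_pmul2l.
Qed.
End FewLeaves.

(** * Combination of the switchings *)

Lemma weaken_scale Q Q' a b c : Q' <= Q -> Q * a <= Q * b + c -> Q' * a <= Q' * b + c.
Proof.
move=> QQ; have [ab _|ba] := leqP a b; first by apply: leq_trans (leq_addr _ _); rewrite leq_mul2l ab orbT.
rewrite -!leq_subLR -!mulnBr; apply: leq_trans; by rewrite leq_mul2r QQ orbT.
Qed.

Lemma copy_free_rare (P : forall n, {set {set 'I_n}} -> bool) (V : finType)
    (H : {set {set V}}) (r : V) K :
  planar_like P -> simple_graph H -> unicyclic H -> hangs P H r -> 0 < K ->
  exists Q n0, forall n m, n0 <= n -> Q * n <= Q * m + n -> Q * m <= Q * n + n ->
  K * #|[set E in class_graphs P n m | ~~ has_copy H E]| <= #|class_graphs P n m|.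
Proof.
move=> pl sH uH hH K0; set h := #|V|.
have h0 : 0 < h by case/andP: uH => /andP[].
(* There are h + 3 exceptional classes: isolated vertices, leaves, paths, and one for each cycle
   length up to h. *)
pose K' := (h + 3) * K; have K'0 : 0 < K' by rewrite muln_gt0 addn_gt0 orbT.
pose k := 128 * 4 ^ h; have k0 : 0 < k by rewrite muln_gt0 expn_gt0.
(* The summand k yields the leaf bound of [starts_count], the other one meets the hypothesis of
   [few_leaves]. *)
pose a := k + 8 * max_placements V * K'; have a0 : 0 < a by rewrite addn_gt0 k0.
pose b := 4 * (h * h).
have [n1 isolP] := few_isolated pl k0 K'0.
have [n2 leavesP] := many_leaves pl sH uH hH a0 K'0.
have [N islP] := fin_all_exists (fun q : 'I_h => many_islands pl sH uH hH b K' (ltn0Sn q)).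
have [n3 fewP] := few_leaves pl sH uH hH (leq_addl _ _) a0.
pose Q4 := 4 * (2 * (max_placements V * (4 * a) ^ h.+1) * K').
(* [4 * k] serves [few_isolated] and [starts_count], [Q4] serves [many_leaves], and 1 gives m <= 2
   n. *)
exists (4 * k + Q4 + 1), (n1 + n2 + n3 + \max_q N q) => n m n0 lo hi.
have m2 : m <= 2 * n.
  have := weaken_scale (leq_addl _ _) hi; rewrite !mul1n; clear; lia.
have mk : k * m <= k * n + n.
  by apply: weaken_scale hi; rewrite -addnA; apply: leq_trans (leq_addr _ _); rewrite leq_pmull.
have iso_rare : K' * #|[set E in class_graphs P n m | n <= k * #|isol E|]| <= #|class_graphs P n m|.
  apply: isolP => //; first by apply: leq_trans n0; rewrite -!addnA leq_addr.
  by apply: weaken_scale lo; rewrite -addnA leq_addr.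
have leaf_rare := leavesP n m.
have {}leaf_rare : K' * #|[set E in class_graphs P n m | ~~ has_copy H E & n <= a * #|leaves E|]|
    <= #|class_graphs P n m|.
  apply: leaf_rare => //.
    by apply: leq_trans n0; rewrite [n1 + n2]addnC -!addnA leq_addr.
  by apply: weaken_scale lo; rewrite [4 * k + Q4]addnC -addnA leq_addr.
have few_rare := fewP n m.
have {}few_rare : K' * #|[set E in class_graphs P n m | [&& ~~ has_copy H E,
    a * #|leaves E| <= n & n <= 4 * #|starts V E|]]| <= #|class_graphs P n m|.
  by apply: few_rare; apply: leq_trans n0; rewrite addnAC leq_addl.
have island_rare (q : 'I_h) : K' * #|[set E in class_graphs P n m | ~~ has_copy H E &
    n <= b * #|islands E q.+1|]| <= #|class_graphs P n m|.
  by apply: islP; apply: leq_trans n0; apply: leq_trans (leq_addl _ _); apply: leq_bigmax.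
set G := class_graphs P n m in iso_rare leaf_rare few_rare island_rare *.
set A1 := [set E in G | _] in iso_rare; set A2 := [set E in G | _] in leaf_rare.
set A3 := [set E in G | _] in few_rare.
pose A4 (q : 'I_h) := [set E in G | ~~ has_copy H E & n <= b * #|islands E q.+1|].
have cov : [set E in G | ~~ has_copy H E] \subset A1 :|: A2 :|: A3 :|: \bigcup_q A4 q.
  apply/subsetP => E /setIdP[EG noH]; rewrite !in_setU.
  have [//|i1] := boolP (E \in A1); have [//|i2] := boolP (E \in A2).
  have [//|i3] := boolP (E \in A3); apply/bigcupP.
  case: (pickP (fun q : 'I_h => E \in A4 q)) => [q Eq|no4]; first by exists q.
  have isolE : k * #|isol E| <= n.
    by rewrite leqNgt; apply: contra i1 => /ltnW le; rewrite inE EG.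
  have leafE : a * #|leaves E| <= n.
    by rewrite leqNgt; apply: contra i2 => /ltnW le; rewrite inE EG noH.
  case/negP: i3; rewrite inE EG noH leafE /=; apply: (starts_count r sH uH EG) => //.
  - by apply: leq_trans leafE; rewrite leq_mul2r leq_addr orbT.
  - case=> // q /= qh; rewrite leqNgt; apply/negP => /ltnW le.
    by have /negP[] := no4 (Ordinal qh); rewrite inE EG noH.
have {}cov := subset_leq_card cov.
have c4 : #|\bigcup_q A4 q| <= \sum_q #|A4 q|.
  elim/big_ind2: _ => [|A a' B b' Aa Bb|q _] //; first by rewrite cards0.
  by apply: leq_trans (leq_card_setU _ _) _; apply: leq_add.
have tot : K' * #|[set E in G | ~~ has_copy H E]| <= (h + 3) * #|G|.
  apply: (@leq_trans (K' * (#|A1| + #|A2| + #|A3| + \sum_q #|A4 q|))).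
    rewrite leq_mul2l; apply/orP; right; apply: leq_trans cov _.
    apply: leq_trans (leq_card_setU _ _) _; apply: leq_add c4.
    apply: leq_trans (leq_card_setU _ _) _; rewrite leq_add2r; exact: leq_card_setU.
  have : K' * \sum_q #|A4 q| <= h * #|G|.
    rewrite big_distrr /= -[X in _ <= X * _](card_ord h) -sum_nat_const.
    by apply: leq_sum => q _; apply: island_rare.
  rewrite [K' * (_ + _)]mulnDr [K' * (_ + _ + _)]mulnDr [K' * (_ + _)]mulnDr [(_ + 3) * _]mulnDl.
  move: iso_rare leaf_rare few_rare; rewrite -/A1 -/A2 -/A3.
  move: (K' * #|A1|) (K' * #|A2|) (K' * #|A3|) (K' * \sum_q _) #|G| (h * #|G|); clear; lia.
by move: tot; rewrite -mulnA leq_pmul2l // addn_gt0 orbT.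
Qed.

From mathcomp Require Import all_boot all_order all_algebra.
From mathcomp Require Import all_classical all_reals all_analysis.
From mathcomp Require Import ring lra.
Import Order.TTheory GRing.Theory Num.Theory.
Import numFieldNormedType.Exports.

Local Open Scope classical_set_scope.
Local Open Scope ring_scope.

(** * From drawings to grids *)

Section Clamp.
Variable R : realType.
Implicit Types (t : R) (x y : R * R) (f : R -> R * R).

(** Composing with [clamp] turns an arc continuous on [0, 1] only into a function continuous
    everywhere. *)
Definition clamp t : R := Num.min (Num.max t 0) 1.

Lemma clamp_itv t : clamp t \in `[0, 1]%R.
Proof. by rewrite in_itv /= /clamp le_min ge_min le_max !lexx ler01 !orbT. Qed.

Lemma clamp_id t : t \in `[0, 1]%R -> clamp t = t.
Proof. by rewrite in_itv /= => /andP[t0 t1]; rewrite /clamp max_l // min_l. Qed.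

Lemma continuous_clamp : continuous clamp.
Proof.
move=> t; apply: (@continuous_min R R (id \max cst 0) (cst 1)).
  by apply: (@continuous_max R R id (cst 0)); [exact: cvg_id|exact: cvg_cst].
exact: cvg_cst.
Qed.

Lemma continuous_clamped f :
  {within `[0, 1], continuous f} -> continuous (f \o clamp).
Proof.
move=> /subspace_continuousP cf t.
apply: (@cvg_comp _ _ _ clamp f _ (within `[0, 1] (nbhs (clamp t)))).
  move=> A wA.
  have h : \forall s \near t, clamp s \in `[0, 1]%R -> A (clamp s) :=
    @continuous_clamp t _ wA.
  change (nbhs t (clamp @^-1` A)).
  by apply: filterS h => s /(_ (clamp_itv s)).
exact: cf (clamp_itv t).
Qed.

(** The sup metric: its balls are squares, so the grid points in a ball form a rectangle. *)
Definition dist (x y : R * R) : R := Num.max `|x.1 - y.1| `|x.2 - y.2|.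

Lemma dist_le x y d : (dist x y <= d) = (`|x.1 - y.1| <= d) && (`|x.2 - y.2| <= d).
Proof. by rewrite /dist ge_max. Qed.

Lemma dist_lt x y d : (dist x y < d) = (`|x.1 - y.1| < d) && (`|x.2 - y.2| < d).
Proof. by rewrite /dist gt_max. Qed.

Lemma distC x y : dist x y = dist y x.
Proof. by rewrite /dist distrC [X in Num.max _ X]distrC. Qed.

Lemma distxx x : dist x x = 0.
Proof. by rewrite /dist !subrr normr0 maxxx. Qed.

Lemma dist_triangle y x z : dist x z <= dist x y + dist y z.
Proof.
rewrite dist_le; apply/andP; split.
  apply: le_trans (ler_distD y.1 _ _) _; apply: lerD; rewrite le_max lexx //.
apply: le_trans (ler_distD y.2 _ _) _; apply: lerD; rewrite le_max lexx orbT //.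
Qed.

Lemma dist_ge0 x y : 0 <= dist x y.
Proof. by rewrite le_max normr_ge0. Qed.

Lemma dist_gt0 x y : x <> y -> 0 < dist x y.
Proof.
move=> xy; rewrite lt_def dist_ge0 andbT; apply/eqP => d0; apply: xy.
have : dist x y <= 0 by rewrite d0.
rewrite dist_le !normr_le0 !subr_eq0 => /andP[/eqP + /eqP].
by case: x y {d0} => [a b] [c d] /= -> ->.
Qed.

Lemma dist_norm (x y : R * R) : dist x y = `|x - y|.
Proof. by rewrite prod_normE. Qed.

Lemma continuous_near_dist f t e : continuous f -> 0 < e ->
  \forall s \near t, dist (f s) (f t) < e.
Proof.
move=> cf e0; have /cvgrPdist_lt /(_ _ e0) := cf t.
by apply: filterS => s; rewrite distC dist_norm.
Qed.

(* [0, 1] is connected, so the points of a curve can be joined by short steps *)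
Lemma short_steps f (e : R) : continuous f -> 0 < e ->
  exists s : seq R, path (fun u v : R => dist (f u) (f v) <= e) 0 s /\ last 0 s = 1.
Proof.
move=> cf e0.
pose S := [set t : R | exists s : seq R,
  path (fun u v : R => dist (f u) (f v) <= e) 0 s /\ last 0 s = t].
have step t u : S t -> dist (f t) (f u) <= e -> S u.
  move=> [s [ps ls]] tu; exists (rcons s u); rewrite last_rcons rcons_path ps ls.
  by [].
have opS : open S.
  rewrite openE => t St; have := continuous_near_dist t cf e0.
  by apply: filterS => u ut; apply: step St _; rewrite distC ltW.
have opSC : open (~` S).
  rewrite openE => t St; have := continuous_near_dist t cf e0.
  by apply: filterS => u ut Su; apply: St; apply: step Su (ltW ut).
suff : S 1 by [].
suff -> : S = setT by [].
have cR : connected [set: R].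
  by apply/connected_intervalP => x y _ _ z _.
apply: cR.
- by exists 0, [::].
- by exists S => //; rewrite setTI.
- by exists S; rewrite ?setTI // -openC.
Qed.

Lemma compact_dist_gt0 (A B : set (R * R)) : compact A -> compact B ->
  (forall x y, A x -> B y -> x <> y) ->
  exists2 d : R, 0 < d & forall x y, A x -> B y -> d < dist x y.
Proof.
move=> cA cB dAB.
have [[[a b] [Aa Bb]]|] := pselect (A `*` B !=set0); last first.
  move=> no; exists 1 => // x y Ax By; exfalso; apply: no; by exists (x, y).
have cn : {within A `*` B, continuous (fun z : (R * R) * (R * R) => `|z.1 - z.2|)}.
  apply: continuous_subspaceT => z.
  apply: (@cvg_norm _ _ _ (nbhs z)); apply: (@cvgB _ _ _ (nbhs z)); first exact: cvg_fst.
  exact: cvg_snd.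
have AB0 : A `*` B !=set0 by exists (a, b).
have [c /set_mem [Ac Bc] cmin] := compact_EVT_min AB0 (compact_setX cA cB) cn.
have c0 : 0 < dist c.1 c.2 by apply: dist_gt0; apply: dAB.
exists (dist c.1 c.2 / 2); first by rewrite divr_gt0.
move=> x y Ax By; apply: (@lt_le_trans _ _ (dist c.1 c.2)); first by lra.
by rewrite !dist_norm; apply: (cmin (x, y)); rewrite inE.
Qed.

Lemma finite_gt0 (I : finType) (P : I -> R -> Prop) :
  (forall i d e, e <= d -> P i d -> P i e) ->
  (forall i, exists2 d, 0 < d & P i d) ->
  exists2 d, 0 < d & forall i, P i d.
Proof.
move=> Pm Pd.
have /fin_all_exists[d dP] : forall i, exists d, 0 < d /\ P i d.
  by move=> i; have [d ? ?] := Pd i; exists d.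
exists (\big[Num.min/1]_i d i).
  apply: (big_ind (fun z : R => 0 < z)) => // [x y x0 y0|i _].
    by rewrite lt_min x0.
  by have [] := dP i.
move=> i; have [_] := dP i; apply: Pm; exact: bigmin_le.
Qed.
End Clamp.

Section Squash.
Variable R : realType.

(** Injective and continuous into (1/4, 3/4); it brings a drawing into the unit square, away from
    the border. *)
Definition squash1 (x : R) : R := 2^-1 + x / (4 * (1 + `|x|)).

Lemma squash1_inj : injective squash1.
Proof.
move=> x y /addrI; have x0 := normr_ge0 x; have y0 := normr_ge0 y.
have x1 : 4 * (1 + `|x|) != 0 by rewrite gt_eqF //; lra.
have y1 : 4 * (1 + `|y|) != 0 by rewrite gt_eqF //; lra.
move/eqP; rewrite eqr_div // => /eqP h.
have {}h : x * (1 + `|y|) = y * (1 + `|x|) by lra.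
have [xs|xs] := lerP 0 x; have [ys|ys] := lerP 0 y; move: h;
  rewrite ?(ger0_norm xs) ?(ger0_norm ys) ?(ltr0_norm xs) ?(ltr0_norm ys); nra.
Qed.

Lemma squash1_itv x : 4^-1 < squash1 x < 3 / 4.
Proof.
have x0 := normr_ge0 x.
have -> : squash1 x = 2^-1 + x / (1 + `|x|) / 4.
  by rewrite /squash1; field; rewrite gt_eqF //; lra.
have : - 1 < x / (1 + `|x|) < 1.
  rewrite ltr_pdivlMr ?ltr_pdivrMr; [|lra|lra].
  have := ler_norm x; have := ler_norm (- x); rewrite normrN => h1 h2.
  apply/andP; split; lra.
move: (x / _) => z /andP[z1 z2]; apply/andP; split; lra.
Qed.

Lemma continuous_squash1 : continuous squash1.
Proof.
move=> x; apply: cvgD; first exact: cvg_cst.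
apply: cvgM; first exact: cvg_id.
apply: cvgV; first by rewrite gt_eqF // mulr_gt0 // ltr_wpDr.
apply: cvgM; first exact: cvg_cst.
by apply: cvgD; [exact: cvg_cst|exact: cvg_norm].
Qed.

Definition squash (z : R * R) : R * R := (squash1 z.1, squash1 z.2).

Lemma squash_inj : injective squash.
Proof. by move=> [a b] [c d] [/squash1_inj -> /squash1_inj ->]. Qed.

Lemma continuous_squash : continuous squash.
Proof.
move=> z; apply: (@cvg_pair _ _ _ (nbhs z) (nbhs (squash1 z.1)) (nbhs (squash1 z.2))).
  by apply: (@cvg_comp _ _ _ fst squash1 _ (nbhs z.1)); [exact: cvg_fst|exact: continuous_squash1].
by apply: (@cvg_comp _ _ _ snd squash1 _ (nbhs z.2)); [exact: cvg_snd|exact: continuous_squash1].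
Qed.

Definition midsquare (z : R * R) : bool :=
  (4^-1 < z.1 < 3 / 4) && (4^-1 < z.2 < 3 / 4).

Lemma itv_oc (t : R) : t \in `]0, 1[ -> t \in `[0, 1].
Proof. by rewrite !in_itv /= => /andP[/ltW -> /ltW ->]. Qed.

Lemma planar_midsquare (V : finType) (E : {set {set V}}) : planar R E ->
  exists p gamma, [/\ @plane_drawing R V E p gamma,
    forall e, e \in E -> continuous (gamma e), forall v, midsquare (p v) &
    forall e t, midsquare (gamma e t) /\ gamma e t = gamma e (clamp t)].
Proof.
move=> [p [gamma [pI arcs gp gg]]].
exists (squash \o p), (fun e => squash \o (gamma e \o @clamp R)); split.
- split.
  + by apply: inj_comp pI; exact: squash_inj.
  + move=> e eE; have [gc gi [x [y [exy g0 g1]]]] := arcs e eE; split.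
    * apply: continuous_subspaceT => t; apply: continuous_comp.
        exact: continuous_clamped.
      exact: continuous_squash.
    * by move=> s t sI tI /squash_inj; rewrite /= !clamp_id //; apply: gi.
    * exists x, y; split=> //=; rewrite clamp_id ?g0 ?g1 // in_itv /= ?lexx ?ler01 //.
  + by move=> e v t eE tI /squash_inj; rewrite /= clamp_id ?itv_oc //; apply: gp.
  + move=> e e' s t eE e'E ee' sI tI /squash_inj.
    by rewrite /= !clamp_id ?itv_oc //; apply: gg.
- move=> e eE; have [gc _ _] := arcs e eE.
  move=> t; apply: continuous_comp; first exact: continuous_clamped.
  exact: continuous_squash.
- by move=> v; rewrite /midsquare !squash1_itv.
- move=> e t; rewrite /midsquare !squash1_itv; split=> //=.
  by rewrite (clamp_id (clamp_itv t)).
Qed.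
End Squash.

Section Separation.
Variables (R : realType) (V : finType) (E : {set {set V}}).
Variables (p : V -> R * R) (gamma : {set V} -> R -> R * R).
Hypotheses (dr : plane_drawing E p gamma)
  (cgamma : forall e, e \in E -> continuous (gamma e)).

Lemma compact_arc e : e \in E -> compact (gamma e @` `[0, 1]).
Proof.
move=> eE; apply: continuous_compact; last exact: segment_compact.
by apply: continuous_subspaceT; exact: cgamma.
Qed.

Lemma closed_far (c : R * R) (r : R) : closed [set q | r <= dist q c].
Proof.
have -> : [set q | r <= dist q c] = (fun q => `|q - c|) @^-1` [set x | r <= x].
  by apply/seteqP; split => q /=; rewrite dist_norm.
apply: closed_comp; last exact: closed_ge.
move=> q _; apply: (@cvg_norm _ _ _ (nbhs q)); apply: (@cvgB _ _ _ (nbhs q)).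
  exact: cvg_id.
exact: cvg_cst.
Qed.

Lemma endpoint e t : e \in E -> t \in `[0, 1] ->
  (t \in `]0, 1[) \/ exists2 x, x \in e & gamma e t = p x.
Proof.
have [_ arcs _ _] := dr => eE; have [_ _ [x [y [-> g0 g1]]]] := arcs e eE.
rewrite !in_itv /= => /andP[]; rewrite le_eqVlt => /predU1P[<- _|t0].
  by right; exists x; rewrite // !inE eqxx.
rewrite le_eqVlt => /predU1P[->|t1]; last by left; rewrite t0.
by right; exists y; rewrite // !inE eqxx orbT.
Qed.

(** Compactness: distinct arcs meet only at common ends, so what remains of them outside the r-boxes
    of their ends is compact and pairwise disjoint. *)
Lemma separation : exists r d : R,
  [/\ 0 < r <= 8^-1, 0 < d <= r, forall u v, u != v -> 4 * r < dist (p u) (p v),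
      forall e v (t : R), e \in E -> v \notin e -> t \in `[0, 1] -> 4 * r < dist (gamma e t) (p v) &
      forall e e' (s t : R), e \in E -> e' \in E -> e != e' -> s \in `[0, 1] -> t \in `[0, 1] ->
        (forall x, x \in e -> r <= dist (gamma e s) (p x)) ->
        (forall x, x \in e' -> r <= dist (gamma e' t) (p x)) ->
        d < dist (gamma e s) (gamma e' t)].
Proof.
have [pI arcs gp gg] := dr.
have [r1 r10 r1P] : exists2 r : R, 0 < r & forall uv : V * V, uv.1 != uv.2 -> r < dist (p uv.1) (p uv.2).
  apply: finite_gt0 => [uv a b ba h /h|uv]; first exact: le_lt_trans.
  have [->|uv12] := eqVneq uv.1 uv.2; first by exists 1.
  have dp : 0 < dist (p uv.1) (p uv.2).
    by apply: dist_gt0 => /pI/eqP; rewrite (negPf uv12).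
  by exists (dist (p uv.1) (p uv.2) / 2) => [|_]; lra.
have [r2 r20 r2P] : exists2 r : R, 0 < r & forall ev : {set V} * V, 
    forall t : R, ev.1 \in E -> ev.2 \notin ev.1 -> t \in `[0, 1] -> r < dist (gamma ev.1 t) (p ev.2).
  apply: finite_gt0 => [ev a b ba h t eE vn tI|[e v]] /=.
    exact: le_lt_trans ba (h t eE vn tI).
  have [eE|] := boolP (e \in E); last by exists 1.
  have [|vn] := boolP (v \in e); first by exists 1.
  have disj x y : (gamma e @` `[0, 1]) x -> [set p v] y -> x <> y.
    move=> [t tI <-] -> gt.
    have [tI'|[z ze gz]] := endpoint eE tI; first exact: gp eE tI' gt.
    by move: vn; rewrite -(pI _ _ (etrans (esym gz) gt)) ze.
  have [d d0 dP] := compact_dist_gt0 (compact_arc eE) (@compact_set1 _ (p v)) disj.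
  by exists d => // t _ _ tI; apply: dP => //; exists t.
(* The bound 1/8 keeps the boxes about points of the middle square inside the unit square. *)
pose r : R := Num.min 8^-1 (Num.min (r1 / 4) (r2 / 4)).
have r0 : 0 < r by rewrite !lt_min; apply/and3P; split; lra.
have [r8 ra rb] : [/\ r <= 8^-1, r <= r1 / 4 & r <= r2 / 4].
  by rewrite /r; split; rewrite ?ge_min ?lexx ?orbT.
pose tube e := (gamma e @` `[0, 1]) `&` [set q | forall x, x \in e -> r <= dist q (p x)].
have ctube e : e \in E -> compact (tube e).
  move=> eE; apply: compact_closedI; first exact: compact_arc.
  have [_ _ [x [y [-> _ _]]]] := arcs e eE.
  have -> : [set q | forall z, z \in [set x; y]%SET -> r <= dist q (p z)] =
     [set q | r <= dist q (p x)] `&` [set q | r <= dist q (p y)].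
    apply/seteqP; split=> q /=; first by move=> h; split; apply: h; rewrite !inE eqxx ?orbT.
    by move=> [hx hy] z; rewrite !inE => /orP[] /eqP ->.
  by apply: closedI; exact: closed_far.
have [d d0 dP] : exists2 d : R, 0 < d & forall ee : {set V} * {set V},
    forall x y, ee.1 \in E -> ee.2 \in E -> ee.1 != ee.2 ->
    tube ee.1 x -> tube ee.2 y -> d < dist x y.
  apply: finite_gt0 => [ee a b ba h x y e1 e2 ne t1 t2|[e e']] /=.
    exact: le_lt_trans ba (h x y e1 e2 ne t1 t2).
  have [eE|] := boolP (e \in E); last by exists 1.
  have [eE'|] := boolP (e' \in E); last by exists 1.
  have [->|ee] := eqVneq e e'; first by exists 1.
  have disj x y : tube e x -> tube e' y -> x <> y.
    move=> [[s sI <-] sf] [[t tI <-] tf].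
    have [sI'|[z ze gz]] := endpoint eE sI; last first.
      by have := sf z ze; rewrite gz distxx leNgt r0.
    have [tI'|[z ze gz]] := endpoint eE' tI; last first.
      by have := tf z ze; rewrite gz distxx leNgt r0.
    exact: gg.
  have [d d0 dP] := compact_dist_gt0 (ctube e eE) (ctube e' eE') disj.
  by exists d => // x y _ _ _; exact: dP.
exists r, (Num.min d r); split.
- by rewrite r0 r8.
- by rewrite lt_min d0 r0 ge_min lexx orbT.
- by move=> u v uv; have := r1P (u, v) uv => /=; lra.
- by move=> e v t eE ve tI; have := r2P (e, v) t eE ve tI => /=; lra.
- move=> e e' s t eE e'E ee sI tI sf tf; rewrite gt_min; apply/orP; left.
  by apply: (dP (e, e')) => //; split=> //; [exists s|exists t].
Qed.
End Separation.

Section GridPoints.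
Variables (R : realType) (N : nat).
Hypothesis N0 : (0 < N)%N.
Let h : R := N%:R^-1.

Let NR0 : 0 < N%:R :> R. Proof. by rewrite ltr0n. Qed.
Let h0 : 0 < h. Proof. by rewrite invr_gt0. Qed.

Definition gpt (z : 'I_N.+1 * 'I_N.+1) : R * R := (z.1%:R * h, z.2%:R * h).

Definition gball (c : R * R) (r : R) : {set 'I_N.+1 * 'I_N.+1} :=
  [set z | dist (gpt z) c <= r]%SET.

Lemma gball_connected c r z z' : z \in gball c r -> z' \in gball c r ->
  connect (restr (@gadj N.+1) (gball c r)) z z'.
Proof.
have -> : gball c r = [set z | (fun a : 'I_N.+1 => `|a%:R * h - c.1| <= r) z.1 &&
                            (fun a : 'I_N.+1 => `|a%:R * h - c.2| <= r) z.2]%SET.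
  by apply/setP => t; rewrite !inE dist_le.
rewrite !inE => /andP[z1 z2] /andP[z1' z2'].
have conv (x : R) (a b d : 'I_N.+1) : (a <= b)%N -> (b <= d)%N ->
    `|a%:R * h - x| <= r -> `|d%:R * h - x| <= r -> `|b%:R * h - x| <= r.
  rewrite -(ler_nat R) -[(b <= d)%N](ler_nat R) => ab bd.
  have {}ab : a%:R * h <= b%:R * h by rewrite ler_wpM2r // ltW.
  have {}bd : b%:R * h <= d%:R * h by rewrite ler_wpM2r // ltW.
  by rewrite !ler_norml => /andP[? ?] /andP[? ?]; apply/andP; split; lra.
apply: (@grid_rect _ (fun a : 'I_N.+1 => `|a%:R * h - c.1| <= r)
  (fun a : 'I_N.+1 => `|a%:R * h - c.2| <= r)) => //; exact: conv.
Qed.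

(** Rounding a towards c. In two dimensions this finds a grid point near a sample of an arc that
    still lies in the box of its end. *)
Lemma round1 (a c : R) : 0 <= a <= 1 -> 0 <= c <= 1 ->
  exists k : 'I_N.+1, `|k%:R * h - a| <= h /\ `|k%:R * h - c| <= Num.max `|a - c| h.
Proof.
move=> /andP[a0 a1] /andP[c0 c1].
have Na : 0 <= N%:R * a by rewrite mulr_ge0 // ltW.
have /andP[k1 k2] := truncn_itv Na; move: (Num.truncn _) k1 k2 => k k1 k2.
have E : N%:R * h = 1 by rewrite divff // gt_eqF.
have {k1}k1 : k%:R * h <= a.
  by move: k1; rewrite -(ler_pM2r h0) mulrAC E mul1r.
have {k2}k2 : a < k.+1%:R * h.
  by move: k2; rewrite -(ltr_pM2r h0) mulrAC E mul1r.
have {}E (j : nat) : (j <= N)%N = (j%:R * h <= 1).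
  by rewrite -(ler_nat R) -(ler_pM2r h0) E.
rewrite -natr1 mulrDl mul1r in k2.
have [ca|ac] := lerP c a.
  have kN : (k < N.+1)%N by rewrite ltnS E; lra.
  exists (Ordinal kN) => /=; split; first by rewrite ler_norml; apply/andP; split; lra.
  rewrite le_max; apply/orP; have [ck|kc] := lerP c (k%:R * h).
    by left; lra.
  by right; lra.
have kN : (k.+1 < N.+1)%N.
  rewrite ltnS ltnNge; apply/negP => Nk.
  have : N%:R * h <= k%:R * h by rewrite ler_pM2r // ler_nat.
  by rewrite divff ?gt_eqF //; lra.
exists (Ordinal kN) => /=; rewrite -natr1 mulrDl mul1r.
split; first by rewrite ler_norml; apply/andP; split; lra.
rewrite le_max; apply/orP; have [ck|kc] := lerP c (k%:R * h + h).
  by right; lra.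
by left; lra.
Qed.

Lemma round2 (a c : R * R) : midsquare a -> midsquare c ->
  exists z, z \in gball a h /\ z \in gball c (Num.max (dist a c) h).
Proof.
move=> /andP[/andP[a1 a1'] /andP[a2 a2']] /andP[/andP[c1 c1'] /andP[c2 c2']].
have unit (x : R) : 4^-1 < x -> x < 3 / 4 -> 0 <= x <= 1 by move=> *; apply/andP; split; lra.
have [k [k1 k2]] := round1 (unit _ a1 a1') (unit _ c1 c1').
have [l [l1 l2]] := round1 (unit _ a2 a2') (unit _ c2 c2').
have [d1 d2] : `|a.1 - c.1| <= dist a c /\ `|a.2 - c.2| <= dist a c.
  by rewrite /dist !le_max !lexx orbT.
exists (k, l); rewrite !inE !dist_le /= k1 l1; split=> //.
apply/andP; split; [apply: le_trans k2 _|apply: le_trans l2 _];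
  rewrite ge_max; apply/andP; split; rewrite le_max ?d1 ?d2 ?lexx ?orbT //.
Qed.

Lemma gball_inner (c : R * R) (r : R) z : midsquare c -> r <= 8^-1 -> h <= 8^-1 ->
  z \in gball c r -> inner_grid z.
Proof.
move=> /andP[/andP[c1 c1'] /andP[c2 c2']] r8 h8.
rewrite inE dist_le /= !ler_norml => /andP[/andP[z1 z1'] /andP[z2 z2']].
have E : N%:R * h = 1 by rewrite divff // gt_eqF.
have pos (k : nat) : 0 < k%:R * h -> (0 < k)%N by rewrite pmulr_lgt0 // ltr0n.
have lt (k : nat) : k%:R * h < 1 -> (k.+1 < N.+1)%N.
  by rewrite ltnS -(ltr_nat R) -(ltr_pM2r h0) E.
by apply/and4P; split; [apply: pos|apply: lt|apply: pos|apply: lt]; lra.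
Qed.

Lemma gball_dist c c' r r' z : z \in gball c r -> z \in gball c' r' -> dist c c' <= r + r'.
Proof.
rewrite !inE distC => h1 h2; apply: le_trans (dist_triangle (gpt z) _ _) _.
exact: lerD.
Qed.

Lemma gball_sub c c' r z : z \in gball c r -> z \in gball c' (r + dist c c').
Proof.
rewrite !inE => h1; apply: le_trans (dist_triangle c _ _) _.
exact: lerD.
Qed.
End GridPoints.

(** The samples run from the last one near px to the next one near py. Some lie in between, since
    one step of length h / 2 cannot bridge the gap between the boxes. *)
Lemma arc_samples (R : realType) (f : R -> R * R) (px py : R * R) (r h : R) :
  continuous f -> f 0 = px -> f 1 = py -> 0 < r -> 0 < h -> h <= r -> 4 * r < dist px py ->
  exists u m x y,
  [/\ dist (f x) px < r, dist (f y) py < r,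
    path (fun s t => dist (f s) (f t) <= h / 2) x (rcons (u :: m) y) &
    all (fun s => (r <= dist (f s) px) && (r <= dist (f s) py)) (u :: m)].
Proof.
move=> fc f0 f1 r0 h0 hr far; have h20 : 0 < h / 2 by lra.
have [s [ps ls]] := short_steps fc h20.
have PQ (x : R) : dist (f x) px < r -> ~~ (dist (f x) py < r).
  move=> xr; apply/negP => yr; have := dist_triangle (f x) px py.
  by rewrite [dist px (f x)]distC; lra.
have [||x [m [y [Px Qy pm am]]]] := last_first_split PQ ps.
- by rewrite f0 distxx.
- by rewrite ls f1 distxx.
case: m pm am => [|u m] pm am.
  move: pm => /=; rewrite andbT => xy.
  have := dist_triangle (f x) px py; have := dist_triangle (f y) (f x) py.
  by rewrite [dist px (f x)]distC; lra.
exists u, m, x, y; split=> //.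
by apply: sub_all am => t; rewrite -!leNgt.
Qed.

Lemma planar_grid_minor (R : realType) (V : finType) (E : {set {set V}}) :
  simple_graph E -> planar R E ->
  exists N B ra rb, @grid_minor N V E B ra rb.
Proof.
move=> sE /planar_midsquare [p [gamma [dr cg pm gm]]].
have [r [d [/andP[r0 r8] /andP[d0 dr'] pp ap aa]]] := separation dr cg.
have [_ arcs _ _] := dr.
(* The mesh h then satisfies 8 h <= d, so tubes of radius 2 h about different arcs are disjoint. *)
pose N := (Num.truncn (8 / d)).+1.
have N0 : (0 < N)%N by [].
pose h : R := N%:R^-1.
have NR0 : 0 < N%:R :> R by rewrite ltr0n.
have h0 : 0 < h by rewrite invr_gt0.
have hd : 8 * h <= d.
  have d8 : 0 <= 8 / d by rewrite divr_ge0 // ltW.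
  have /andP[_] := truncn_itv d8; rewrite -/N ltr_pdivrMr // => lt.
  by rewrite /h ler_pdivrMr // mulrC ltW // mulrC.
(* The samples lie outside the boxes; the last clause gives, for each end of e, a point c of the arc
   inside its box and within h / 2 of a sample w. *)
pose good e (x0 : R * R) l := 
  [/\ forall z, z \in x0 :: l -> exists2 t, t \in `[0, 1] & z = gamma e t /\
         forall x, x \in e -> r <= dist z (p x),
      path (fun u v => dist u v <= h / 2) x0 l &
      forall x, x \in e -> exists c w, [/\ midsquare c, dist c (p x) < r,
         w \in x0 :: l & dist c w <= h / 2]].
have : forall e, exists t : (R * R) * seq (R * R), e \in E -> good e t.1 t.2.
  move=> e; have [eE|] := boolP (e \in E); last by exists ((0, 0), [::]).
  have [_ _ [x [y [ee g0 g1]]]] := arcs e eE.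
  have xy : x != y.
    by apply/eqP => xy; move/forall_inP: sE => /(_ e eE); rewrite ee xy finset.setUid cards1.
  have hr : h <= r by lra.
  have [u [m [a [b [ax by_ pth al]]]]] := arc_samples (cg e eE) g0 g1 r0 h0 hr (pp _ _ xy).
  exists (gamma e u, map (gamma e) m) => _ /=.
  have mem z : z \in gamma e u :: map (gamma e) m -> exists2 t, t \in u :: m & z = gamma e t.
    by rewrite -map_cons => /mapP.
  have ine w : w \in e -> w = x \/ w = y.
    by rewrite ee !inE => /orP[] /eqP ->; [left|right].
  split.
  - move=> z /mem[t tm ->]; exists (clamp t); first exact: clamp_itv.
    split; first by have [_ <-] := gm e t.
    by move=> w /ine[] ->; have /andP[] := allP al t tm.
  - move: pth; rewrite rcons_cons /= => /andP[_]; rewrite rcons_path => /andP[+ _].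
    by rewrite path_map.
  - move=> w /ine[] ->.
      exists (gamma e a), (gamma e u); rewrite mem_head; split=> //; first by have [] := gm e a.
      by move: pth; rewrite rcons_cons /= => /andP[].
    exists (gamma e b), (gamma e (last u m)); split=> //; first by have [] := gm e b.
      by rewrite -last_map mem_last.
    by rewrite distC; move: pth; rewrite rcons_cons /= => /andP[_]; rewrite rcons_path => /andP[].
case/fin_all_exists => t tP.
pose A v := gball N (p v) r.
(* With radius 2 h, a grid point within h of one sample, or of the point c above, also belongs to
   the ball of a sample h / 2 further; so consecutive balls intersect and tubes meet the boxes of
   their ends. *)
pose K e := [set z | has (fun c => z \in gball N c (2 * h)) ((t e).1 :: (t e).2)]%SET.
exists N.+1; apply: (@tubes_minor N V E A K) => //.
- move=> v z; apply: gball_inner => //; rewrite -/h; lra.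
- move=> e z eE; rewrite inE => /hasP[c cin].
  have [samp _ _] := tP e eE; have [s sI [-> _]] := samp c cin.
  apply: gball_inner => //; rewrite -/h; [by have [] := gm e s|lra|lra].
- move=> u v z zu zv; apply/eqP; apply: contraT => /pp.
  by have := gball_dist zu zv; lra.
- move=> e e' z eE eE'; rewrite !inE => /hasP[c cin zc] /hasP[c' cin' zc'].
  apply/eqP; apply: contraT => ee.
  have [samp _ _] := tP e eE; have [s sI [cE cf]] := samp c cin.
  have [samp' _ _] := tP e' eE'; have [s' sI' [cE' cf']] := samp' c' cin'.
  have := gball_dist zc zc'; rewrite cE cE' in cf cf' *.
  by have := aa e e' s s' eE eE' ee sI sI' cf cf'; rewrite -/h; lra.
- move=> v e z eE zv; rewrite inE => /hasP[c cin zc].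
  have [samp _ _] := tP e eE; have [s sI [cE _]] := samp c cin.
  apply: contraT => ve; have := ap e v s eE ve sI.
  by have := gball_dist zc zv; rewrite cE -/h; lra.
- move=> v e eE ve; have [_ _ near_] := tP e eE.
  have [c [w [mc cv wl cw]]] := near_ v ve.
  have [z [z1 z2]] := round2 N0 mc (pm v).
  exists z.
    move: z2; rewrite !inE => z2; apply: le_trans z2 _.
    by rewrite ge_max ltW //= -/h; lra.
  rewrite inE; apply/hasP; exists w => //.
  have := gball_sub w z1; rewrite !inE -/h => /le_trans; apply; lra.
- by move=> v z z'; apply: gball_connected.
- move=> e z z' eE; rewrite !inE => zK zK'.
  apply: (union_connected (b := fun c => gball N c (2 * h))) => //.
  + exact: gadj_sym.
  + by move=> c a b; apply: gball_connected.
  + have [samp pth _] := tP e eE.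
    apply: (sub_in_path (P := fun c => c \in (t e).1 :: (t e).2)) pth; last by apply/allP.
    move=> a b ain bin ab; apply/set0Pn.
    have [s _ [aE _]] := samp a ain.
    have ma : midsquare a by rewrite aE; have [] := gm e s.
    have [x [x1 _]] := round2 N0 ma ma.
    exists x; rewrite inE; apply/andP; split.
      by move: x1; rewrite !inE -/h => /le_trans; apply; lra.
    by have := gball_sub b x1; rewrite !inE -/h => /le_trans; apply; lra.
Qed.

Theorem planar_euler (R : realType) (V : finType) (E : {set {set V}}) (g : nat) :
  simple_graph E -> planar R E ->
  (forall F : {set {set V}}, F \subset E -> F != finset.set0 -> even_edges F -> (g <= #|F|)%N) ->
  ((#|E| - #|[set x | nbrs E x != finset.set0]%SET|) * g <= 2 * #|E|)%N.
Proof.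
move=> sE /(planar_grid_minor sE) [N [B [ra [rb gm]]]].
exact: grid_euler sE gm _.
Qed.

(** * Hanging a graph at a vertex *)

Section Chords.
Variable R : realType.

Definition seg (A B : R * R) (t : R) : R * R :=
  ((1 - t) * A.1 + t * B.1, (1 - t) * A.2 + t * B.2).

(* A chord of the parabola lies above the point of abscissa z by (z - a)(b - z). *)
Lemma chord_height (a b t : R) : let z := (1 - t) * a + t * b in
  (1 - t) * a ^+ 2 + t * b ^+ 2 = z ^+ 2 + (z - a) * (b - z).
Proof. by move=> z; rewrite /z; ring. Qed.

(** Two chords over the same z that do not interleave are nested, and the outer one is strictly
    higher unless both ends agree. *)
Lemma chords_disjoint (a b c d z : R) : a < z < b -> c < z < d ->
  (z - a) * (b - z) = (z - c) * (d - z) ->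
  ~~ [&& a < c, c < b & b < d] -> ~~ [&& c < a, a < d & d < b] ->
  a = c /\ b = d.
Proof.
move=> /andP[az zb] /andP[cz zd] eqh n1 n2.
have [ac|ca|ac] := ltgtP a c.
- move: n1; rewrite ac (lt_trans cz zb) /= -leNgt => db; exfalso; nra.
- move: n2; rewrite ca (lt_trans az zd) /= -leNgt => db; exfalso; nra.
- subst c; split=> //.
  by move: eqh => /mulfI => /(_ _)/addIr; apply; rewrite gt_eqF // subr_gt0.
Qed.

Lemma parabola_drawing (V : finType) (H : {set {set V}}) (pos : V -> nat) (r : V)
    (a o : R * R) (rho : R) :
  injective pos -> noncrossing H pos -> (forall v, (pos r <= pos v)%N) -> 
  simple_graph H -> 0 < rho -> dist a o <= rho ->
  exists P : V -> R * R,
  [/\ injective P /\ P r = a, forall v, v != r -> dist (P v) o < rho,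
      forall x y (t : R), adj H x y -> t \in `]0, 1[ -> dist (seg (P x) (P y) t) o < rho,
      forall x y v (t : R), adj H x y -> t \in `]0, 1[ -> seg (P x) (P y) t <> P v &
      forall x y x' y' (s t : R), adj H x y -> adj H x' y' -> [set x; y]%SET != [set x'; y']%SET ->
       s \in `]0, 1[ -> t \in `]0, 1[ -> seg (P x) (P y) s <> seg (P x') (P y') t].
Proof.
move=> posI nc rmin sH rho0 ao.
pose M := (\max_v pos v)%N.
pose X v : R := (pos v - pos r)%:R / M.+1%:R.
have M0 : 0 < M.+1%:R :> R by rewrite ltr0n.
have X0 v : 0 <= X v by rewrite divr_ge0.
have X1 v : X v <= 1.
  rewrite ler_pdivrMr // mul1r ler_nat; apply: leq_trans (leq_subr _ _) _.
  exact/leqW/leq_bigmax.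
have Xr : X r = 0 by rewrite /X subnn mul0r.
have Xlt u v : (X u < X v) = (pos u < pos v)%N.
  rewrite ltr_pM2r ?invr_gt0 // ltr_nat ltn_sub2rE //.
have XI : injective X.
  move=> u v Xuv; apply: posI; have := Xlt u v; have := Xlt v u; rewrite Xuv ltxx.
  by case: ltngtP.
have Xpos v : v != r -> 0 < X v.
  move=> vr; rewrite lt_def X0 andbT; apply: contra vr => /eqP Xv.
  by apply/eqP/XI; rewrite Xv Xr.
(* The abscissa aimed at: o.1, moved aside if it equals a.1, for the map [F] must be injective. *)
have [q1 q1a q1o] : exists2 q1 : R, q1 != a.1 & `|q1 - o.1| < rho.
  have [->|oa] := eqVneq a.1 o.1; last by exists o.1; rewrite 1?eq_sym // subrr normr0.
  exists (o.1 + rho / 2); first by rewrite gt_eqF //; lra.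
  by rewrite addrC addKr ger0_norm; lra.
(* An affine image of the parabola with x = 0 at a. As x grows, the point moves from a towards (q1,
   o.2); the extra height is at most x * rho / 2, so the box is left at no x in (0, 1]. *)
pose F (x y : R) : R * R := (a.1 + x * (q1 - a.1), a.2 + x * (o.2 - a.2) + y * (rho / 2)).
have FI x y x' y' : F x y = F x' y' -> x = x' /\ y = y'.
  case=> /addrI /mulIf -> => [|]; last by rewrite subr_eq0.
  by move=> /addrI /mulIf ->//; rewrite gt_eqF //; lra.
pose P v := F (X v) (X v ^+ 2).
have segE x y t : seg (P x) (P y) t =
    F ((1 - t) * X x + t * X y) ((1 - t) * X x ^+ 2 + t * X y ^+ 2).
  by rewrite /seg /P /F /=; congr (_, _); ring.
move: ao; rewrite dist_le !ler_norml => /andP[/andP[a1 a1'] /andP[a2 a2']].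
have box x y : 0 < x <= 1 -> 0 <= y <= x -> dist (F x y) o < rho.
  move: q1o; rewrite ltr_norml => /andP[q q'].
  move=> /andP[x0 x1] /andP[y0 y1].
  by rewrite dist_lt /= !ltr_norml; apply/andP; split; apply/andP; split; nra.
have sq v : 0 <= X v ^+ 2 <= X v by have := X0 v; have := X1 v => *; apply/andP; split; nra.
have between x y : adj H x y -> X x != X y.
  by move=> /(adj_neq sH) xy; rewrite (inj_eq XI).
exists P; split.
- split; last by rewrite /P Xr /F expr0n /= !mul0r !addr0; case: (a).
  by move=> u v /FI[/XI].
- by move=> v /Xpos v0; apply: box; rewrite ?v0 ?X1 ?sq.
- move=> x y t xy tI; rewrite segE; apply: box.
    have := between x y xy; move: tI; rewrite in_itv /= => /andP[t0 t1] ne.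
    have := X0 x; have := X1 x; have := X0 y; have := X1 y => *.
    apply/andP; split; last by nra.
    have [x0|x0] := eqVneq (X x) 0.
      by rewrite x0 mulr0 add0r mulr_gt0 // lt_def X0 andbT -x0 eq_sym.
    have : 0 < X x by rewrite lt_def x0 X0.
    by nra.
  have /andP[? ?] := sq x; have /andP[? ?] := sq y.
  move: tI; rewrite in_itv /= => /andP[t0 t1].
  by apply/andP; split; nra.
- move=> x y v t xy tI; rewrite segE => /FI[Ev]; rewrite chord_height Ev => /eqP.
  rewrite -subr_eq0 addrC addKr mulf_eq0 -{1 2}Ev.
  have := between x y xy; move: tI; rewrite in_itv /= => /andP[t0 t1] ne.
  have -> : (1 - t) * X x + t * X y - X x = t * (X y - X x) by ring.
  have -> : X y - ((1 - t) * X x + t * X y) = (1 - t) * (X y - X x) by ring.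
  rewrite !mulf_eq0 !subr_eq0 [X y == _]eq_sym (negPf ne) !orbF => /orP[|] /eqP; lra.
(* Chords oriented from left to right; the other cases reverse the parameter. *)
- have main x y x' y' s t : adj H x y -> adj H x' y' -> [set x; y]%SET != [set x'; y']%SET ->
       s \in `]0, 1[ -> t \in `]0, 1[ -> X x < X y -> X x' < X y' ->
       seg (P x) (P y) s <> seg (P x') (P y') t.
    move=> xy xy' ne; rewrite !in_itv /= => /andP[s0 s1] /andP[t0 t1] ltx ltx'.
    rewrite !segE => /FI[Ez]; rewrite !chord_height -Ez => /addrI hz.
    have zI : X x < (1 - s) * X x + s * X y < X y by apply/andP; split; nra.
    have zI' : X x' < (1 - s) * X x + s * X y < X y'.
      by rewrite Ez; apply/andP; split; nra.
    have := chords_disjoint zI zI' hz; rewrite !Xlt => /(_ (nc _ _ _ _ xy xy') (nc _ _ _ _ xy' xy)).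
    by move=> [/XI Ex /XI Ey]; rewrite Ex Ey eqxx in ne.
  have flip x y t : seg (P x) (P y) t = seg (P y) (P x) (1 - t).
    by rewrite /seg; congr (_, _); ring.
  have flipI (t : R) : t \in `]0, 1[ -> 1 - t \in `]0, 1[.
    by rewrite !in_itv /= => /andP[? ?]; apply/andP; split; lra.
  move=> x y x' y' s t xy xy' ne sI tI.
  have yx : adj H y x by rewrite adj_sym.
  have yx' : adj H y' x' by rewrite adj_sym.
  have := between x y xy; rewrite neq_lt => /orP[] lt1;
  have := between x' y' xy'; rewrite neq_lt => /orP[] lt2.
  + exact: main.
  + by rewrite [seg (P x') _ _]flip; apply: main => //; rewrite 1?(finset.setUC [set y']%SET) //; apply: flipI.
  + by rewrite flip; apply: main => //; rewrite 1?(finset.setUC [set y]%SET) //; apply: flipI.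
  + rewrite flip [seg (P x') _ _]flip; apply: main => //; try exact: flipI.
    by rewrite (finset.setUC [set y]%SET) (finset.setUC [set y']%SET).
Qed.

Lemma continuous_seg (A B : R * R) : continuous (seg A B).
Proof.
move=> t; apply: (@cvg_pair _ _ _ (nbhs t) (nbhs ((1 - t) * A.1 + t * B.1))
  (nbhs ((1 - t) * A.2 + t * B.2))).
  by apply: cvgD; apply: cvgM; (try exact: cvg_cst); (try exact: cvg_id);
     apply: cvgB; [exact: cvg_cst|exact: cvg_id].
by apply: cvgD; apply: cvgM; (try exact: cvg_cst); (try exact: cvg_id);
   apply: cvgB; [exact: cvg_cst|exact: cvg_id].
Qed.

Lemma seg_inj (A B : R * R) : A <> B -> injective (seg A B).
Proof.
move=> AB s t [h1 h2].
have {}h1 : (s - t) * (B.1 - A.1) = 0 by lra.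
have {}h2 : (s - t) * (B.2 - A.2) = 0 by lra.
apply/eqP; rewrite -subr_eq0; apply: contraT => st; exfalso; apply: AB.
move: h1 h2 => /eqP + /eqP; rewrite !mulf_eq0 (negPf st) /= !subr_eq0 => /eqP + /eqP.
by case: A B {st} => [? ?] [? ?] /= -> ->.
Qed.
End Chords.

Lemma first_time (R : realType) (f : R -> R * R) (o : R * R) (rho : R) :
  continuous f -> rho < dist (f 0) o -> dist (f 1) o <= rho ->
  exists tau : R, [/\ 0 < tau <= 1, dist (f tau) o <= rho &
    forall t, 0 <= t < tau -> rho < dist (f t) o].
Proof.
move=> fc far near1.
pose S := `[0, 1] `&` [set t | dist (f t) o <= rho].
have cS : compact S.
  apply: compact_closedI; first exact: segment_compact.
  have -> : [set t | dist (f t) o <= rho] = (fun t => `|f t - o|) @^-1` [set x | x <= rho].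
    by apply/seteqP; split => t /=; rewrite dist_norm.
  apply: closed_comp; last exact: closed_le.
  move=> t _; apply: (@cvg_norm _ _ _ (nbhs t)); apply: (@cvgB _ _ _ (nbhs t)).
    exact: fc.
  exact: cvg_cst.
have S1 : S !=set0 by exists 1; split; rewrite //= in_itv /= ler01 lexx.
have idc : {within S, continuous (id : R -> R)}.
  by apply: continuous_subspaceT => t; exact: cvg_id.
have [tau /set_mem[tI tr] tmin] := compact_EVT_min S1 cS idc.
move: tI; rewrite /= in_itv /= => /andP[t0 t1].
exists tau; split=> //.
  by rewrite t1 andbT lt_def t0 andbT; apply: contraTneq far => <-; rewrite -leNgt.
move=> t /andP[t0' tt]; rewrite ltNge; apply/negP => tr'.
have : tau <= t.
  by apply: tmin; rewrite inE; split; rewrite //= in_itv /= t0' (le_trans (ltW tt)).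
by rewrite leNgt tt.
Qed.

(** A small box about p (f r) meets no arc but the one ending there, if any. That arc is cut at its
    first entry into the box, f r moves to the entry point, and H is drawn in the box, the isolated
    vertices f v being moved into it. *)
Lemma hang (R : realType) (V W : finType) (H : {set {set V}}) (E : {set {set W}})
    (pos : V -> nat) (r : V) (f : V -> W) :
  simple_graph H -> injective pos -> noncrossing H pos -> (forall v, (pos r <= pos v)%N) ->
  simple_graph E -> planar R E -> injective f ->
  (forall v, v != r -> nbrs E (f v) = finset.set0) -> (#|nbrs E (f r)| <= 1)%N ->
  planar R (E :|: imgraph f H).
Proof.
move=> sH posI nc rmin sE /planar_midsquare [p [gamma [dr cg _ _]]] fI iso leaf.
have [rho [_ [/andP[r0 _] _ pp ap _]]] := separation dr cg.
have [pI arcs gp gg] := dr.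
have far4 x : 4 * rho < x -> x <= rho -> False by move=> *; lra.
have inrange (v : V) e : e \in E -> f v \in e -> v = r.
  move=> eE; have [x [y [_ ee]]] := simple_edge sE eE.
  move=> fe; apply/eqP; apply: contraTT fe => /iso i0.
  have noadj z : ~~ adj E (f v) z.
    by have : z \notin nbrs E (f v); [rewrite i0 inE|rewrite inE].
  rewrite ee !inE; apply/negP => /orP[] /eqP fv.
    by have := noadj y; rewrite /adj fv -ee eE.
  by have := noadj x; rewrite /adj fv finset.setUC -ee eE.
have uniq_e e e' : e \in E -> e' \in E -> f r \in e -> f r \in e' -> e = e'.
  move=> eE eE' re re'; move: leaf; rewrite -card_inc // => /card_le1_eqP; apply;
    by rewrite in_inc ?eE ?eE'.
pose o := p (f r).
(* [a] is the entry point and [eta] the arc up to it, oriented towards f r; without an edge at f r,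
   [a] is the centre. *)
have [a [eta [ao etaP]]] : exists a (eta : R -> R * R), dist a o <= rho /\
   forall e, e \in E -> f r \in e -> [/\ continuous eta, {in `[0, 1] &, injective eta},
     exists u, [/\ e = [set u; f r]%SET, eta 0 = p u & eta 1 = a],
     forall t : R, 0 <= t < 1 -> rho < dist (eta t) o &
     forall t : R, t \in `]0, 1[ -> exists2 s, s \in `]0, 1[ & eta t = gamma e s].
  have [/exists_inP[e eE re]|/exists_inPn noe] := boolP [exists e in E, f r \in e]; last first.
    exists o, (fun _ => o); split; first by rewrite distxx ltW.
    by move=> e /noe/negPf ->.
  have [_ gI [x [y [ee g0 g1]]]] := arcs e eE.
  have [d [dc dI [u [eu d0 d1]] dg]] : exists d : R -> R * R,
    [/\ continuous d, {in `[0, 1] &, injective d},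
      exists u, [/\ e = [set u; f r]%SET, d 0 = p u & d 1 = o] &
      forall t : R, t \in `]0, 1[ -> exists2 s, s \in `]0, 1[ & d t = gamma e s].
    have : f r = y \/ f r = x by move: re; rewrite ee !inE => /orP[]/eqP; [right|left].
    case=> fr.
      exists (gamma e); split=> //; first exact: cg.
        by exists x; rewrite fr; split=> //; rewrite /o fr.
      by move=> t tI; exists t.
    exists (fun t => gamma e (1 - t)); split.
    - move=> t; apply: (@cvg_comp _ _ _ (fun t => 1 - t) (gamma e) _ (nbhs (1 - t))).
        by apply: cvgB; [exact: cvg_cst|exact: cvg_id].
      exact: cg.
    - move=> s t sI tI /gI eqst.
      have : 1 - s = 1 - t.
        by apply: eqst; move: sI tI; rewrite !in_itv /= => /andP[? ?] /andP[? ?]; apply/andP; split; lra.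
      by lra.
    - exists y; rewrite fr finset.setUC subr0 subrr; split=> //; by rewrite /o fr.
    - move=> t; rewrite in_itv /= => /andP[? ?]; exists (1 - t) => //.
      by rewrite in_itv /=; apply/andP; split; lra.
  have uf : u != f r.
    by apply/eqP => uf; move/forall_inP: sE => /(_ e eE); rewrite eu uf finset.setUid cards1.
  have far : rho < dist (d 0) o by rewrite d0; have := pp _ _ uf; lra.
  have near1 : dist (d 1) o <= rho by rewrite d1 distxx ltW.
  have [tau [/andP[tau0 tau1] dtau taumin]] := first_time dc far near1.
  exists (d tau), (fun t => d (tau * t)); split=> // e' eE' re'.
  rewrite -(uniq_e e e') //.
  split.
  - move=> t; apply: (@cvg_comp _ _ _ (fun t => tau * t) d _ (nbhs (tau * t))); last exact: dc.
    by apply: cvgM; [exact: cvg_cst|exact: cvg_id].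
  - move=> s t; rewrite !in_itv /= => /andP[s0 s1] /andP[t0 t1] /dI eqst.
    have : tau * s = tau * t.
      by apply: eqst; rewrite in_itv /=; apply/andP; split; nra.
    by apply: mulfI; rewrite gt_eqF.
  - by exists u; rewrite mulr0 mulr1.
  - by move=> t /andP[t0 t1]; apply: taumin; apply/andP; split; nra.
  - move=> t; rewrite in_itv /= => /andP[t0 t1]; apply: dg; rewrite in_itv /=.
    by apply/andP; split; nra.
have [P [[PI Pr] Pnear Pseg Pv Pss]] := parabola_drawing posI nc rmin sH r0 ao.
have Pin v : dist (P v) o <= rho.
  by have [->|/Pnear/ltW //] := eqVneq v r; rewrite Pr.
pose p' z := if [pick v | f v == z] is Some v then P v else p z.
have p'f v : p' (f v) = P v.
  by rewrite /p'; case: pickP => [u /eqP/fI -> //|/(_ v)]; rewrite eqxx.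
have p'n z : (forall v, f v != z) -> p' z = p z.
  by move=> nz; rewrite /p'; case: pickP => // u; rewrite (negPf (nz u)).
pose gamma' e := if e \in E then (if f r \in e then eta else gamma e) else
  if [pick xy : V * V | adj H xy.1 xy.2 && (e == [set f xy.1; f xy.2]%SET)] is Some xy
  then seg (P xy.1) (P xy.2) else (fun _ => 0).
have old e : e \in E -> [/\ continuous (gamma' e), {in `[0, 1] &, injective (gamma' e)},
    exists x y, [/\ e = [set x; y]%SET, gamma' e 0 = p' x & gamma' e 1 = p' y],
    forall t : R, t \in `]0, 1[ -> rho < dist (gamma' e t) o &
    forall t : R, t \in `]0, 1[ -> exists2 s, s \in `]0, 1[ & gamma' e t = gamma e s].
  move=> eE; rewrite /gamma' eE; case: ifPn => [re|nre].
    have [ec eI [u [eu e0 e1]] efar es] := etaP e eE re.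
    have uf v : f v != u.
      apply/eqP => fv; have vr : v = r by apply: (inrange v e eE); rewrite eu fv !inE eqxx.
      by move/forall_inP: sE => /(_ e eE); rewrite eu -fv vr finset.setUid cards1.
    split=> //.
      by exists u, (f r); rewrite (p'n _ uf) p'f Pr.
    by move=> t; rewrite in_itv /= => /andP[t0 t1]; apply: efar; rewrite ltW.
  have [_ gI [x [y [ee g0 g1]]]] := arcs e eE.
  have nf z : z \in e -> forall v, f v != z.
    move=> ze v; apply/eqP => fv; move: nre.
    by rewrite -(inrange v e eE) ?fv ?ze.
  split=> //; first exact: cg.
  - have nx : forall v, f v != x by apply: nf; rewrite ee !inE eqxx.
    have ny : forall v, f v != y by apply: nf; rewrite ee !inE eqxx orbT.
    by exists x, y; rewrite (p'n _ nx) (p'n _ ny).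
  - by move=> t /itv_oc tI; have := ap e (f r) t eE nre tI; rewrite -/o; lra.
  - by move=> t tI; exists t.
have new e : e \in E :|: imgraph f H -> e \notin E -> exists x y, [/\ adj H x y,
    e = [set f x; f y]%SET & gamma' e = seg (P x) (P y)].
  rewrite inE => /orP[-> //|/(imgraphP sH)[x [y [xy ee]]]] nE.
  rewrite /gamma' (negPf nE); case: pickP => [[x' y'] /= /andP[xy' /eqP ee']|].
    by exists x', y'.
  by move/(_ (x, y)); rewrite /= xy ee eqxx.
have oldn e z t : e \in E -> t \in `]0, 1[ -> gamma' e t <> p' z.
  move=> eE tI; have [_ _ _ far /(_ t tI)[s sI es]] := old e eE.
  have [/existsP[v /eqP <-]|/existsPn nz] := boolP [exists v, f v == z].
    by rewrite p'f => eq; have := far t tI; rewrite eq ltNge Pin.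
  by rewrite (p'n _ nz) es; apply: gp.
exists p', gamma'; split.
- move=> y z.
  have [/existsP[v /eqP <-]|/existsPn ny] := boolP [exists v, f v == y];
  have [/existsP[w /eqP <-]|/existsPn nz] := boolP [exists v, f v == z].
  + by rewrite !p'f => /PI ->.
  + rewrite p'f (p'n _ nz) => eq; exfalso; apply: (far4 _ (pp _ _ (nz r))).
    by rewrite -eq distC.
  + rewrite p'f (p'n _ ny) => eq; exfalso; apply: (far4 _ (pp _ _ (ny r))).
    by rewrite eq distC.
  + by rewrite !p'n // => /pI.
- move=> e eE'; have [eE|nE] := boolP (e \in E).
    have [ec eI ee _ _] := old e eE; split=> //.
    exact: continuous_subspaceT.
  have [x [y [xy ee ->]]] := new e eE' nE; split.
  + by apply: continuous_subspaceT; apply: continuous_seg.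
  + move=> s t _ _; apply: seg_inj => /PI; apply/eqP; exact: adj_neq sH xy.
  + exists (f x), (f y); rewrite !p'f /seg; split=> //.
      by rewrite subr0 !mul1r !mul0r !addr0; case: (P x).
    by rewrite subrr !mul0r !mul1r !add0r; case: (P y).
- move=> e z t eE' tI; have [eE|nE] := boolP (e \in E); first exact: oldn.
  have [x [y [xy ee ->]]] := new e eE' nE.
  have [/existsP[v /eqP <-]|/existsPn nz] := boolP [exists v, f v == z].
    by rewrite p'f; apply: Pv.
  rewrite (p'n _ nz) => eq; exfalso; apply: (far4 _ (pp _ _ (nz r))).
  by rewrite -eq distC; apply/ltW/Pseg.
- move=> e e' s t eE1 eE2 ee sI tI.
  have [eE|nE] := boolP (e \in E); have [eE'|nE'] := boolP (e' \in E).
  + have [_ _ _ _ /(_ s sI)[s' sI' ->]] := old e eE.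
    have [_ _ _ _ /(_ t tI)[t' tI' ->]] := old e' eE'.
    exact: gg.
  + have [_ _ _ /(_ s sI) far _] := old e eE.
    have [x [y [xy _ ->]]] := new e' eE2 nE' => eq.
    by have := Pseg x y t xy tI; rewrite -eq ltNge (ltW far).
  + have [_ _ _ /(_ t tI) far _] := old e' eE'.
    have [x [y [xy _ ->]]] := new e eE1 nE => eq.
    by have := Pseg x y s xy sI; rewrite eq ltNge (ltW far).
  + have [x [y [xy e1 ->]]] := new e eE1 nE.
    have [x' [y' [xy' e2 ->]]] := new e' eE2 nE'.
    apply: Pss => //; apply: contra ee => /eqP xx.
    by rewrite e1 e2 -!imset_set2 xx.
Qed.

(** * Conclusion *)

Lemma planar_sub (R : realType) (V : finType) (E F : {set {set V}}) :
  F \subset E -> planar R E -> planar R F.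
Proof.
move=> /fintype.subsetP FE [p [gamma [pI arcs gp gg]]]; exists p, gamma; split=> //.
- by move=> e /FE; apply: arcs.
- by move=> e v t /FE; apply: gp.
- by move=> e e' s t /FE eE /FE; apply: gg.
Qed.

(** A single edge is a graph on [bool], hung at x. *)
Lemma planar_join (R : realType) (V : finType) (E : {set {set V}}) x y :
  simple_graph E -> planar R E -> x != y ->
  nbrs E x = finset.set0 -> nbrs E y = finset.set0 -> planar R ([set x; y] |: E)%SET.
Proof.
move=> sE pE xy nx ny; pose f b := if b then y else x.
have -> : ([set x; y] |: E)%SET = E :|: imgraph f [set [set false; true]]%SET.
  by rewrite finset.setUC /imgraph finset.imset_set1 imset_set2.
apply: (@hang _ _ _ _ _ nat_of_bool false) => //; try by case.
- by apply/forall_inP => e /finset.set1P ->; rewrite cards2.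
- by case; case.
- move=> a b c d; rewrite /adj !finset.in_set1.
  by case: a; case: b; case: c; case: d.
- by case; case=> //= e; move: xy; rewrite e eqxx.
- by rewrite nx cards0.
Qed.

Definition planar_class (R : realType) n (E : {set {set 'I_n}}) : bool := `[< planar R E >].

Lemma planar_class_like (R : realType) : planar_like (planar_class R).
Proof.
split.
- by move=> n E F FE /asboolP pE; apply/asboolP; apply: planar_sub pE.
- by move=> n E x y sE /asboolP pE xy nx ny; apply/asboolP; apply: planar_join.
- by move=> n E g sE /asboolP pE; apply: (planar_euler sE pE).
Qed.

Lemma planar_class_hangs (R : realType) (V : finType) (H : {set {set V}}) :
  simple_graph H -> unicyclic H -> exists r, hangs (planar_class R) H r.
Proof.
move=> sH uH; have [pos [r [posI nc rmin]]] := unicyclic_order sH uH.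
exists r => n E f sE /asboolP pE fI iso lf; apply/asboolP.
exact: hang sH posI nc rmin sE pE fI iso lf.
Qed.

Lemma planar_empty (R : realType) n : planar R (finset.set0 : {set {set 'I_n}}).
Proof.
exists (fun i : 'I_n => ((i : nat)%:R, 0)), (fun _ _ => (0, 0)); split.
- by move=> i j [/eqP]; rewrite eqr_nat => /eqP /val_inj.
- by move=> e; rewrite finset.inE.
- by move=> e v t; rewrite finset.inE.
- by move=> e e' s t; rewrite finset.inE.
Qed.

(** The whole fan is hung on the edgeless graph. Without this, the convention for the empty set
    would make the probability 0. *)
Lemma planar_graphs_neq0 (R : realType) n m : (m + 3 <= n.*2)%N ->
  (0 < #|planar_graphs R n m|)%N.
Proof.
case: n => [|[|n]]; rewrite ?addn3 // !doubleS !ltnS => /fan_graph[E [sE cE nc]]; apply/card_gt0P; exists E.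
rewrite finset.inE sE cE eqxx /=; apply/asboolP.
have n0 v : nbrs (finset.set0 : {set {set 'I_n.+2}}) v = finset.set0.
  by apply/finset.setP => w; rewrite !finset.inE /adj finset.inE.
have -> : E = (finset.set0 :|: imgraph (@id 'I_n.+2) E)%SET.
  rewrite finset.set0U /imgraph -[LHS]finset.imset_id; apply: eq_in_imset => e _.
  by rewrite finset.imset_id.
apply: (@hang _ _ _ _ _ val ord0) => //.
- by apply/forall_inP => e; rewrite finset.inE.
- exact: planar_empty.
- by rewrite n0 cards0.
Qed.

Lemma ratio_to1_near (R : realType) (m : nat -> nat) (Q : nat) :
  (fun n : nat => (m n)%:R / n%:R : R) @ \oo --> (1 : R) ->
  \forall n \near \oo, (Q * n <= Q * m n + n)%N /\ (Q * m n <= Q * n + n)%N.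
Proof.
move=> /cvgrPdist_le /(_ Q.+1%:R^-1); rewrite invr_gt0 ltr0n => /(_ isT) mn.
near=> n.
have n0 : 0 < n%:R :> R by rewrite ltr0n; near: n; exact: nbhs_infty_gt.
have : `|1 - (m n)%:R / n%:R| <= Q.+1%:R^-1 :> R by near: n.
have -> : 1 - (m n)%:R / n%:R = (n%:R - (m n)%:R) / n%:R :> R.
  by rewrite mulrBl divff ?gt_eqF.
rewrite normrM [`|_^-1|]gtr0_norm ?invr_gt0 //.
rewrite ler_pdivrMr // mulrC ler_pdivlMr ?ltr0n // => le.
have {}le : `|n%:R - (m n)%:R| * Q%:R <= n%:R :> R.
  by apply: le_trans le; rewrite ler_wpM2l // ler_nat.
have := le_trans (ler_wpM2r (ler0n R Q) (ler_norm _)) le.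
have := le_trans (ler_wpM2r (ler0n R Q) (ler_norm _)) (eq_ind _ (fun x => x * _ <= _) le _ (distrC _ _)).
rewrite !mulrBl !lerBlDr -!natrM -!natrD !ler_nat ![(_ * Q)%N]mulnC.
by rewrite ![(n + _)%N]addnC.
Unshelve. all: by end_near.
Qed.

Lemma prob_near1 (R : realType) (T : finType) (S : {set T}) (A : pred T) K : (0 < K)%N ->
  (0 < #|S|)%N -> (K * #|[set x in S | ~~ A x]%SET| <= #|S|)%N ->
  `|1 - prob_in R S A| <= K%:R^-1.
Proof.
move=> K0 S0 le; rewrite /prob_in; set c := #|[set x in S | ~~ A x]%SET| in le *.
have eS : #|S| = (#|[set x in S | A x]%SET| + c)%N.
  rewrite -(finset.cardsID [set x | A x]%SET S); congr (_ + _)%N; apply: eq_card => x.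
    by rewrite !finset.inE.
  by rewrite !finset.inE andbC.
have S0' : 0 < #|S|%:R :> R by rewrite ltr0n.
have -> : 1 - #|[set x in S | A x]%SET|%:R / #|S|%:R = c%:R / #|S|%:R :> R.
  have -> : c%:R = #|S|%:R - #|[set x in S | A x]%SET|%:R :> R by rewrite eS natrD addrC addKr.
  by rewrite mulrBl divff ?gt_eqF.
rewrite ger0_norm ?divr_ge0 // ler_pdivrMr // mulrC ler_pdivlMr ?ltr0n //.
by rewrite -natrM ler_nat mulnC.
Qed.

Theorem theorem5p5 (R : realType) (V : finType) (H : {set {set V}})
    (m : nat -> nat) :
  simple_graph H -> unicyclic H ->
  (fun n : nat => (m n)%:R / n%:R : R) @ \oo --> (1 : R) ->
  (fun n : nat => prob_in R (planar_graphs R n (m n)) (has_copy H))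
    @ \oo --> (1 : R).
Proof.
move=> sH uH mn; have [r hH] := planar_class_hangs R sH uH.
apply/cvgrPdist_le => e e0.
have [K K0 Ke] : exists2 K, (0 < K)%N & K%:R^-1 <= e.
  exists (Num.trunc e^-1).+1 => //; rewrite invf_ple ?posrE ?ltr0n //.
  by rewrite ltW // truncnS_gt.
have [Q [n0 rare]] := copy_free_rare (planar_class_like R) sH uH hH K0.
(* The factor 10 gives m <= 11 n / 10, well below the 2 n - 3 edges of a fan. *)
have ratio := ratio_to1_near Q mn; have ratio10 := ratio_to1_near 10 mn.
near=> n; apply: le_trans Ke; apply: prob_near1 => //.
  have n10 : (10 <= n)%N by near: n; exact: nbhs_infty_ge.
  have [_ le] : (10 * n <= 10 * m n + n)%N /\ (10 * m n <= 10 * n + n)%N by near: n.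
  by apply: planar_graphs_neq0; rewrite -mul2n; lia.
have [lo hi] : (Q * n <= Q * m n + n)%N /\ (Q * m n <= Q * n + n)%N by near: n.
by apply: rare lo hi; near: n; exact: nbhs_infty_ge.
Unshelve. all: by end_near.
Qed.
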